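(* Let $a<0$, $c<0$, $a_2>0$, $c_2>0$, $b>0$, $b_2>0$ be real constants and let $\omega$ satisfy $$0<|\omega|<\min\left\{1,\frac{-a}{b},\frac{-c}{b},\frac{a_2}{b_2},\frac{c_2}{b_2}\right\}.$$ Let $F:\mathbb{R}^4\to\mathbb{R}$ be a $C^2$ function with $F(0)=0$ satisfying conditions (a), (b), (c) described in the context. Let $((\psi_n,v_n))_n$ be a minimizing sequence for $S(\omega)$, i.e. $(\psi_n,v_n)\in\mathcal M_\omega\setminus\{0\}$ for all $n$ and $J_\omega(\psi_n,v_n)\to S(\omega)$. Then there exist a subsequence $((\psi_{n_k},v_{n_k}))_k$, a sequence of points $y_k\in\mathbb{R}$ and $(\psi_0,v_0)\in\mathcal M_\omega\setminus\{0\}$ such that $$(\psi_{n_k}(\cdot+y_k),v_{n_k}(\cdot+y_k))\to(\psi_0,v_0)\quad\text{in } X=H^2(\mathbb{R})\times H^2(\mathbb{R})\text{ as }k\to\infty,$$ and $J_\omega(\psi_0,v_0)=S(\omega)$. In particular $(\psi_0,v_0)$ is a minimizer of $J_\omega$ on $\mathcal M_\omega\setminus\{0\}$ and a weak solution of the traveling-wave system (a critical point of $J_\omega$ on $X$).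
   Context: Setting: traveling waves $\eta(x,t)=\psi(x-\omega t)$, $u(x,t)=v(x-\omega t)$ of a higher-order Boussinesq system with coefficients $b=d>0$, $b_2=d_2>0$, $a,c<0$, $a_2,c_2>0$; weak solutions of the traveling-wave equations are by definition the critical points of the functional $J_\omega$ below on $X=H^2(\mathbb{R})\times H^2(\mathbb{R})$. For $(\psi,v)\in X$ define $I_1(\psi,v)=\int_{\mathbb R}[\psi^2-c(\psi')^2+c_2(\psi'')^2+v^2-a(v')^2+a_2(v'')^2]\,dx$, $I_2(\psi,v)=\int_{\mathbb R}(\psi v+b\psi'v'+b_2\psi''v'')\,dx$, $I_\omega=I_1-2\omega I_2$. $F:\mathbb{R}^4\to\mathbb{R}$ is $C^2$ with $F(0)=0$, and $G(w)=w\cdot\nabla F(w)$ for $w\in\mathbb{R}^4$. Conditions: (a) there is $p>0$ with $w\cdot\nabla G(w)\ge (p+2)G(w)$ for all $w\in\mathbb{R}^4$; (b) there exist $0<q_1\le q_2<\infty$ and $C>0$ with $|D^2F(w)|\le C(|w|^{q_1}+|w|^{q_2})$ for all $w\in\mathbb{R}^4$; (c) there exist $u,v\in H^2(\mathbb{R})$ with $\int_{\mathbb R}F(u,u',v,v')\,dx>0$. $K(\psi,v)=\int_{\mathbb R}F(\psi,\psi',v,v')\,dx$, $N(\psi,v)=\int_{\mathbb R}G(\psi,\psi',v,v')\,dx$, $J_\omega=\tfrac12 I_\omega-K$, $P_\omega=I_\omega-N$ (so $P_\omega(\Psi)=\langle J_\omega'(\Psi),\Psi\rangle$), $\mathcal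 M_\omega=\{(\psi,v)\in X: P_\omega(\psi,v)=0\}$, and $S(\omega)=\inf\{J_\omega(\psi,v):(\psi,v)\in\mathcal M_\omega\setminus\{0\}\}$. *)

(* Defs.v *)
From HB Require Import structures.
From mathcomp Require Import all_boot all_order all_algebra.
From mathcomp Require Import all_classical all_reals all_analysis.
Set Implicit Arguments. Unset Strict Implicit. Unset Printing Implicit Defensive.
Import Order.TTheory GRing.Theory Num.Theory.
Import numFieldNormedType.Exports.
Local Open Scope classical_set_scope.
Local Open Scope ring_scope.

Section Defs.
Variable R : realType.

Definition RI (f : R -> R) : R := Rintegral (@lebesgue_measure R) setT f.

Definition L2 (f : R -> R) : Prop :=
  measurable_fun setT f /\
  (@lebesgue_measure R).-integrable setT (fun x => ((f x) ^+ 2)%:E).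

Definition test_fun (phi : R -> R) : Prop :=
  (forall (n : nat) (x : R), derivable (derive1n n phi) x 1) /\
  (exists M : R, forall x : R, M < `|x| -> phi x = 0).

Definition weak_deriv (f g : R -> R) : Prop :=
  forall phi, test_fun phi ->
    RI (fun x => f x * derive1 phi x) = - RI (fun x => g x * phi x).

(* An element of H^2(R) is represented by a triple (f, f', f'') of
   functions: f, its first and its second weak derivative. *)
Definition H2t : Type := ((R -> R) * (R -> R) * (R -> R))%type.
Definition h0 (u : H2t) := u.1.1.
Definition h1 (u : H2t) := u.1.2.
Definition h2 (u : H2t) := u.2.

Definition inH2 (u : H2t) : Prop :=
  L2 (h0 u) /\ L2 (h1 u) /\ L2 (h2 u) /\
  weak_deriv (h0 u) (h1 u) /\ weak_deriv (h1 u) (h2 u).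

Definition Xt : Type := (H2t * H2t)%type.
Definition inX (P : Xt) : Prop := inH2 P.1 /\ inH2 P.2.

Definition H2norm2 (u : H2t) : R :=
  RI (fun x => h0 u x ^+ 2 + h1 u x ^+ 2 + h2 u x ^+ 2).
Definition Xnorm2 (P : Xt) : R := H2norm2 P.1 + H2norm2 P.2.

Definition H2lin (s t : R) (u w : H2t) : H2t :=
  ((fun x => s * h0 u x + t * h0 w x, fun x => s * h1 u x + t * h1 w x),
    fun x => s * h2 u x + t * h2 w x).
Definition Xlin (s t : R) (P Q : Xt) : Xt :=
  (H2lin s t P.1 Q.1, H2lin s t P.2 Q.2).
Definition H2shift (y : R) (u : H2t) : H2t :=
  ((fun x => h0 u (x + y), fun x => h1 u (x + y)), fun x => h2 u (x + y)).
Definition Xshift (y : R) (P : Xt) : Xt := (H2shift y P.1, H2shift y P.2).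

Definition vec4 (a b c d : R) : 'rV[R]_4 := \row_(i < 4) [:: a; b; c; d]`_i.
Definition e4 (i : 'I_4) : 'rV[R]_4 := delta_mx 0 i.

Definition pd (i : 'I_4) (F : 'rV[R]_4 -> R) : 'rV[R]_4 -> R :=
  fun w => derive F w (e4 i).

Definition C2 (F : 'rV[R]_4 -> R) : Prop :=
  continuous F /\
  (forall i w, derivable F w (e4 i)) /\
  (forall i, continuous (pd i F)) /\
  (forall i j w, derivable (pd i F) w (e4 j)) /\
  (forall i j, continuous (pd j (pd i F))).

Definition Gof (F : 'rV[R]_4 -> R) : 'rV[R]_4 -> R :=
  fun w => \sum_(i < 4) w 0 i * pd i F w.

Definition condA (F : 'rV[R]_4 -> R) : Prop :=
  exists p : R, 0 < p /\
    forall w, \sum_(j < 4) w 0 j * pd j (Gof F) w >= (p + 2) * Gof F w.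

(* |D^2F(w)| <= C(|w|^q1 + |w|^q2), stated entrywise on the Hessian
   (all matrix norms on R^{4x4} and norms on R^4 are equivalent, C is free) *)
Definition condB (F : 'rV[R]_4 -> R) : Prop :=
  exists q1 q2 C : R, 0 < q1 /\ q1 <= q2 /\ 0 < C /\
    forall w i j, `|pd j (pd i F) w| <= C * (`|w| `^ q1 + `|w| `^ q2).

Definition Kf (F : 'rV[R]_4 -> R) (P : Xt) : R :=
  RI (fun x => F (vec4 (h0 P.1 x) (h1 P.1 x) (h0 P.2 x) (h1 P.2 x))).
Definition Nf (F : 'rV[R]_4 -> R) (P : Xt) : R :=
  RI (fun x => Gof F (vec4 (h0 P.1 x) (h1 P.1 x) (h0 P.2 x) (h1 P.2 x))).

Definition condC (F : 'rV[R]_4 -> R) : Prop :=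
  exists P : Xt, inX P /\ Kf F P > 0.

Definition I1 (a c a2 c2 : R) (P : Xt) : R :=
  RI (fun x => h0 P.1 x ^+ 2 - c * h1 P.1 x ^+ 2 + c2 * h2 P.1 x ^+ 2
             + h0 P.2 x ^+ 2 - a * h1 P.2 x ^+ 2 + a2 * h2 P.2 x ^+ 2).
Definition I2 (b b2 : R) (P : Xt) : R :=
  RI (fun x => h0 P.1 x * h0 P.2 x + b * h1 P.1 x * h1 P.2 x
             + b2 * h2 P.1 x * h2 P.2 x).
Definition Iom (a c a2 c2 b b2 om : R) (P : Xt) : R :=
  I1 a c a2 c2 P - 2 * om * I2 b b2 P.
Definition Jom (a c a2 c2 b b2 om : R) F (P : Xt) : R :=
  Iom a c a2 c2 b b2 om P / 2 - Kf F P.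
Definition Pom (a c a2 c2 b b2 om : R) F (P : Xt) : R :=
  Iom a c a2 c2 b b2 om P - Nf F P.

Definition Mom_nz (a c a2 c2 b b2 om : R) F (P : Xt) : Prop :=
  inX P /\ Pom a c a2 c2 b b2 om F P = 0 /\ Xnorm2 P != 0.

Definition Som (a c a2 c2 b b2 om : R) F : \bar R :=
  ereal_inf [set (Jom a c a2 c2 b b2 om F P)%:E | P in Mom_nz a c a2 c2 b b2 om F].

End Defs.

(* Main.v *)
(** The quadratic form [B] polarizing [Iom] is equivalent to the X-norm, and
    with [k = p + 2] the functional [E = J - P / k] dominates a positive multiple
    of [B].  Hence a minimizing sequence is bounded, and since small functions
    cannot lie on [Pom = 0], the pointwise size of its members is bounded below at
    suitable points; translate these to the origin.  Along an ultrafilter on the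
    indices [B (Phi n) Q] converges for every [Q], and the Riesz representation
    produces a weak limit [z], which is nonzero because point evaluations are
    bounded on X.  By a Brezis-Lieb splitting, [E], [Pom] and [Jom] decouple
    asymptotically into [z] and [Phi n - z].  An element with [Pom < 0] is scaled
    down onto the manifold [Pom = 0] and therefore has [E > S]; this excludes both
    [Pom z < 0] and [Pom z > 0].  So [Pom z = 0], [Jom z = S], [E (Phi n - z)] tends
    to 0, and the convergence is strong.  If [J' z D < 0] for some [D], the path
    [s z + t D] with small [t > 0] would still cross the manifold, at a level below
    [S]; hence [z] is critical. *)

Require Import Defs.
From HB Require Import structures.
From mathcomp Require Import all_boot all_order all_algebra.
From mathcomp Require Import all_classical all_reals all_analysis.
From mathcomp Require Import measurable_realfun.
From mathcomp Require Import ring lra.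
Import Order.TTheory GRing.Theory Num.Theory.
Import numFieldNormedType.Exports.
Local Open Scope classical_set_scope.
Local Open Scope ring_scope.

Set Implicit Arguments.
Unset Strict Implicit.
Unset Printing Implicit Defensive.

(** * Integrals and square-integrable functions *)

Section Integral.
Context {R : realType}.
Implicit Types f g h : R -> R.

Local Notation mu := (@lebesgue_measure R).

(** Elements of X are triples of plain functions, so integrals see them only up to null sets, while
    [nw P x] needs values. The analysis is therefore done on continuous representatives, and the
    form is handled without a quotient space. The exponent [k = p + 2] comes from (a): along a ray
    [Gof F (expR s *: w) * expR (- k * s)] is nondecreasing whatever the sign of G, and
    [Gof F w / k - F w] is nonnegative, which leaves the positive quadratic weight [1/2 - 1/k].
    Condition (a) also forces the gradient of F to vanish at 0, so that (b) bounds G by o(|w|^2)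
    there. The obstacle is the lost compactness on the line. Along an ultrafilter every bounded real
    sequence converges, which replaces a diagonal extraction over a dense set; a genuine subsequence
    is recovered at the end from the norm tending to 0. Dichotomy needs no separate treatment: since
    [E z > 0], the remainder has action tending to a value strictly below S, too little for an
    element with [Pom < 0]. No regularity of the manifold is used: criticality follows from the
    intermediate value theorem instead of a Lagrange multiplier. *)

Lemma aeW (P : set R) : (forall x, P x) -> {ae mu, forall x, P x}.
Proof. by move=> h; apply: (@filterE _ _ (ae_filter_ringOfSetsType mu)). Qed.

Lemma ae_imp (P Q : set R) : (forall x, P x -> Q x) ->
  {ae mu, forall x, P x} -> {ae mu, forall x, Q x}.
Proof. by move=> h; apply: (@filterS _ _ (ae_filter_ringOfSetsType mu)). Qed.

Lemma ae_imp2 (P Q S : set R) : (forall x, P x -> Q x -> S x) ->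
  {ae mu, forall x, P x} -> {ae mu, forall x, Q x} -> {ae mu, forall x, S x}.
Proof. by move=> h; apply: (@filterS2 _ _ (ae_filter_ringOfSetsType mu)). Qed.

Definition intg f := mu.-integrable setT (EFin \o f).

Lemma intg_measurable f : intg f -> measurable_fun setT f.
Proof. by move=> /measurable_int /measurable_EFinP. Qed.

Lemma intgD f g : intg f -> intg g -> intg (fun x => f x + g x).
Proof. by move=> If Ig; exact: (integrableD _ If Ig). Qed.

Lemma intgB f g : intg f -> intg g -> intg (fun x => f x - g x).
Proof. by move=> If Ig; exact: (integrableB _ If Ig). Qed.

Lemma intgZ (r : R) f : intg f -> intg (fun x => r * f x).
Proof. by move=> If; exact: (integrableZl _ r If). Qed.

Lemma intg_norm f : intg f -> intg (fun x => `|f x|).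
Proof. exact: integrable_norm. Qed.

Lemma intg_le f g : measurable_fun setT f -> intg g ->
  (forall x, `|f x| <= g x) -> intg f.
Proof.
move=> mf Ig fg; apply: le_integrable Ig => //; first exact/measurable_EFinP.
by move=> x _ /=; rewrite lee_fin (le_trans (fg x))// ler_norm.
Qed.

Lemma RID f g : intg f -> intg g -> RI (fun x => f x + g x) = RI f + RI g.
Proof. by move=> If Ig; exact: RintegralD. Qed.

Lemma RIB f g : intg f -> intg g -> RI (fun x => f x - g x) = RI f - RI g.
Proof. by move=> If Ig; exact: RintegralB. Qed.

Lemma RIZ (r : R) f : intg f -> RI (fun x => r * f x) = r * RI f.
Proof. by move=> If; exact: RintegralZl. Qed.

Lemma RI_ext f g : (forall x, f x = g x) -> RI f = RI g.
Proof. by move=> fg; congr RI; exact/funext. Qed.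

Lemma RI_ge0 f : (forall x, 0 <= f x) -> 0 <= RI f.
Proof. by move=> f0; apply: Rintegral_ge0. Qed.

Lemma RI_le f g : intg f -> intg g -> (forall x, f x <= g x) -> RI f <= RI g.
Proof. by move=> If Ig fg; apply: le_Rintegral. Qed.

Lemma RI_norm f : intg f -> `|RI f| <= RI (fun x => `|f x|).
Proof. by move=> If; exact: le_normr_Rintegral. Qed.

Lemma RI_norm_le f g : intg f -> intg g -> (forall x, `|f x| <= g x) ->
  `|RI f| <= RI g.
Proof.
move=> If Ig fg; apply: le_trans (RI_norm If) _.
by apply: RI_le => //; exact: intg_norm.
Qed.

Lemma RI_EFin f : intg f -> (RI f)%:E = (\int[mu]_x (f x)%:E)%E.
Proof. by move=> If; rewrite /RI /Rintegral fineK//; exact: integrable_fin_num. Qed.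

Lemma RI_ae f g : measurable_fun setT f -> measurable_fun setT g ->
  {ae mu, forall x, f x = g x} -> RI f = RI g.
Proof.
move=> mf mg fg; rewrite /RI /Rintegral; congr fine.
apply: ae_eq_integral => //; [exact/measurable_EFinP|exact/measurable_EFinP|].
by apply: ae_imp fg => x /= -> _.
Qed.

Lemma intg_ae f g : measurable_fun setT g ->
  {ae mu, forall x, f x = g x} -> intg f -> intg g.
Proof.
move=> mg fg If; have mf := intg_measurable If.
have /integrableP[_ fi] := If.
apply/integrableP; split; first exact/measurable_EFinP.
move: fi; congr (_ < _)%E; apply: ae_eq_integral => //.
- by apply: measurableT_comp => //; exact/measurable_EFinP.
- by apply: measurableT_comp => //; exact/measurable_EFinP.
- by apply: ae_imp fg => x /= -> _.
Qed.

Lemma L2_measurable f : L2 f -> measurable_fun setT f. Proof. by case. Qed.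

Lemma L2_intg_sqr f : L2 f -> intg (fun x => f x ^+ 2). Proof. by case. Qed.

Lemma L2_mul f g : L2 f -> L2 g -> intg (fun x => f x * g x).
Proof.
move=> [mf If] [mg Ig].
apply: (@intg_le _ (fun x => f x ^+ 2 + g x ^+ 2)).
- exact: measurable_funM.
- exact: intgD.
- move=> x; rewrite ler_norml; apply/andP; split; nra.
Qed.

Lemma L2_lin (s t : R) f g : L2 f -> L2 g -> L2 (fun x => s * f x + t * g x).
Proof.
move=> Lf Lg; split.
  by apply: measurable_funD; apply: measurable_funM => //; apply: L2_measurable.
have -> : (fun x => ((s * f x + t * g x) ^+ 2)%:E) =
  EFin \o (fun x => (s ^+ 2 * f x ^+ 2 + (2 * s * t) * (f x * g x)) + t ^+ 2 * g x ^+ 2).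
  by apply/funext => x /=; congr EFin; ring.
by apply: intgD; [apply: intgD|]; apply: intgZ => //;
  (exact: L2_intg_sqr || exact: L2_mul).
Qed.

Lemma L2_ae f g : measurable_fun setT g ->
  {ae mu, forall x, f x = g x} -> L2 f -> L2 g.
Proof.
move=> mg fg [mf If]; split => //.
apply: (@intg_ae (fun x => f x ^+ 2)) => //; first exact: measurable_funX.
by apply: ae_imp fg => x /= ->.
Qed.

Definition ip f g := RI (fun x => f x * g x).

Lemma ipC f g : ip f g = ip g f.
Proof. by apply: RI_ext => x; rewrite mulrC. Qed.

Lemma ip_linl (s t : R) f g h : L2 f -> L2 g -> L2 h ->
  ip (fun x => s * f x + t * g x) h = s * ip f h + t * ip g h.
Proof.
move=> Lf Lg Lh; rewrite /ip -!RIZ -?RID; try apply: intgZ; try exact: L2_mul.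
by apply: RI_ext => x; ring.
Qed.

Lemma ip_linr (s t : R) f g h : L2 f -> L2 g -> L2 h ->
  ip h (fun x => s * f x + t * g x) = s * ip h f + t * ip h g.
Proof. by move=> *; rewrite ipC ip_linl// !(ipC h). Qed.

Lemma ip_sqr f : ip f f = RI (fun x => f x ^+ 2).
Proof. by apply: RI_ext => x; rewrite expr2. Qed.

Lemma ip_ge0 f : 0 <= ip f f.
Proof. by apply: RI_ge0 => x; rewrite -expr2 sqr_ge0. Qed.

Lemma ip_AMGM (r : R) f g : L2 f -> L2 g ->
  2 * r * ip f g <= ip f f + r ^+ 2 * ip g g.
Proof.
move=> Lf Lg; have := ip_ge0 (fun x => 1 * f x + (- r) * g x).
by rewrite !(ip_linl, ip_linr)//; [rewrite (ipC g f); lra|exact: L2_lin].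
Qed.

Lemma ip_CS f g : L2 f -> L2 g -> ip f g ^+ 2 <= ip f f * ip g g.
Proof.
move=> Lf Lg; have [g0|] := eqVneq (ip g g) 0.
  have [->|fg0] := eqVneq (ip f g) 0; first by rewrite g0 expr0n mulr0.
  (* With [ip g g = 0] the right side no longer depends on [r]; this [r] makes the left side
     [ip f f + 1], a contradiction. *)
  have := ip_AMGM ((ip f f + 1) / (2 * ip f g)) Lf Lg.
  have -> : 2 * ((ip f f + 1) / (2 * ip f g)) * ip f g = ip f f + 1 by field.
  by rewrite g0 mulr0; lra.
move=> g0; have gp : 0 < ip g g by rewrite lt_neqAle eq_sym g0 ip_ge0.
have := ip_AMGM (ip f g / ip g g) Lf Lg.
have -> : (ip f g / ip g g) ^+ 2 * ip g g = ip f g ^+ 2 / ip g g by field.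
have -> : 2 * (ip f g / ip g g) * ip f g = 2 * (ip f g ^+ 2 / ip g g) by field.
by move=> h; rewrite -ler_pdivrMr//; lra.
Qed.

End Integral.

(** * Translation invariance of the integral *)

Section Shift.
Context {R : realType}.
Implicit Types f g h : R -> R.
Local Notation mu := (@lebesgue_measure R).

Lemma measurable_shift (y : R) : measurable_fun setT (fun x : R => x + y).
Proof. by apply: measurable_funD. Qed.

(** Lebesgue measure is determined by its values on half-open intervals, whose length translation
    preserves. *)
Lemma lebesgue_measure_shift (y : R) (A : set R) : measurable A ->
  mu A = pushforward mu (fun x : R => x + y) A.
Proof.
move=> mA.
have mphi : measurable_fun [set: measurableTypeR R]
  ((fun x : R => x + y) : measurableTypeR R -> measurableTypeR R) := measurable_shift y.
pose mf := isMeasurableFun.Build _ _ _ _ _ mphi.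
pose phi : {mfun (measurableTypeR R) >-> (measurableTypeR R)} := HB.pack ((fun x : R => x + y) : measurableTypeR R -> measurableTypeR R) mf.
have := @lebesgue_measure_unique R (pushforward mu phi).
apply => // X [[a b] /= _ <-].
rewrite /pushforward.
have -> : (fun x : R => x + y) @^-1` `]a, b] = `]a - y, b - y]%classic.
  by apply/seteqP; split => x /=; rewrite !in_itv/= ltrBlDr lerBrDr.
by rewrite !lebesgue_measure_itv/= !lte_fin ltrD2r; case: ifP => // _;
  rewrite -!EFinB opprB addrA subrK.
Qed.

Lemma ge0_integral_shift (y : R) (f : R -> \bar R) : measurable_fun setT f ->
  (forall x, 0 <= f x)%E ->
  (\int[mu]_x f (x + y)%R = \int[mu]_x f x)%E.
Proof.
move=> mf f0; have mphi : measurable_fun [set: measurableTypeR R]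
  ((fun x : R => x + y) : measurableTypeR R -> measurableTypeR R) := measurable_shift y.
pose mfx := isMeasurableFun.Build _ _ _ _ _ mphi.
pose phi : {mfun (measurableTypeR R) >-> (measurableTypeR R)} := HB.pack ((fun x : R => x + y) : measurableTypeR R -> measurableTypeR R) mfx.
transitivity (\int[pushforward mu phi]_x f x)%E.
  by rewrite ge0_integral_pushforward.
by apply: eq_measure_integral => A mA _; apply: (esym (lebesgue_measure_shift y mA)).
Qed.

Lemma RI_shift (y : R) f : measurable_fun setT f ->
  RI (fun x => f (x + y)) = RI f.
Proof.
move=> mf; rewrite /RI /Rintegral; congr fine.
have mEf : measurable_fun setT (EFin \o f) by exact/measurable_EFinP.
rewrite integralE [RHS]integralE; congr (_ - _)%E.
- rewrite -(ge0_integral_shift y (f := (EFin \o f)^\+%E) (measurable_funepos mEf))//.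
  by apply: eq_integral => x _; rewrite !funeposE.
- rewrite -(ge0_integral_shift y (f := (EFin \o f)^\-%E) (measurable_funeneg mEf))//.
  by apply: eq_integral => x _; rewrite !funenegE.
Qed.

Lemma intg_shift (y : R) f : intg f -> intg (fun x => f (x + y)).
Proof.
move=> /integrableP[mf fi]; apply/integrableP; split.
  apply/measurable_EFinP; apply: (@measurableT_comp _ _ _ _ _ _ f) => //.
    exact/measurable_EFinP.
  exact: measurable_shift.
rewrite (ge0_integral_shift y (f := fun x => `|(f x)%:E|%E))//.
by apply: measurableT_comp.
Qed.

Lemma L2_shift (y : R) f : L2 f -> L2 (fun x => f (x + y)).
Proof.
move=> [mf If]; split; last exact: (intg_shift y If).
by apply: (@measurableT_comp _ _ _ _ _ _ f) => //; exact: measurable_shift.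
Qed.

End Shift.

Lemma cvg_EFin_comp {R : realType} {T : Type} (U : set_system T) {FU : Filter U}
  (u : T -> R) (l : R) : u @ U --> l -> (EFin \o u) @ U --> l%:E.
Proof. by move=> ul; apply: cvg_EFin => //; exact: nearW. Qed.

(** * Completeness of L^2 *)

Section Complete.
Context {R : realType}.
Implicit Types f g h : R -> R.
Local Notation mu := (@lebesgue_measure R).

(** Almost everywhere [h] equals the lower limit, to which Fatou's lemma applies; the lower limit is
    measurable as minus the upper limit of the opposites. *)
Lemma fatou_ae (h_ : nat -> R -> R) h (e : R) :
  (forall n, intg (h_ n)) -> (forall n x, 0 <= h_ n x) ->
  measurable_fun setT h ->
  {ae mu, forall x, h_ ^~ x @ \oo --> h x} ->
  (\forall n \near \oo, RI (h_ n) <= e) ->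
  (\int[mu]_x (h x)%:E <= e%:E)%E.
Proof.
move=> Ih h0 mh hh he.
have mh_ n : measurable_fun setT (EFin \o h_ n).
  by apply/measurable_EFinP; apply: intg_measurable.
have -> : (\int[mu]_x (h x)%:E = \int[mu]_x limn_einf (fun n => (h_ n x)%:E))%E.
  apply: ae_eq_integral => //; first exact/measurable_EFinP.
    rewrite (_ : (fun x => _) = (fun x => - limn_esup (fun n => - (h_ n x)%:E))%E).
      apply: measurableT_comp => //; apply: measurable_fun_limn_esup => n.
      by apply: (@measurableT_comp _ _ _ _ _ _ (-%E) _ (EFin \o h_ n)).
    by apply/funext => x; rewrite -limn_einfN; congr limn_einf; apply/funext => n /=;
      rewrite ?opprK.
  apply: ae_imp hh => x hx _; apply/esym.
  have hE : (h_ n x)%:E @[n --> \oo] --> (h x)%:E by exact: cvg_EFin_comp.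
  rewrite is_cvg_limn_einfE; first exact: cvg_lim.
  by apply/cvg_ex; eexists; exact: hE.
have h0' n x : setT x -> (0 <= (EFin \o h_ n) x)%E by rewrite lee_fin.
apply: le_trans (fatou mu measurableT mh_ h0') _.
rewrite limn_einf_lim; apply: lime_le; first exact: is_cvg_einfs.
apply: filterS he => n hn; apply: ge_ereal_inf.
by exists (RI (h_ n))%:E => //; exists n => //=; rewrite RI_EFin.
Qed.

Lemma L2_sqr_subl f g : L2 f -> L2 g -> intg (fun x => (f x - g x) ^+ 2).
Proof.
move=> Lf Lg; have [_] := L2_lin 1 (-1) Lf Lg; congr (is_true (integrable _ _ _)).
by apply/funext => x; rewrite mul1r mulN1r.
Qed.

Lemma ge0_intg f (e : R) : measurable_fun setT f -> (forall x, 0 <= f x) ->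
  (\int[mu]_x (f x)%:E <= e%:E)%E -> intg f /\ RI f <= e.
Proof.
move=> mf f0 fe; have If : intg f.
  apply/integrableP; split; first exact/measurable_EFinP.
  under eq_integral do rewrite /= ger0_norm//.
  by apply: le_lt_trans fe _; rewrite ltry.
by split => //; rewrite -lee_fin RI_EFin.
Qed.

Lemma cvg_seq_geometric (u : nat -> R) (C : R) :
  (forall n, `|u n.+1 - u n| <= C * 2^-1 ^+ n) -> cvgn u.
Proof.
move=> uC.
have h : cvgn (series (fun n => u n.+1 - u n)).
  apply: normed_cvg; apply: (@series_le_cvg _ _ (geometric C 2^-1)) => //.
  - by move=> n /=.
  - by move=> n; apply: le_trans (normr_ge0 _) (uC n).
  - by apply: is_cvg_geometric_series; rewrite gtr0_norm; lra.
have -> : u = (fun n => u 0%N + series (fun n => u n.+1 - u n) n).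
  apply/funext => n; rewrite /series/= telescope_sumr//; ring.
by apply: is_cvgD => //; exact: is_cvg_cst.
Qed.

(** The weights [4 ^+ n] absorb one factor of the hypothesis and leave a summable series of
    integrals. Its sum is finite almost everywhere, so there the increments are O(2^-n). *)
Lemma L2_subseq_cvg (f_ : nat -> R -> R) :
  (forall n, L2 (f_ n)) ->
  (forall n, RI (fun x => (f_ n.+1 x - f_ n x) ^+ 2) <= 2^-1 ^+ n * 4^-1 ^+ n) ->
  {ae mu, forall x, cvgn (f_ ^~ x)}.
Proof.
move=> Lf fb.
pose d n x := 4 ^+ n * (f_ n.+1 x - f_ n x) ^+ 2.
have Id n : intg (d n) by apply: intgZ; exact: L2_sqr_subl.
have d0 n x : 0 <= d n x by apply: mulr_ge0; [exact: exprn_ge0|exact: sqr_ge0].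
have mE n : measurable_fun setT (EFin \o d n).
  by apply/measurable_EFinP; exact: intg_measurable.
have Sb : (\int[mu]_x (\sum_(n <oo) (d n x)%:E) < +oo)%E.
  rewrite integral_nneseries//; last by move=> n x _; rewrite lee_fin.
  apply: (@le_lt_trans _ _ (\sum_(n <oo) (geometric 1 2^-1 n)%:E)%E).
    apply: lee_nneseries => [n _ _|n _].
      by apply: integral_ge0 => x _; rewrite lee_fin.
    rewrite -RI_EFin// lee_fin RIZ ?L2_sqr_subl// /geometric/= mul1r.
    apply: le_trans (ler_wpM2l _ (fb n)) _; first exact: exprn_ge0.
    by rewrite mulrCA -exprMn mulfV// expr1n mulr1.
  have /cvg_ex[l hl] : cvgn (series (geometric (1:R) 2^-1)).
    by apply: is_cvg_geometric_series; rewrite gtr0_norm; lra.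
  suff -> : (\sum_(n <oo) (geometric 1 2^-1 n)%:E = l%:E)%E by rewrite ltry.
  apply/cvg_lim => //.
  have -> : (fun n => \sum_(0 <= k < n) (geometric 1 2^-1 k)%:E)%E =
            EFin \o series (geometric (1:R) 2^-1).
    by apply/funext => n /=; rewrite sumEFin.
  exact: cvg_EFin_comp.
have IS : mu.-integrable setT (fun x => \sum_(n <oo) (d n x)%:E)%E.
  apply/integrableP; split.
    apply: (ge0_emeasurable_sum (h := fun n x => (d n x)%:E) (P := xpredT)) => //.
    by move=> n x _ _; rewrite lee_fin.
    by move=> n _; exact: mE.
  move: Sb; congr (_ < _)%E; apply: eq_integral => x _.
  by rewrite gee0_abs// nneseries_ge0// => n _ _; rewrite lee_fin.
have := integrable_ae measurableT IS.
apply: ae_imp => x /(_ I) fx.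
have [C hC] : exists C : R, (\sum_(n <oo) (d n x)%:E = C%:E)%E.
  by exists (fine (\sum_(n <oo) (d n x)%:E)%E); rewrite fineK.
apply: (@cvg_seq_geometric _ (C + 1)) => n.
have : d n x <= C.
  rewrite -lee_fin -hC; apply: (@le_trans _ _ (\sum_(0 <= k < n.+1) (d k x)%:E)%E).
    rewrite big_nat_recr//= leeDr// sume_ge0// => k _; by rewrite lee_fin.
  by apply: nneseries_lim_ge => *; rewrite lee_fin.
rewrite /d; set a := f_ n.+1 x - f_ n x => h.
have {h} : (2 ^+ n * `|a|) ^+ 2 <= C.
  by rewrite exprMn real_normK ?num_real// -exprM mulnC exprM expr2 -natrM.
set q := 2 ^+ n * `|a| => h.
have q1 : q <= C + 1 by nra.
have -> : `|a| = q * 2^-1 ^+ n by rewrite /q mulrAC -exprMn mulfV// expr1n mul1r.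
by rewrite ler_pM2r// exprn_gt0// invr_gt0.
Qed.

(** Riesz-Fischer: a subsequence with geometrically small gaps converges almost everywhere, and
    Fatou's lemma along it bounds the distance from any late term to the limit. *)
Lemma L2_complete (f_ : nat -> R -> R) :
  (forall n, L2 (f_ n)) ->
  (forall e : R, 0 < e -> exists N, forall m n, (N <= m)%N -> (N <= n)%N ->
     RI (fun x => (f_ m x - f_ n x) ^+ 2) <= e) ->
  exists g, L2 g /\ RI (fun x => (f_ n x - g x) ^+ 2) @[n --> \oo] --> 0.
Proof.
move=> Lf fC.
have /choice[N hN] : forall j : nat, exists N, forall m n, (N <= m)%N -> (N <= n)%N ->
     RI (fun x => (f_ m x - f_ n x) ^+ 2) <= 2^-1 ^+ j * 4^-1 ^+ j.
  by move=> j; apply: fC; rewrite mulr_gt0// exprn_gt0// invr_gt0.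
(* [n_ j] is at least [N j] for the rate, at least [j] so that it tends to infinity, and at least
   its predecessor for monotonicity. *)
pose n_ := fix n_ j := if j is j'.+1 then maxn (N j'.+1) (maxn j'.+1 (n_ j')) else N 0%N.
have n_N j : (N j <= n_ j)%N by case: j => //= j; rewrite leq_maxl.
have n_S j : (n_ j <= n_ j.+1)%N by rewrite /= !leq_max leqnn !orbT.
have n_j j : (j <= n_ j)%N by case: j => //= j; rewrite !leq_max leqnn !orbT.
have acvg : {ae mu, forall x, cvgn (fun j => f_ (n_ j) x)}.
  apply: (@L2_subseq_cvg (fun j => f_ (n_ j))) => // j.
  by apply: hN => //; apply: leq_trans (n_S _).
(* An upper limit is measurable without knowing that the sequence converges; its value on the null
   set of divergence is immaterial. *)
pose g x := fine (limn_esup (fun j => (f_ (n_ j) x)%:E)).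
have mg : measurable_fun setT g.
  apply: measurableT_comp => //; apply: measurable_fun_limn_esup => j.
  by apply/measurable_EFinP; apply: L2_measurable.
have fg : {ae mu, forall x, f_ (n_ j) x @[j --> \oo] --> g x}.
  apply: ae_imp acvg => x /cvg_ex[l hl].
  suff -> : g x = l by [].
  rewrite /g; have hE : (f_ (n_ j) x)%:E @[j --> \oo] --> l%:E by exact: cvg_EFin_comp.
  rewrite is_cvg_limn_esupE; last by apply/cvg_ex; eexists; exact: hE.
  by rewrite (cvg_lim _ hE).
have key e : 0 < e -> exists M, forall m, (M <= m)%N ->
    intg (fun x => (f_ m x - g x) ^+ 2) /\ RI (fun x => (f_ m x - g x) ^+ 2) <= e.
  move=> /fC[M hM]; exists M => m Mm; apply: ge0_intg.
  - by apply: measurable_funX; apply: measurable_funB => //; exact: L2_measurable.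
  - by move=> x; rewrite sqr_ge0.
  apply: (@fatou_ae (fun j x => (f_ m x - f_ (n_ j) x) ^+ 2)) => //.
  - by move=> j; exact: L2_sqr_subl.
  - by move=> j x; rewrite sqr_ge0.
  - by apply: measurable_funX; apply: measurable_funB => //; exact: L2_measurable.
  - apply: ae_imp fg => x hx.
    have hB : f_ m x - f_ (n_ j) x @[j --> \oo] --> f_ m x - g x.
      by apply: cvgB => //; exact: cvg_cst.
    exact: (cvgM hB hB).
  - by exists M => // j /= Mj; apply: hM => //; apply: leq_trans (n_j j).
exists g; split.
  have [M /(_ M (leqnn M))[IM _]] := key 1 ltr01.
  have LM : L2 (fun x => f_ M x - g x).
    by split => //; apply: measurable_funB => //; exact: L2_measurable.
  have := L2_lin 1 (-1) (Lf M) LM; congr L2; apply/funext => x; ring.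
apply/cvgrPdist_le => e e0; have [M hM] := key e e0.
exists M => // m /= Mm; rewrite sub0r normrN ger0_norm; first by have [] := hM m Mm.
by apply: RI_ge0 => x; rewrite sqr_ge0.
Qed.

End Complete.

(** * Differential calculus on the line and on R^4 *)

Section OneVar.
Context {R : realType}.
Implicit Types f g df : R -> R.

Lemma is_deriveP f (x l : R) :
  is_derive x 1 f l <-> h^-1 * (f (h + x) - f x) @[h --> 0^'] --> l.
Proof.
have E : (fun h : R => h^-1 *: ((f \o shift x) (h *: (1 : R)) - f x)) =
         (fun h => h^-1 * (f (h + x) - f x)).
  by apply/funext => h; rewrite /= /GRing.scale/= mulr1.
split=> [[fx <-]|fl]; first by move: fx; rewrite /derivable /derive E.
split; rewrite /derivable /derive E; first by apply/cvg_ex; exists l.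
exact: cvg_lim.
Qed.

Lemma is_derive_add f g (x a b : R) : is_derive x 1 f a -> is_derive x 1 g b ->
  is_derive x 1 (fun t => f t + g t) (a + b).
Proof. by move=> ? ?; exact: is_deriveD. Qed.

Lemma is_derive_sub f g (x a b : R) : is_derive x 1 f a -> is_derive x 1 g b ->
  is_derive x 1 (fun t => f t - g t) (a - b).
Proof. by move=> ? ?; exact: is_deriveB. Qed.

Lemma is_derive_mul f g (x a b : R) : is_derive x 1 f a -> is_derive x 1 g b ->
  is_derive x 1 (fun t => f t * g t) (f x * b + g x * a).
Proof. by move=> ? ?; exact: is_deriveM. Qed.

Lemma is_derive_scale (c : R) f (x a : R) : is_derive x 1 f a ->
  is_derive x 1 (fun t => c * f t) (c * a).
Proof. by move=> ?; exact: is_deriveZ. Qed.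

Lemma is_derive_comp f g (x a b : R) : is_derive (g x) 1 f a -> is_derive x 1 g b ->
  is_derive x 1 (fun t => f (g t)) (a * b).
Proof. by move=> ? ?; exact: is_derive1_comp. Qed.

Lemma is_derive_within f df (a b : R) :
  (forall x, a <= x <= b -> is_derive x 1 f (df x)) -> {within `[a, b], continuous f}.
Proof.
move=> fd; apply: continuous_in_subspaceT => x; rewrite inE/= in_itv/= => xab.
by apply/differentiable_continuous/derivable1_diffP; have [] := fd x xab.
Qed.

Lemma MVT_derive f df (a b : R) : a <= b ->
  (forall x, a <= x <= b -> is_derive x 1 f (df x)) ->
  exists2 c, a <= c <= b & f b - f a = df c * (b - a).
Proof.
move=> ab fd.
have [x|c cab ->] := @MVT_segment R f df a b ab _ (is_derive_within fd).
  by rewrite in_itv/= => /andP[/ltW ax /ltW xb]; apply: fd; rewrite ax.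
by exists c => //; move: cab; rewrite in_itv.
Qed.

Lemma derive_ge0_le f df (a b : R) : a <= b ->
  (forall x, a <= x <= b -> is_derive x 1 f (df x)) ->
  (forall x, a < x < b -> 0 <= df x) -> f a <= f b.
Proof.
rewrite le_eqVlt => /predU1P[->//|ab] fd fd0.
have [x|c] := @MVT R f df a b ab _ (is_derive_within fd).
  by rewrite in_itv/= => /andP[/ltW ax /ltW xb]; apply: fd; rewrite ax.
rewrite in_itv/= => /fd0 c0 fE; rewrite -subr_ge0 fE mulr_ge0// subr_ge0.
exact: ltW.
Qed.

End OneVar.

(** * Row vectors and measurability of composites *)

Section RowVectors.
Context {R : realType} {n : nat}.
Implicit Types x y w : 'rV[R]_n.

Lemma coord_le_norm x i : `|x 0 i| <= `|x|.
Proof.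
rewrite [leRHS]/Num.norm /= mx_normrE.
by apply/bigmax_geP; right => /=; exists (0, i).
Qed.

Lemma norm_rv_le x (r : R) : 0 <= r -> (forall i, `|x 0 i| <= r) -> `|x| <= r.
Proof.
move=> r0 xr; rewrite [leLHS]/Num.norm /= mx_normrE.
by apply/bigmax_leP; split => // -[i j] _ /=; rewrite ord1.
Qed.

Lemma norm_rv_lt x (r : R) : 0 < r -> (forall i, `|x 0 i| < r) -> `|x| < r.
Proof.
move=> r0 xr; rewrite [ltLHS]/Num.norm /= mx_normrE.
by apply/bigmax_ltP; split => // -[i j] _ /=; rewrite ord1.
Qed.

(** The norm of row vectors is the maximum norm, attained at some coordinate. *)
Lemma norm_rv_sqr_le x : `|x| ^+ 2 <= \sum_i x 0 i ^+ 2.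
Proof.
have [->|x0] := eqVneq x 0.
  by rewrite normr0 expr0n sumr_ge0// => i _; exact: sqr_ge0.
have [[i j] /= ->] : exists i, `|x| = `|x i.1 i.2|.
  by apply: mx_norm_neq0; rewrite -[mx_norm x]/(`|x|) normr_eq0.
rewrite ord1 real_normK ?num_real// (bigD1 j)//= lerDl sumr_ge0// => k _.
exact: sqr_ge0.
Qed.

Lemma cvg_rv (T : Type) (U : set_system T) {FU : Filter U} (f : T -> 'rV[R]_n) y :
  (forall i, f t 0 i @[t --> U] --> y 0 i) -> f @ U --> y.
Proof.
move=> fy; apply/cvgrPdist_lt => e e0.
have : \forall t \near U, forall i, `|y 0 i - f t 0 i| < e.
  by apply: filter_forall => i; have /cvgrPdist_lt/(_ e e0) := fy i.
by apply: filterS => t h; apply: norm_rv_lt => // i; rewrite !mxE.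
Qed.

(** The preimage of an open interval by [F] is an open set of vectors, hence a countable union of
    boxes with rational centres; pulling a box back by the coordinates gives a finite intersection
    of measurable sets. *)
Lemma measurable_fun_rv_comp (F : 'rV[R]_n -> R) (f : 'I_n -> R -> R) :
  continuous F -> (forall i, measurable_fun setT (f i)) ->
  measurable_fun setT (fun x : R => F (\row_i f i x)).
Proof.
move=> cF mf; apply: (measurability _ (RGenOpens.measurableE R)).
move=> _ [_ [a [b ->]] <-]; rewrite setTI.
have oU : open (F @^-1` `]a, b[%classic).
  by apply: open_comp => [x _|]; [exact: cF|exact: interval_open].
set U := F @^-1` _ in oU.
pose Q (q : 'rV[rat]_n) : 'rV[R]_n := \row_i ratr (q 0 i).
(* Centre [Q p.1], radius [1/(p.2 + 1)]. The first clause does not involve [x], so [B p] is either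
   empty or the whole preimage of the box. *)
pose B (p : 'rV[rat]_n * nat) : set R := [set x | (forall y, `|Q p.1 - y| < p.2.+1%:R^-1 -> U y) /\
    forall i, `|ratr (p.1 0 i) - f i x| < p.2.+1%:R^-1].
have -> : (fun x : R => F (\row_i f i x)) @^-1` `]a, b[%classic = \bigcup_p B p.
  apply/seteqP; split=> [x xU|x [[q k] _ [/= h1 h2]]]; last first.
    apply: h1; apply: norm_rv_lt; first by rewrite invr_gt0.
    by move=> i; rewrite !mxE.
  have /nbhs_ballP[e /= e0 he] : nbhs (\row_i f i x) U by exact: open_nbhs_nbhs.
  have [k _ hk] := near_infty_natSinv_lt (PosNum (divr_gt0 e0 (ltr0n _ 2))).
  have {}hk : k.+1%:R^-1 < e / 2 by have := hk k (leqnn k).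
  have k0 : 0 < k.+1%:R^-1 :> R by rewrite invr_gt0.
  have /choice[q hq] : forall i, exists q : rat, `|ratr q - f i x| < k.+1%:R^-1.
    move=> i; have := @dense_rat R (ball (f i x) k.+1%:R^-1).
    case; [by exists (f i x); exact: ballxx|exact: ball_open|].
    by move=> z [h [q _ qz]]; exists q; rewrite qz distrC.
  exists (\row_i q i, k) => //; split => [y|i]; last by rewrite mxE.
  move=> /= hy; apply: he; rewrite -ball_normE /=.
  rewrite -(subrKA (Q (\row_i q i))); apply: le_lt_trans (ler_normD _ _) _.
  rewrite [e]splitr; apply: ltrD; last exact: lt_trans hy hk.
  apply: le_lt_trans hk; apply: norm_rv_le; first exact: ltW.
  by move=> i; rewrite !mxE distrC; exact/ltW/hq.
apply: countable_bigcupT_measurable => // -[q k].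
have [hU|hU] := pselect (forall y, `|Q q - y| < k.+1%:R^-1 -> U y); last first.
  rewrite [B _](_ : _ = set0)//; apply/seteqP; split => // x [].
  by move=> /hU.
rewrite [B _](_ : _ = \bigcap_(i in [set: 'I_n]) (f i @^-1` (ball (ratr (q 0 i) : R) k.+1%:R^-1))).
  apply: fin_bigcap_measurable => // i _; rewrite -[X in measurable X]setTI.
  by apply: mf => //; exact: measurable_ball.
apply/seteqP; split => x /=; first by move=> [_ h] i _; exact: h.
by move=> h; split => // i; exact: h.
Qed.

End RowVectors.

Lemma cvg_sumr {R : realType} {T : Type} (U : set_system T) {FU : Filter U}
    (I : finType) (f : I -> T -> R) (l : I -> R) :
  (forall i, f i @ U --> l i) -> \sum_i f i t @[t --> U] --> \sum_i l i.
Proof.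
move=> fl; elim: (index_enum I) => [|i s IH].
  by rewrite big_nil; under eq_fun do rewrite big_nil; exact: cvg_cst.
by rewrite big_cons; under eq_fun do rewrite big_cons; exact: cvgD (fl i) IH.
Qed.

(** * Mean value theorem and chain rule from partial derivatives *)

Section Calculus4.
Context {R : realType}.
Implicit Types (H F : 'rV[R]_4 -> R) (x y w v : 'rV[R]_4).

Definition C1 H := (forall i w, derivable H w (e4 R i)) /\ forall i, continuous (pd i H).

Lemma is_derive_coord H i w (s : R) : (forall w, derivable H w (e4 R i)) ->
  is_derive s 1 (fun t : R => H (w + t *: e4 R i)) (pd i H (w + s *: e4 R i)).
Proof.
move=> dH; apply/is_deriveP; have dHw := dH (w + s *: e4 R i).
rewrite [X in X @ _ --> _](_ : _ = fun h => h^-1 *: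
  ((H \o shift (w + s *: e4 R i)) (h *: e4 R i) - H (w + s *: e4 R i))).
  exact: dHw.
by apply/funext => h /=; rewrite scalerDl addrCA.
Qed.

Lemma coord_MVT H i w (d : R) : (forall w, derivable H w (e4 R i)) ->
  exists2 s : R, `|s| <= `|d| &
    H (w + d *: e4 R i) - H w = pd i H (w + s *: e4 R i) * d.
Proof.
move=> dH; pose f (t : R) := H (w + t *: e4 R i).
have f0 : f 0 = H w by rewrite /f scale0r addr0.
have df (s : R) := is_derive_coord w s dH.
have [d0|d0] := leP 0 d.
  have [s /andP[s0 sd]] := MVT_derive d0 (fun s _ => df s).
  rewrite -/(f 0) -/(f d) f0 subr0 => E; exists s => //.
  by rewrite !ger0_norm.
have [s /andP[s0 sd]] := MVT_derive (ltW d0) (fun s _ => df s).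
rewrite -/(f 0) -/(f d) f0 sub0r mulrN => E; exists s.
  by rewrite !ler0_norm// ?lerN2// ltW.
by rewrite -/(f d) -[RHS]opprK -E opprB.
Qed.

(** Corners of the path from [x] to [y] that changes one coordinate at a time. *)
Definition stair x y (k : nat) : 'rV[R]_4 := \row_i if (i < k)%N then y 0 i else x 0 i.

(** The increments over the edges of the path telescope, and each edge involves a single partial
    derivative. In the maximum norm the whole path stays within [|y - x|] of [x]. *)
Lemma MVT4 H x y : (forall i w, derivable H w (e4 R i)) ->
  exists xi : 'I_4 -> 'rV[R]_4, (forall i, `|xi i - x| <= `|y - x|) /\
    H y - H x = \sum_i pd i H (xi i) * (y - x) 0 i.
Proof.
move=> dH.
have stS (k : 'I_4) : stair x y k.+1 = stair x y k + (y - x) 0 k *: e4 R k.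
  apply/rowP => i; rewrite !mxE eqxx/= ltnS leq_eqVlt.
  case: (ltngtP i k) => [ik|ik|/val_inj ->] /=; rewrite ?eqxx ?ltnn ?mulr1; last by ring.
    by rewrite (_ : (i == k) = false) ?mulr0 ?addr0//; apply/eqP => h; rewrite h ltnn in ik.
  by rewrite (_ : (i == k) = false) ?mulr0 ?addr0//; apply/eqP => h; rewrite h ltnn in ik.
have /choice[s hs] : forall k : 'I_4, exists s : R, `|s| <= `|(y - x) 0 k| /\
    H (stair x y k.+1) - H (stair x y k) =
    pd k H (stair x y k + s *: e4 R k) * (y - x) 0 k.
  by move=> k; rewrite stS; have [s ? ?] := coord_MVT (stair x y k) ((y - x) 0 k) (dH k); exists s.
exists (fun k : 'I_4 => stair x y k + s k *: e4 R k); split => [k|].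
  apply: norm_rv_le => // i; rewrite !mxE eqxx/=.
  case: (ltngtP i k) => [ik|ik|/val_inj ->] /=.
  - rewrite (_ : (i == k) = false) ?mulr0 ?addr0; last by apply/eqP => h; rewrite h ltnn in ik.
    by have := coord_le_norm (y - x) i; rewrite !mxE.
  - rewrite (_ : (i == k) = false) ?mulr0 ?addr0 ?subrr ?normr0//.
    by apply/eqP => h; rewrite h ltnn in ik.
  - rewrite eqxx mulr1 addrAC subrr add0r; have [h _] := hs k.
    exact: le_trans h (coord_le_norm _ _).
have -> : \sum_i pd i H (stair x y i + s i *: e4 R i) * (y - x) 0 i =
          \sum_(0 <= k < 4) (H (stair x y k.+1) - H (stair x y k)).
  by rewrite big_mkord; apply: eq_bigr => i _; have [_ ->] := hs i.
rewrite telescope_sumr//; congr (H _ - H _); apply/rowP => i; rewrite mxE//.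
by rewrite ltn_ord.
Qed.

(** By [MVT4] the difference quotient is a combination of partial derivatives at points tending to
    the base point, where they are continuous. *)
Lemma is_derive_line H w v (t : R) : C1 H ->
  is_derive t 1 (fun s : R => H (w + s *: v)) (\sum_i v 0 i * pd i H (w + t *: v)).
Proof.
move=> [dH cH]; apply/is_deriveP; set a := w + t *: v.
have /choice[xi hxi] : forall h : R, exists xi : 'I_4 -> 'rV[R]_4,
   (forall i, `|xi i - a| <= `|h| * `|v|) /\
   H (a + h *: v) - H a = \sum_i pd i H (xi i) * (h * v 0 i).
  move=> h; have [xi [h1 h2]] := MVT4 a (a + h *: v) dH; exists xi; split.
    by move=> i; apply: le_trans (h1 i) _; rewrite addrAC subrr add0r normrZ.
  by rewrite h2; apply: eq_bigr => i _; rewrite addrAC subrr add0r mxE.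
have cxi i : xi h i @[h --> (0:R)^'] --> a.
  apply/cvgrPdist_le => e e0.
  have e1 : 0 < e / (`|v| + 1) by rewrite divr_gt0// ltr_wpDl.
  near=> h; rewrite distrC; apply: le_trans (proj1 (hxi h) i) _.
  apply: (@le_trans _ _ (`|h| * (`|v| + 1))); first by rewrite ler_wpM2l// lerDl.
  rewrite -ler_pdivlMr; last by rewrite ltr_wpDl.
  near: h; apply: dnbhs0_le => //.
have : \sum_i v 0 i * pd i H (xi h i) @[h --> (0:R)^'] --> \sum_i v 0 i * pd i H a.
  apply: cvg_sumr => i; apply: cvgM; first exact: cvg_cst.
  exact: (cvg_comp _ (pd i H) (cxi i) (cH i a)).
apply: cvg_trans; apply: near_eq_cvg; near=> h.
have h0 : h != 0 by near: h; exact: nbhs_dnbhs_neq.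
rewrite (_ : w + (h + t) *: v = a + h *: v); last by rewrite scalerDl addrCA addrC.
rewrite (proj2 (hxi h)) mulr_sumr; apply: eq_bigr => i _.
by rewrite mulrCA mulKf// mulrC.
Unshelve. all: by end_near. Qed.

Lemma is_derive_ray H w (t : R) : C1 H ->
  is_derive t 1 (fun s : R => H (s *: w)) (\sum_i w 0 i * pd i H (t *: w)).
Proof.
move=> cH; have := is_derive_line 0 w t cH; rewrite add0r.
by under eq_fun do rewrite add0r.
Qed.

Section Gof.
Variable F : 'rV[R]_4 -> R.
Hypothesis F2 : C2 F.

Lemma C2_C1 : C1 F. Proof. by case: F2 => ? [? [? _]]; split. Qed.

Lemma C2_pdC1 i : C1 (pd i F). Proof. by case: F2 => ? [? [? [? ?]]]; split. Qed.

Lemma is_derive_Gof j w : is_derive w (e4 R j) (Gof F)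
  (pd j F w + \sum_i w 0 i * pd j (pd i F) w).
Proof.
have [_ [_ [_ [dF _]]]] := F2.
have coordD i : is_derive w (e4 R j) (fun v : 'rV[R]_4 => v 0 i) ((e4 R j) 0 i).
  have E : (fun h : R => h^-1 *: (((fun v : 'rV[R]_4 => v 0 i) \o shift w) (h *: e4 R j) - w 0 i))
     @ 0^' --> (e4 R j) 0 i.
    have H0 : (fun=> e4 R j 0 i) @ (0 : R)^' --> e4 R j 0 i by exact: cvg_cst.
    apply: cvg_trans H0; apply: near_eq_cvg; near=> h.
    have h0 : h != 0 by near: h; exact: nbhs_dnbhs_neq.
    by rewrite /= !mxE addrK /GRing.scale/= mulKf.
  by split; [apply/cvg_ex; exists (e4 R j 0 i)|exact: cvg_lim].
have dE i : is_derive w (e4 R j) (fun v : 'rV[R]_4 => v 0 i * pd i F v)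
   (w 0 i * pd j (pd i F) w + pd i F w * (e4 R j) 0 i).
  have d2 : is_derive w (e4 R j) (pd i F) (pd j (pd i F) w) by split.
  exact: is_deriveM.
have -> : Gof F = \sum_(i < 4) (fun v : 'rV[R]_4 => v 0 i * pd i F v).
  by apply/funext => v; rewrite /Gof fct_sumE.
suff -> : pd j F w + \sum_i w 0 i * pd j (pd i F) w =
  \sum_i (w 0 i * pd j (pd i F) w + pd i F w * e4 R j 0 i) by exact: is_derive_sum.
rewrite big_split/= addrC; congr (_ + _); apply/esym.
rewrite (bigD1 j)//= big1 ?addr0; first by rewrite mxE !eqxx mulr1.
by move=> i ij; rewrite mxE eqxx (negbTE ij) mulr0.
Unshelve. all: by end_near. Qed.

Lemma pd_Gof j w : pd j (Gof F) w = pd j F w + \sum_i w 0 i * pd j (pd i F) w.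
Proof. by have [_ <-] := is_derive_Gof j w. Qed.

Lemma Gof_C1 : C1 (Gof F).
Proof.
have [_ [_ [cF [_ cFF]]]] := F2.
split=> [j w|j]; first by have [] := is_derive_Gof j w.
rewrite (_ : pd j (Gof F) = fun w => pd j F w + \sum_i w 0 i * pd j (pd i F) w); last first.
  by apply/funext => w; rewrite pd_Gof.
move=> w.
have hs : (fun v : 'rV[R]_4 => \sum_i v 0 i * pd j (pd i F) v) @ w -->
    \sum_i w 0 i * pd j (pd i F) w.
  apply: (@cvg_sumr R _ (nbhs w)) => i.
  exact: (cvgM (@coord_continuous R 1 4 0 i w) (cFF i j w)).
exact: (cvgD (cF j w) hs).
Qed.

Lemma C1_cvg_comp {T : Type} (U : set_system T) {FU : Filter U} H (f : T -> 'rV[R]_4) x :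
  C1 H -> f @ U --> x -> H (f t) @[t --> U] --> H x.
Proof.
move=> [dH cH] fx; apply/cvgrPdist_le => e e0.
have /nbhs_ballP[d /= d0 hd] : nbhs x [set y | forall i, `|pd i H x - pd i H y| <= 1].
  apply: (@filter_forall _ _ _ (nbhs x)) => i.
  by have /cvgrPdist_le/(_ 1 ltr01) := cH i x.
pose C := \sum_i (`|pd i H x| + 1) + 1.
have C0 : 0 < C by rewrite ltr_wpDl// sumr_ge0.
near=> t; have [xi [h1 h2]] := MVT4 x (f t) dH.
have yx : `|f t - x| < d.
  by rewrite distrC; near: t; exact: (cvgr_dist_lt _ _ fx).
have yxe : `|f t - x| <= e / C.
  by rewrite distrC; near: t; exact: (cvgr_dist_le _ _ fx _ (divr_gt0 e0 C0)).
rewrite distrC h2; apply: le_trans (ler_norm_sum _ _ _) _.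
apply: (@le_trans _ _ (\sum_i (`|pd i H x| + 1) * `|f t - x|)).
  apply: ler_sum => i _; rewrite normrM; apply: ler_pM => //; last exact: coord_le_norm.
  have /hd/(_ i) : ball x d (xi i).
    by rewrite -ball_normE /= distrC; exact: le_lt_trans (h1 i) yx.
  rewrite distrC => h; rewrite -lerBlDl; apply: le_trans h; exact: lerB_dist.
rewrite -mulr_suml; apply: (@le_trans _ _ (C * `|f t - x|)).
  by rewrite ler_wpM2r// lerDl.
by rewrite mulrC -ler_pdivlMr.
Unshelve. all: by end_near. Qed.

Lemma C1_continuous H : C1 H -> continuous H.
Proof. by move=> cH x; apply: (@C1_cvg_comp _ (nbhs x) _ H id). Qed.

End Gof.

End Calculus4.

(* Everything the variational argument needs from conditions (a) and (b), with
   k = p + 2 and kap(r) a multiple of r^q1 + r^q2. *)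
Record nonlinearity {R : realType} (F : 'rV[R]_4 -> R) (k : R) (kap : R -> R) : Prop := {
  nl_C1 : C1 F;
  nl_C1G : C1 (Gof F);
  nl_C1pd : forall i, C1 (pd i F);
  nl_k : 2 < k;
  nl_F0 : F 0 = 0;
  nl_kap_ge0 : forall r, 0 <= kap r;
  nl_kap_le : forall r s, 0 <= r -> r <= s -> kap r <= kap s;
  nl_kap_small : forall e, 0 < e -> exists2 r, 0 < r & kap r <= e;
  nl_pd : forall w i, `|pd i F w| <= kap `|w| * `|w|;
  nl_pdG : forall w i, `|pd i (Gof F) w| <= kap `|w| * `|w|;
  nl_pdpd : forall w i j, `|pd j (pd i F) w| <= kap `|w|;
  nl_G_le : forall w, `|Gof F w| <= kap `|w| * `|w| ^+ 2;
  nl_G_exp_ge : forall w s, 0 <= s -> expR (k * s) * Gof F w <= Gof F (expR s *: w);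
  nl_G_exp_le : forall w s, s <= 0 -> Gof F (expR s *: w) <= expR (k * s) * Gof F w;
  nl_F_exp : forall w s, Gof F w * ((expR (k * s) - 1) / k) <= F (expR s *: w) - F w;
  nl_L_le : forall w t, 0 <= t -> t <= 1 ->
    Gof F (t *: w) / k - F (t *: w) <= Gof F w / k - F w;
  nl_L_ge0 : forall w, 0 <= Gof F w / k - F w
}.

Lemma sum4_const {R : realType} (c : R) : \sum_(j < 4) c = 4 * c.
Proof. by rewrite sumr_const card_ord mulr_natl. Qed.

Lemma is_derive_exp_scale {R : realType} (c s : R) : is_derive s 1 (fun s => expR (c * s)) (c * expR (c * s)).
Proof.
have h := is_derive_scale c (is_derive_id s (1 : R)).
by have := is_derive_comp (is_derive_expR (c * s)) h; rewrite mulr1 mulrC.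
Qed.

Lemma exp_min {R : realType} (f df : R -> R) : (forall s : R, is_derive s 1 f (df s)) ->
  (forall s : R, 0 <= s -> 0 <= df s) -> (forall s : R, s <= 0 -> df s <= 0) ->
  forall s, f 0 <= f s.
Proof.
move=> fd d1 d2 s; have [s0|s0] := leP 0 s.
  by apply: (derive_ge0_le s0 (fun x _ => fd x)) => x /andP[/ltW x0 _]; exact: d1.
rewrite -lerN2.
apply: (@derive_ge0_le R (fun t => - f t) (fun t => - df t) s 0 (ltW s0)) => x.
by move=> /andP[_ /ltW x0]; rewrite oppr_ge0; exact: d2.
Qed.

(** * Consequences of conditions (a) and (b) *)

Section Nonlinearity.
Context {R : realType}.
Variables (F : 'rV[R]_4 -> R) (p q1 q2 C : R).
Hypothesis F2 : C2 F.
Hypothesis F00 : F 0 = 0.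
Hypothesis p0 : 0 < p.
Hypothesis hA : forall w, (p + 2) * Gof F w <= \sum_(j < 4) w 0 j * pd j (Gof F) w.
Hypothesis q10 : 0 < q1.
Hypothesis q12 : q1 <= q2.
Hypothesis C0 : 0 < C.
Hypothesis hB : forall w i j, `|pd j (pd i F) w| <= C * (`|w| `^ q1 + `|w| `^ q2).

Let k := p + 2.
Let kap0 (r : R) := C * (r `^ q1 + r `^ q2).
(** 16 = 4 * 4: one sum over four coordinates bounds the gradient of F by its Hessian, a second one
    bounds G by the gradient. *)
Let kap (r : R) := 16 * kap0 r.

Let kap0_ge0 r : 0 <= kap0 r.
Proof. by rewrite mulr_ge0 ?addr_ge0 ?powR_ge0// ltW. Qed.

Let kap0_le r s : 0 <= r -> r <= s -> kap0 r <= kap0 s.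
Proof.
move=> r0 rs; rewrite ler_wpM2l//; first exact: ltW.
have q20 := lt_le_trans q10 q12.
have s0 := le_trans r0 rs.
by apply: lerD; apply: ge0_ler_powR; rewrite ?nnegrE ?(ltW q10) ?(ltW q20).
Qed.

Let kap0_small e : 0 < e -> exists2 r, 0 < r & kap0 r <= e.
Proof.
move=> e0; have e1 : 0 < e / (2 * C) by rewrite divr_gt0// mulr_gt0.
have /cvgrPdist_le/(_ _ e1) h1 := powR_cvg0 q10.
have /cvgrPdist_le/(_ _ e1) h2 := powR_cvg0 (lt_le_trans q10 q12).
have [r [r0 [h1r h2r]]] : exists r : R, 0 < r /\ (`|0 - r `^ q1| <= e / (2 * C) /\ `|0 - r `^ q2| <= e / (2 * C)).
  near (0 : R)^'+ => r; exists r; split; last by split; near: r.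
  by near: r; exact: nbhs_right_gt.
exists r => //; move: h1r h2r; rewrite !sub0r !normrN !ger0_norm ?powR_ge0// => h1r h2r.
rewrite /kap0 mulrC -ler_pdivlMr//.
have -> : e / C = e / (2 * C) + e / (2 * C) by field; rewrite gt_eqF.
exact: lerD.
Unshelve. all: by end_near. Qed.

(** Condition (a) at [c *: e4 R i] reduces to [(p + 1) * (c * pd i F) <= c ^+ 2 * pd i (pd i F)] at
    that point, and the right side is O(c^2). Dividing by [c] and letting it tend to 0 from either
    side gives both signs. *)
Let pdF_0 i : pd i F 0 = 0.
Proof.
have key (c : R) : `|c| <= 1 ->
    (p + 1) * (c * pd i F (c *: e4 R i)) <= c ^+ 2 * (2 * C).
  move=> c1; have Ei j : (c *: e4 R i) 0 j = if j == i then c else 0.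
    by rewrite !mxE eqxx /=; case: eqP => _; rewrite ?mulr1 ?mulr0.
  have sumE (f : 'I_4 -> R) : \sum_j (c *: e4 R i) 0 j * f j = c * f i.
    rewrite (bigD1 i)//= Ei eqxx big1 ?addr0// => j ji.
    by rewrite Ei (negbTE ji) mul0r.
  have := hA (c *: e4 R i); rewrite sumE /Gof sumE pd_Gof// sumE => h.
  have nc : `|c *: e4 R i| <= 1.
    apply: norm_rv_le => // j; rewrite Ei; case: ifP => // _; by rewrite normr0.
  have : pd i (pd i F) (c *: e4 R i) <= 2 * C.
    apply: le_trans (ler_norm _) _; apply: le_trans (hB _ _ _) _.
    apply: le_trans (kap0_le _ nc) _ => //.
    by rewrite /kap0 !powR1; lra.
  move=> h2; have : c ^+ 2 * pd i (pd i F) (c *: e4 R i) <= c ^+ 2 * (2 * C).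
    by rewrite ler_wpM2l// sqr_ge0.
  move: h; set X := pd i F _; set Y := pd i (pd i F) _; move: X Y => X Y h h3.
  have -> : (p + 1) * (c * X) = (p + 2) * (c * X) - c * X by ring.
  rewrite lerBlDr; apply: le_trans h _; rewrite mulrDr mulrA -expr2 addrC.
  by rewrite lerD2r.
have p1 : 0 < p + 1 by rewrite addr_gt0.
have cv : pd i F (c *: e4 R i) @[c --> (0 : R)] --> pd i F 0.
  have c0 : (c : R) *: e4 R i @[c --> (0 : R)] --> (0 : 'rV[R]_4).
    by rewrite -[X in _ --> X](scale0r (e4 R i)); apply: cvgZr_tmp; exact: cvg_id.
  exact: (C1_cvg_comp (C2_pdC1 F2 i) c0).
have bound e : 0 < e -> `|pd i F 0| <= e.
  move=> e0; have e2 : 0 < e / 2 by lra.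
  have /cvgrPdist_le/(_ _ e2)/nbhs_ballP[d /= d0 hd] := cv.
  (* The three terms ensure [kap0 <= 2 * C] at this size, continuity of [pd i F] at 0 up to [e / 2],
     and [2 * C * c <= e / 2 * (p + 1)]. *)
  pose c := Num.min 1 (Num.min (d / 2) (e * (p + 1) / (4 * C))).
  have c0 : 0 < c.
    by rewrite !lt_min ltr01 !divr_gt0//= ?mulr_gt0.
  have [c1 [cd ce]] : c <= 1 /\ (c < d /\ c <= e * (p + 1) / (4 * C)).
    split; first by rewrite ge_min lexx.
    split; last by rewrite !ge_min lexx !orbT.
    by apply: (@le_lt_trans _ _ (d / 2)); [rewrite !ge_min lexx orbT|lra].
  have ce' : 2 * C * c <= e / 2 * (p + 1).
    move: ce; rewrite ler_pdivlMr; last by rewrite mulr_gt0.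
    by lra.
  have := key c; rewrite (ger0_norm (ltW c0)) => /(_ c1) k1.
  have := key (- c); rewrite normrN (ger0_norm (ltW c0)) => /(_ c1) k2.
  have d1 := hd c _; have d2 := hd (- c) _.
  rewrite -ball_normE /= sub0r normrN gtr0_norm// in d1.
  rewrite -ball_normE /= sub0r opprK gtr0_norm// in d2.
  have {d1} := d1 cd; have {d2} := d2 cd.
  rewrite !ler_norml => /andP[a1 a2] /andP[b1 b2].
  have k1' : (p + 1) * pd i F (c *: e4 R i) <= 2 * C * c.
    by rewrite -(ler_pM2l c0); nra.
  have k2' : - (2 * C * c) <= (p + 1) * pd i F (- c *: e4 R i).
    by rewrite -(ler_pM2l c0); nra.
  have k1'' : pd i F (c *: e4 R i) <= e / 2 by rewrite -(ler_pM2l p1); lra.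
  have k2'' : - (e / 2) <= pd i F (- c *: e4 R i) by rewrite -(ler_pM2l p1); lra.
  by apply/andP; split; lra.
apply/eqP; rewrite -normr_le0; apply/ler_addgt0Pr => e e0; rewrite add0r; exact: bound.
Qed.

Let pdF_le w i : `|pd i F w| <= 4 * kap0 `|w| * `|w|.
Proof.
have [xi [h1 h2]] := MVT4 0 w (proj1 (C2_pdC1 F2 i)).
have -> : pd i F w = \sum_j pd j (pd i F) (xi j) * w 0 j.
  by move: h2; rewrite pdF_0 !subr0.
apply: le_trans (ler_norm_sum _ _ _) _.
apply: (@le_trans _ _ (\sum_(j < 4) kap0 `|w| * `|w|)).
  apply: ler_sum => j _; rewrite normrM; apply: ler_pM => //; last exact: coord_le_norm.
  apply: le_trans (hB _ _ _) _; apply: kap0_le => //.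
  by have := h1 j; rewrite !subr0.
by rewrite sum4_const mulrA.
Qed.

Let G_le w : `|Gof F w| <= kap `|w| * `|w| ^+ 2.
Proof.
apply: le_trans (ler_norm_sum _ _ _) _.
apply: (@le_trans _ _ (\sum_(j < 4) 4 * kap0 `|w| * `|w| ^+ 2)).
  apply: ler_sum => j _; rewrite normrM expr2 mulrCA.
  by apply: ler_pM => //; exact: coord_le_norm.
by rewrite sum4_const /kap le_eqVlt; apply/orP; left; apply/eqP; ring.
Qed.

Let pdG_le w i : `|pd i (Gof F) w| <= kap `|w| * `|w|.
Proof.
rewrite pd_Gof//; apply: le_trans (ler_normD _ _) _.
apply: (@le_trans _ _ (4 * kap0 `|w| * `|w| + 4 * kap0 `|w| * `|w|)).
  apply: lerD; first exact: pdF_le.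
  apply: le_trans (ler_norm_sum _ _ _) _.
  apply: (@le_trans _ _ (\sum_(j < 4) kap0 `|w| * `|w|)).
    apply: ler_sum => j _; rewrite normrM mulrC; apply: ler_pM => //; last exact: coord_le_norm.
  by rewrite sum4_const mulrA.
by rewrite /kap -mulrDl ler_wpM2r// -mulrDl ler_wpM2r//; lra.
Qed.

Let is_derive_exp_ray H w (s : R) : C1 H ->
  is_derive s 1 (fun s => H (expR s *: w))
    (\sum_i (expR s *: w) 0 i * pd i H (expR s *: w)).
Proof.
move=> cH; have := is_derive1_comp (is_derive_ray w (expR s) cH) (is_derive_expR s).
rewrite mulr_suml; congr (is_derive _ _ _ _); apply: eq_bigr => i _.
by rewrite !mxE; ring.
Qed.

(** In the variable [s], condition (a) makes the derivative of this product nonnegative; writing the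
    scale as [expR s] avoids any assumption on the sign of G. *)
Let G_exp w a b : a <= b ->
  Gof F (expR a *: w) * expR (- k * a) <= Gof F (expR b *: w) * expR (- k * b).
Proof.
move=> ab.
pose df s := Gof F (expR s *: w) * (- k * expR (- k * s)) +
   expR (- k * s) * \sum_i (expR s *: w) 0 i * pd i (Gof F) (expR s *: w).
apply: (@derive_ge0_le R (fun s => Gof F (expR s *: w) * expR (- k * s)) df) => // s _.
  by apply: is_derive_mul; [exact: is_derive_exp_ray (Gof_C1 F2)|exact: is_derive_exp_scale].
have -> : df s = expR (- k * s) *
   (\sum_i (expR s *: w) 0 i * pd i (Gof F) (expR s *: w) - k * Gof F (expR s *: w)).
  by rewrite /df; ring.
by rewrite mulr_ge0 ?expR_ge0// subr_ge0 hA.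
Qed.

Let G_exp_ge w s : 0 <= s -> expR (k * s) * Gof F w <= Gof F (expR s *: w).
Proof.
move=> s0; have := G_exp w s0; rewrite mulr0 expR0 scale1r mulr1 mulNr expRN.
by rewrite ler_pdivlMr ?expR_gt0// mulrC.
Qed.

Let G_exp_le w s : s <= 0 -> Gof F (expR s *: w) <= expR (k * s) * Gof F w.
Proof.
move=> s0; have := G_exp w s0; rewrite mulr0 expR0 scale1r mulr1 mulNr expRN.
by rewrite ler_pdivrMr ?expR_gt0// mulrC.
Qed.

Let k0 : 0 < k. Proof. by rewrite /k addr_gt0. Qed.

(** The right side minus the left has derivative [Gof F (expR s *: w) - expR (k * s) * Gof F w] in
    [s], which by [G_exp] has the sign of [s]; so its minimum is at [s = 0]. *)
Let F_exp w s : Gof F w * ((expR (k * s) - 1) / k) <= F (expR s *: w) - F w.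
Proof.
pose f s := F (expR s *: w) - Gof F w / k * expR (k * s).
pose df s := Gof F (expR s *: w) - Gof F w / k * (k * expR (k * s)).
have E t : df t = Gof F (expR t *: w) - expR (k * t) * Gof F w.
  by rewrite /df mulrA divfK ?gt_eqF// mulrC.
have := @exp_min _ f df _ _ _ s; rewrite /f mulr0 !expR0 scale1r mulr1 => h.
suff : F w - Gof F w / k <= F (expR s *: w) - Gof F w / k * expR (k * s).
  have -> : Gof F w * ((expR (k * s) - 1) / k) = Gof F w / k * expR (k * s) - Gof F w / k.
    by field; rewrite gt_eqF.
  by lra.
apply: h => t.
- apply: is_derive_sub; first exact: is_derive_exp_ray (C2_C1 F2).
  by apply: is_derive_scale; exact: is_derive_exp_scale.
- by rewrite E subr_ge0; exact: G_exp_ge.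
- by rewrite E subr_le0; exact: G_exp_le.
Qed.

(** F grows along the ray at rate [Gof F (t *: w) / t], so [t] times the derivative is the slack in
    condition (a) divided by [k]. *)
Let L_mono w a b : 0 <= a -> a <= b ->
  Gof F (a *: w) / k - F (a *: w) <= Gof F (b *: w) / k - F (b *: w).
Proof.
move=> a0 ab; rewrite ![_ / k]mulrC.
pose df t := k^-1 * (\sum_i w 0 i * pd i (Gof F) (t *: w)) - \sum_i w 0 i * pd i F (t *: w).
apply: (@derive_ge0_le R (fun t => k^-1 * Gof F (t *: w) - F (t *: w)) df) => // t.
  move=> _; apply: is_derive_sub; last exact: is_derive_ray (C2_C1 F2).
  by apply: is_derive_scale; exact: is_derive_ray (Gof_C1 F2).
move=> /andP[ta _]; have t0 := le_lt_trans a0 ta.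
rewrite -(pmulr_rge0 _ t0).
have -> : t * df t = k^-1 * (\sum_i (t *: w) 0 i * pd i (Gof F) (t *: w)) - Gof F (t *: w).
  rewrite /df mulrBr mulrCA; congr (_ * _ - _); rewrite [in RHS]/Gof mulr_sumr;
    by apply: eq_bigr => i _; rewrite !mxE mulrA.
by rewrite subr_ge0 ler_pdivlMl// hA.
Qed.

Lemma nonlinearityP : nonlinearity F k kap.
Proof.
split => //.
- exact: C2_C1.
- exact: Gof_C1.
- exact: C2_pdC1.
- by rewrite /k ltrDr.
- by move=> r; rewrite mulr_ge0.
- by move=> r s r0 rs; rewrite ler_wpM2l// kap0_le.
- move=> e e0; have [|r r0 h] := @kap0_small (e / 16); first by rewrite divr_gt0.
  by exists r => //; rewrite /kap mulrC -ler_pdivlMr.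
- move=> w i; apply: le_trans (pdF_le w i) _; rewrite ler_wpM2r// ler_wpM2r//; lra.
- move=> w i j; apply: le_trans (hB w i j) _; rewrite -[leLHS]mul1r ler_wpM2r//; first exact: kap0_ge0.
  by lra.
- by move=> w t t0 t1; have := L_mono w t0 t1; rewrite scale1r.
- move=> w; have := L_mono w (lexx 0) ler01; rewrite scale1r scale0r F00 subr0.
  by rewrite /Gof big1 ?mul0r// => i _; rewrite mxE mul0r.
Qed.

End Nonlinearity.

(** [(expR (k * s) - 1) / k] is the integral of [expR (k * r)] for [r] from 0 to [s], hence
    nondecreasing in [k] for either sign of [s]. It compares the quadratic part of J with the
    superquadratic one along rays. *)
Lemma exp_bernoulli {R : realType} (k s : R) : 2 < k ->
  (expR (2 * s) - 1) / 2 <= (expR (k * s) - 1) / k.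
Proof.
move=> k2; have k0 : 0 < k by lra.
pose f (t : R) := k^-1 * expR (k * t) - 2^-1 * expR (2 * t).
pose df (t : R) := k^-1 * (k * expR (k * t)) - 2^-1 * (2 * expR (2 * t)).
have E t : df t = expR (k * t) - expR (2 * t) by rewrite /df !mulKf// gt_eqF.
have := @exp_min _ f df _ _ _ s; rewrite /f !mulr0 expR0 !mulr1 => h.
suff : k^-1 - 2^-1 <= k^-1 * expR (k * s) - 2^-1 * expR (2 * s).
  by rewrite !mulrBl !mul1r ![_ / k]mulrC ![_ / 2]mulrC; lra.
apply: h => t.
- by apply: is_derive_sub; apply: is_derive_scale; exact: is_derive_exp_scale.
- by rewrite E subr_ge0 ler_expR => t0; rewrite ler_wpM2r// ltW.
- by rewrite E subr_le0 ler_expR => t0; rewrite ler_wnM2r// ltW.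
Qed.

(** * A smooth step *)

Section Smooth.
Context {R : realType}.
Implicit Types f g : R -> R.

(** Recursive form of n-fold differentiability, so that closure properties go by induction on
    [n]. *)
Fixpoint smooth_upto (n : nat) f : Prop :=
  if n is m.+1 then (forall x, derivable f x 1) /\ smooth_upto m (derive1 f) else True.

Lemma smooth_upto_derivable n f :
  smooth_upto n.+1 f -> forall x, derivable (derive1n n f) x 1.
Proof.
elim: n f => [|n IH] f; first by case.
move=> [_ sf] x; have := IH _ sf x.
by rewrite /derive1n -iterSr.
Qed.

Lemma smooth_uptoS n f g : (forall x : R, is_derive x 1 f (g x)) ->
  smooth_upto n g -> smooth_upto n.+1 f.
Proof.
move=> fg sg; split=> [x|]; first by have [] := fg x.
suff -> : derive1 f = g by [].
by apply/funext => x; rewrite derive1E; have [_ ->] := fg x.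
Qed.

Lemma smooth_upto_is_derive n f : smooth_upto n.+1 f ->
  forall x : R, is_derive x 1 f (derive1 f x).
Proof. by move=> [df _] x; split => //; rewrite derive1E. Qed.

Lemma smooth_upto_le n f : smooth_upto n.+1 f -> smooth_upto n f.
Proof.
by elim: n f => [//|n IH] f [df sf]; split => //; exact: IH.
Qed.

Lemma smooth_upto_cst n (c : R) : smooth_upto n (fun=> c).
Proof.
elim: n c => [//|n IH] c; exact: (@smooth_uptoS n _ (fun=> 0)).
Qed.

Lemma smooth_upto_lin n (s t : R) f g : smooth_upto n f -> smooth_upto n g ->
  smooth_upto n (fun x => s * f x + t * g x).
Proof.
elim: n f g => [//|n IH] f g sf sg.
apply: (@smooth_uptoS n _ (fun x => s * derive1 f x + t * derive1 g x)).
  move=> x; exact: (is_derive_add (is_derive_scale s (smooth_upto_is_derive sf x))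
    (is_derive_scale t (smooth_upto_is_derive sg x))).
by apply: IH; [case: sf|case: sg].
Qed.

Lemma smooth_upto_mul n f g : smooth_upto n f -> smooth_upto n g ->
  smooth_upto n (fun x => f x * g x).
Proof.
elim: n f g => [//|n IH] f g sf sg.
apply: (@smooth_uptoS n _ (fun x => 1 * (f x * derive1 g x) + 1 * (g x * derive1 f x))).
  move=> x; rewrite !mul1r.
  exact: (is_derive_mul (smooth_upto_is_derive sf x) (smooth_upto_is_derive sg x)).
by apply: smooth_upto_lin; apply: IH; try exact: smooth_upto_le; [case: sg|case: sf].
Qed.

Lemma smooth_upto_affine n (a b : R) f : smooth_upto n f ->
  smooth_upto n (fun x => f (a * x + b)).
Proof.
elim: n f => [//|n IH] f sf.
apply: (@smooth_uptoS n _ (fun x => a * derive1 f (a * x + b) + 0 * 0)).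
  move=> x; have d := is_derive_add (is_derive_scale a (is_derive_id x (1 : R))) (is_derive_cst b x 1).
  have := @is_derive_comp _ f (fun t => a * t + b) x _ _ (smooth_upto_is_derive sf _) d.
  by rewrite mulr1 mul0r !addr0 mulrC.
by apply: smooth_upto_lin; [apply: IH; case: sf|exact: smooth_upto_cst].
Qed.

Lemma is_derive_inv f (x l : R) : f x != 0 -> is_derive x 1 f l ->
  is_derive x 1 (fun t => (f t)^-1) (- (l * ((f x)^-1 * (f x)^-1))).
Proof.
move=> fx [df <-]; split; first exact: derivableV.
by rewrite deriveV// /GRing.scale/= mulNr mulrC -invfM -expr2.
Qed.

Lemma smooth_upto_inv n f : (forall x, f x != 0) -> smooth_upto n f ->
  smooth_upto n (fun x => (f x)^-1).
Proof.
move=> f0; elim: n => [//|n IH] sf.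
apply: (@smooth_uptoS n _ (fun x => (-1) * (derive1 f x * ((f x)^-1 * (f x)^-1)) + 0 * 0)).
  move=> x; rewrite mulN1r mul0r addr0; apply: is_derive_inv => //.
  exact: (smooth_upto_is_derive sf x).
apply: smooth_upto_lin; last exact: smooth_upto_cst.
apply: smooth_upto_mul; first by case: sf.
by apply: smooth_upto_mul; apply: IH; exact: smooth_upto_le.
Qed.

(** [flat 0] is the classical exp(-1/x). The powers make the family closed under differentiation up
    to linear combinations, hence all members smooth. *)
Definition flat (k : nat) (x : R) : R :=
  if 0 < x then x^-1 ^+ k * expR (- x^-1) else 0.

Lemma flat_ge0 k x : 0 <= flat k x.
Proof.
rewrite /flat; case: ifP => // x0; rewrite mulr_ge0 ?expR_ge0// exprn_ge0//.
by rewrite invr_ge0 ltW.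
Qed.

Lemma flat_le k (h : R) : 0 < h -> h^-1 * flat k h <= (k.+2)`!%:R * h.
Proof.
move=> h0; rewrite /flat h0; set y := h^-1.
have y0 : 0 < y by rewrite invr_gt0.
rewrite mulrA -exprS expRN ler_pdivrMr ?expR_gt0//.
have := expR_ge1Dxn k.+1 (ltW y0); rewrite -/y => hy.
have {}hy : y ^+ k.+2 / k.+2`!%:R <= expR y by lra.
have -> : y ^+ k.+1 = k.+2`!%:R * h * (y ^+ k.+2 / k.+2`!%:R).
  have f0 : k.+2`!%:R != 0 :> R by rewrite pnatr_eq0 -lt0n fact_gt0.
  rewrite [y ^+ k.+2]exprSr /y; field; by rewrite f0 gt_eqF.
by rewrite ler_pM2l// mulr_gt0// ltr0n fact_gt0.
Qed.

Lemma is_derive_flat k (x : R) :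
  is_derive x 1 (flat k) (1 * flat k.+2 x + (- k%:R) * flat k.+1 x).
Proof.
have [x0|x0|->] := ltgtP x 0.
- rewrite /flat !ltNge (ltW x0)/= !mulr0 addr0.
  apply: (@near_eq_is_derive _ _ _ (cst 0)).
  near=> y; rewrite ifF//; apply/negbTE; rewrite -leNgt ltW//.
  by near: y; exact: lt_nbhsl.
- rewrite /flat x0.
  apply: (@near_eq_is_derive _ _ _ (fun y : R => y^-1 ^+ k * expR (- y^-1))).
    near=> y; rewrite ifT//; near: y; exact: lt_nbhsr.
  have xn : x != 0 by rewrite gt_eqF.
  have d1 : is_derive x 1 (fun y : R => y^-1) (- (x^-1 * x^-1)).
    by have := is_derive_inv xn (is_derive_id x (1 : R)); rewrite mul1r.
  have d2 := @is_derive_comp _ expR (fun y => - y^-1) x _ _ (is_derive_expR _) (is_deriveN d1).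
  have d3 : is_derive x 1 (fun y : R => y^-1 ^+ k) (k%:R * x^-1 ^+ k.-1 * (- (x^-1 * x^-1))).
    by have := @is_deriveX _ _ _ k _ _ _ d1; rewrite exprfctE.
  apply: (is_derive_eq (is_derive_mul d3 d2)); rewrite /GRing.scale /= opprK.
  case: (k) => [|m] /=; first by rewrite !expr0 !mul0r !mul1r; ring.
  by rewrite !exprS; ring.
- rewrite /flat ltxx !mulr0 addr0; apply/is_deriveP.
  apply/cvgrPdist_le => e e0.
  have f0 : (0 : R) < k.+2`!%:R by rewrite ltr0n fact_gt0.
  near=> h; rewrite ltxx sub0r normrN subr0 addr0.
  case: ifP => [h0|_]; last by rewrite mulr0 normr0 ltW.
  have := flat_le k h0; rewrite /flat h0 => hh.
  rewrite ger0_norm; last first.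
    by rewrite !mulr_ge0 ?expR_ge0 ?exprn_ge0// ?invr_ge0 ltW.
  apply: le_trans hh _; rewrite mulrC -ler_pdivlMr//.
  apply: le_trans (ler_norm _) _; near: h.
  by apply: dnbhs0_le; rewrite divr_gt0.
Unshelve. all: by end_near. Qed.

Lemma smooth_upto_flat n k : smooth_upto n (flat k).
Proof.
elim: n k => [//|n IH] k; apply: smooth_uptoS (is_derive_flat k) _.
exact: smooth_upto_lin.
Qed.

Definition step (x : R) : R := flat 0 x * (flat 0 x + flat 0 (1 - x))^-1.

Lemma flat0_gt0 (x : R) : 0 < x -> 0 < flat 0 x.
Proof. by move=> x0; rewrite /flat x0 expr0 mul1r expR_gt0. Qed.

Lemma flat0_eq0 (x : R) : x <= 0 -> flat 0 x = 0.
Proof. by move=> x0; rewrite /flat ltNge x0. Qed.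

Lemma step_denom (x : R) : 0 < flat 0 x + flat 0 (1 - x).
Proof.
have [x0|x0] := ltP 0 x; first by rewrite ltr_wpDr// ?flat_ge0// flat0_gt0.
by rewrite flat0_eq0// add0r flat0_gt0//; lra.
Qed.

Lemma smooth_upto_step n : smooth_upto n step.
Proof.
apply: smooth_upto_mul; first exact: smooth_upto_flat.
apply: smooth_upto_inv; first by move=> x; rewrite gt_eqF ?step_denom.
have := smooth_upto_lin 1 1 (smooth_upto_flat n 0) (smooth_upto_affine (-1) 1 (smooth_upto_flat n 0)).
congr smooth_upto; apply/funext => x; rewrite !mul1r; congr (_ + flat _ _); ring.
Qed.

Lemma step_le0 (x : R) : x <= 0 -> step x = 0.
Proof. by move=> x0; rewrite /step flat0_eq0 ?mul0r. Qed.

Lemma step_ge1 (x : R) : 1 <= x -> step x = 1.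
Proof.
move=> x1; rewrite /step [flat 0 (1 - x)]flat0_eq0 ?subr_le0// addr0 divff//.
by rewrite gt_eqF// flat0_gt0//; lra.
Qed.

Lemma step_itv (x : R) : 0 <= step x <= 1.
Proof.
have d0 := step_denom x; apply/andP; split.
  by rewrite /step mulr_ge0 ?flat_ge0// invr_ge0 ltW.
by rewrite /step ler_pdivrMr// mul1r lerDl flat_ge0.
Qed.

End Smooth.

(** * Approximate identities and indicators of intervals *)

Section Mollifier.
Context {R : realType}.
Implicit Types f g phi : R -> R.
Local Notation mu := (@lebesgue_measure R).

Lemma continuous_measurable f : continuous f -> measurable_fun setT f.
Proof. exact: continuous_measurable_fun. Qed.

Lemma derivable_continuous f : (forall x : R, derivable f x 1) -> continuous f.
Proof. by move=> df x; apply/differentiable_continuous/derivable1_diffP. Qed.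

Lemma L2_bounded_support f (M A : R) : measurable_fun setT f ->
  (forall x, `|f x| <= M) -> (forall x, A < `|x| -> f x = 0) -> L2 f.
Proof.
move=> mf fM fA; split => //.
have M0 : 0 <= M by apply: le_trans (normr_ge0 _) (fM 0).
apply: (@intg_le R _ (fun x => M ^+ 2 * \1_`[- A, A] x)).
- exact: measurable_funX.
- by apply: intgZ; exact: integrable_indic_itv.
- move=> x; rewrite normrX indicE; have [xA|xA] := boolP (x \in `[- A, A]%classic).
    by rewrite mulr1 lerXn2r// ?nnegrE.
  rewrite fA ?normr0 ?expr0n ?mulr0//; rewrite ltNge ler_norml; apply: contra xA.
  by rewrite inE/= in_itv.
Qed.

(** Signed indicator of the half-open interval between [a] and [b], negative when [b < a], so that
    [ind_add] holds for every order of the end points. *)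
Definition ind (a b t : R) : R := (t <= b)%R%:R - (t <= a)%R%:R.

Lemma measurable_ind a b : measurable_fun setT (ind a b).
Proof.
have -> : ind a b = (fun t => \1_(`]-oo, b]%classic : set R) t - \1_(`]-oo, a]%classic : set R) t).
  apply/funext => t; rewrite /ind !indicE.
  by congr ((nat_of_bool _)%:R - (nat_of_bool _)%:R); apply/idP/idP; rewrite inE/= in_itv.
by apply: measurable_funB; apply: measurable_indic.
Qed.

Lemma ind_le1 a b t : `|ind a b t| <= 1.
Proof.
by rewrite /ind; case: (t <= b)%R; case: (t <= a)%R;
  rewrite ?subrr ?subr0 ?sub0r ?normrN ?normr0 ?normr1.
Qed.

Lemma L2_ind a b : L2 (ind a b).
Proof.
apply: (@L2_bounded_support _ 1 (`|a| + `|b|)); first exact: measurable_ind.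
  exact: ind_le1.
move=> x xM; rewrite /ind.
have ha : `|a| < `|x| by apply: le_lt_trans xM; rewrite lerDl.
have hb : `|b| < `|x| by apply: le_lt_trans xM; rewrite lerDr.
have [x0|x0] := ltP x 0.
  rewrite (ltr0_norm x0) in ha hb.
  have := ler_norm (- a); have := ler_norm (- b); rewrite !normrN => h1 h2.
  have -> : (x <= b)%R = true by lra.
  have -> : (x <= a)%R = true by lra.
  by rewrite subrr.
rewrite (ger0_norm x0) in ha hb.
rewrite !leNgt (le_lt_trans (ler_norm a) ha) (le_lt_trans (ler_norm b) hb).
by rewrite subrr.
Qed.

Lemma ip_ind a b : ip (ind a b) (ind a b) = `|b - a|.
Proof.
wlog ab : a b / a <= b.
  move=> h; have [ab|ba] := leP a b; first exact: h.
  rewrite distrC -h ?ltW//; apply: RI_ext => x; rewrite /ind; ring.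
rewrite ger0_norm ?subr_ge0//.
transitivity (RI (\1_(`]a, b]%classic : set R))).
  apply: RI_ext => x; rewrite /ind indicE.
  have -> : (x \in `]a, b]%classic) = (a < x) && (x <= b).
    by apply/idP/idP; rewrite inE/= in_itv.
  have [xa|xa] := leP x a => /=; first by rewrite (le_trans xa ab) subrr mul0r.
  by case: (x <= b)%R; rewrite ?subr0 ?mulr1 ?mulr0.
rewrite /RI /Rintegral integral_indic//= setIT.
rewrite lebesgue_measure_itv/= lte_fin.
by move: ab; rewrite le_eqVlt => /predU1P[->|->]; rewrite ?ltxx ?subrr.
Qed.

Lemma ind_add a b c t : ind a c t - ind a b t = ind b c t.
Proof. by rewrite /ind; ring. Qed.

Definition dstep : R -> R := derive1 step.

Lemma is_derive_step (x : R) : is_derive x 1 step (dstep x).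
Proof. exact: (smooth_upto_is_derive (smooth_upto_step 1)). Qed.

Lemma continuous_dstep : continuous dstep.
Proof. by apply: derivable_continuous; have [_ []] := smooth_upto_step (R := R) 2. Qed.

Lemma dstep0 (x : R) : (x < 0) || (1 < x) -> dstep x = 0.
Proof.
move=> h; have [_ <-] := is_derive_step x.
suff [_ ->] : is_derive x 1 step (0 : R) by [].
case/orP: h => h.
- apply: (@near_eq_is_derive _ _ _ (cst 0)).
  near=> y; rewrite step_le0// ltW//; near: y; exact: lt_nbhsl.
- apply: (@near_eq_is_derive _ _ _ (cst (1 : R))).
  near=> y; rewrite step_ge1// ltW//; near: y; exact: lt_nbhsr.
Unshelve. all: by end_near. Qed.

Lemma dstep_bounded : exists2 M, 0 < M & forall x, `|dstep x| <= M.
Proof.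
have : {within `[0, 1], continuous (fun x => `|dstep x|)}.
  apply: continuous_subspaceT => x.
  by apply: cvg_norm; exact: continuous_dstep.
move=> /(EVT_max ler01)[c _ hc]; exists (`|dstep c| + 1); first by rewrite ltr_wpDl.
move=> x; have [xi|xi] := boolP (x \in `[0, 1]%R).
  by apply: le_trans (hc _ xi) _; rewrite lerDl.
rewrite dstep0 ?normr0 ?addr_ge0//; move: xi; rewrite in_itv/= negb_and -!ltNge.
by [].
Qed.

Lemma RI_FTC (F f : R -> R) (c d : R) : c < d ->
  (forall x : R, is_derive x 1 F (f x)) -> continuous f ->
  (forall x, (x < c) || (d < x) -> f x = 0) ->
  intg f /\ RI f = F d - F c.
Proof.
move=> cd dF cf f0.
have fE : EFin \o f = (EFin \o f) \_ `[c, d].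
  apply/funext => x /=; rewrite patchE; case: ifPn => //.
  rewrite notin_setE/= in_itv/= => /negP; rewrite negb_and -!ltNge => /f0 ->.
  by [].
have cfw : {within `[c, d], continuous f} by apply: continuous_subspaceT.
have If : intg f.
  rewrite /intg fE; apply/(integrable_mkcond _ _).1 => //.
  by apply: continuous_compact_integrable => //; exact: segment_compact.
split => //; rewrite /RI /Rintegral.
have -> : (\int[mu]_x (f x)%:E = \int[mu]_(x in `[c, d]) (f x)%:E)%E.
  by rewrite [RHS]integral_mkcond -fE.
have cF : continuous F by apply: derivable_continuous => x; have [] := dF x.
rewrite (@continuous_FTC2 _ f F)//.
  split => [x _| |]; first by have [] := dF x.
    by apply: cvg_at_right_filter; exact: cF.
  by apply: cvg_at_left_filter; exact: cF.
by move=> x _; rewrite derive1E; have [_ ->] := dF x.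
Qed.

(* An approximate identity supported in [a, a + e]. *)
Definition mollif (a e x : R) : R := e^-1 * dstep (e^-1 * x + - (e^-1 * a)).

Lemma is_derive_step_scaled (a e x : R) :
  is_derive x 1 (fun x => step (e^-1 * x + - (e^-1 * a))) (mollif a e x).
Proof.
have d := is_derive_add (is_derive_scale e^-1 (is_derive_id x (1 : R))) (is_derive_cst (- (e^-1 * a)) x 1).
apply: (is_derive_eq (@is_derive_comp _ step (fun t => e^-1 * t + - (e^-1 * a)) x _ _ (is_derive_step _) d)).
by rewrite /mollif mulr1 addr0 mulrC.
Qed.

Lemma continuous_mollif (a e : R) : continuous (mollif a e).
Proof.
move=> x; apply: cvgM; first exact: cvg_cst.
have : (fun t : R => e^-1 * t + - (e^-1 * a)) @ x --> e^-1 * x + - (e^-1 * a).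
  by apply: cvgD; [apply: cvgM; [exact: cvg_cst|exact: cvg_id]|exact: cvg_cst].
move=> h; exact: (@continuous_comp _ _ _ (fun t : R => e^-1 * t + - (e^-1 * a)) dstep x h (@continuous_dstep _)).
Qed.

Lemma mollif0 (a e x : R) : 0 < e -> (x < a) || (a + e < x) -> mollif a e x = 0.
Proof.
move=> e0 h; rewrite /mollif -mulrBr dstep0 ?mulr0//.
rewrite pmulr_rlt0 ?invr_gt0// subr_lt0 mulrC ltr_pdivlMr// mul1r ltrBrDl.
exact: h.
Qed.

Lemma RI_mollif (a e : R) : 0 < e -> intg (mollif a e) /\ RI (mollif a e) = 1.
Proof.
move=> e0; have [|If ->] := RI_FTC _ (is_derive_step_scaled a e) (@continuous_mollif a e) (fun x => @mollif0 a e x e0).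
  by rewrite ltrDl.
split => //; rewrite -!mulrBr subrr mulr0 addrAC subrr add0r mulVf ?gt_eqF//.
by rewrite step_ge1// step_le0// subr0.
Qed.

End Mollifier.

(** * Mollification at Lebesgue points *)

Section LebesguePoints.
Context {R : realType}.
Implicit Types f g phi : R -> R.
Local Notation mu := (@lebesgue_measure R).

Lemma L2_mollif (a e : R) : 0 < e -> L2 (mollif a e).
Proof.
move=> e0; have [M M0 hM] := @dstep_bounded R.
apply: (@L2_bounded_support _ _ (e^-1 * M) (`|a| + e)).
- exact: continuous_measurable (@continuous_mollif _ a e).
- by move=> x; rewrite normrM gtr0_norm ?invr_gt0// ler_pM2l ?invr_gt0.
- move=> x xA; apply: mollif0 => //.
  have [x0|x0] := ltP x 0.
    rewrite (ltr0_norm x0) in xA; have := ler_norm (- a); rewrite normrN => h.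
    by apply/orP; left; lra.
  rewrite (ger0_norm x0) in xA; have := ler_norm a => h.
  by apply/orP; right; lra.
Qed.

Lemma dominated_RI (f_ : nat -> R -> R) f g : intg g ->
  (forall n, measurable_fun setT (f_ n)) -> measurable_fun setT f ->
  (forall x, f_ ^~ x @ \oo --> f x) -> (forall n x, `|f_ n x| <= g x) ->
  RI (f_ n) @[n --> \oo] --> RI f.
Proof.
move=> Ig mf_ mf ff fg.
have If_ n : intg (f_ n) by apply: intg_le Ig _.
have m1 n : measurable_fun setT (EFin \o f_ n) by apply/measurable_EFinP; exact: mf_.
have m2 : measurable_fun setT (EFin \o f) by apply/measurable_EFinP; exact: mf.
have c1 : {ae mu, forall x, setT x -> (EFin \o f_ n) x @[n --> \oo] --> (EFin \o f) x}.
  by apply: aeW => x _; apply: cvg_EFin_comp; exact: ff.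
have b1 : {ae mu, forall x, forall n, setT x -> (`|(EFin \o f_ n) x| <= (EFin \o g) x)%E}.
  by apply: aeW => x n _; rewrite lee_fin.
have [If _ h] := @dominated_convergence _ _ _ mu setT measurableT
  (fun n => EFin \o f_ n) (EFin \o f) (EFin \o g) m1 m2 c1 Ig b1.
by apply/fine_cvg; rewrite RI_EFin.
Qed.

Lemma near_at_right_seq (P : set R) (u : nat -> R) : (forall n, 0 < u n) ->
  u @ \oo --> 0 -> (\forall r \near (0 : R)^'+, P r) -> \forall n \near \oo, P (u n).
Proof.
move=> u0 ucv h.
have h0 : nbhs (0 : R) [set r | 0 < r -> P r] by exact: h.
have hu : \forall n \near \oo, 0 < u n -> P (u n) by exact: (ucv _ h0).
by apply: filterS hu => n; apply; exact: u0.
Qed.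

(** The mollifier has size at most [M / e n] on its support, which lies in the ball of radius
    [2 * e n]. The error is thus at most [4 * M] times the mean of [|f x - f a|] over that ball,
    which tends to 0 at a Lebesgue point. *)
Lemma ip_mollif_cvg f (a : R) : L2 f -> lebesgue_pt f a ->
  ip f (mollif a n.+1%:R^-1) @[n --> \oo] --> f a.
Proof.
move=> Lf fa; have [M M0 hM] := @dstep_bounded R.
pose e n : R := n.+1%:R^-1.
have e0 n : 0 < e n by rewrite invr_gt0.
pose B n : set R := ball a (2 * e n).
have e20 n : 0 < 2 * e n by rewrite mulr_gt0.
have mB n : measurable (B n) by exact: measurable_ball.
pose b n x : R := \1_(B n) x.
have Lb n : L2 (b n).
  apply: (@L2_bounded_support _ _ 1 (`|a| + 2 * e n)); first exact: measurable_indic.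
    by move=> x; rewrite /b indicE; case: (_ \in _); rewrite ?normr1 ?normr0.
  move=> x xA; rewrite /b indicE memNset// /B -ball_normE /= => h.
  have := ler_normB a (a - x); rewrite opprB addrC subrK => h2.
  by lra.
have Ib n : intg (b n).
  have := L2_mul (Lb n) (Lb n); congr intg; apply/funext => x.
  by rewrite /b indicE; case: (_ \in _); rewrite ?mulr1 ?mulr0.
pose D n := RI (fun x => `|f x - f a| * b n x).
have ID n : intg (fun x => `|f x - f a| * b n x).
  have := intg_norm (intgB (L2_mul Lf (Lb n)) (intgZ (f a) (Ib n))).
  congr intg; apply/funext => x; rewrite -mulrBl normrM; congr (_ * _).
  by rewrite /b indicE; case: (_ \in _); rewrite ?normr1 ?normr0.
have DE n : davg f a (2 * e n) = (D n / (4 * e n))%:E.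
  rewrite /davg /iavg lebesgue_measure_ball ?(ltW (e20 n))// inver gt_eqF ?pmulrn_lgt0//.
  have -> : (\int[mu]_(y in ball a (2 * e n)) `|((center (f a) \o f) y)%:E| = (D n)%:E)%E.
    rewrite RI_EFin// integral_mkcond; apply: eq_integral => x _.
    rewrite patchE /b indicE /B.
    by case: (x \in _); rewrite ?mulr1 ?mulr0.
  by rewrite -EFinM mulrC; congr (_ * _)%:E; congr (_^-1); ring.
have Dc eps : 0 < eps -> \forall n \near \oo, D n / (4 * e n) <= eps.
  move=> eps0.
  have ec : 2 * e n @[n --> \oo] --> 0.
    by rewrite -[X in _ --> X](mulr0 2); apply: cvgM; [exact: cvg_cst|exact: cvg_harmonic].
  have h : \forall r \near (0 : R)^'+, (davg f a r < eps%:E)%E.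
    have : nbhs (0 : \bar R) [set y | (y < eps%:E)%E].
      by apply: open_nbhs_nbhs; split; [exact: open_ereal_lt_ereal|rewrite /= lte_fin].
    by move=> /fa.
  have := near_at_right_seq e20 ec h; apply: filterS => n.
  by rewrite DE lte_fin => /ltW.
apply/cvgrPdist_le => eps eps0; near=> n.
have -> : f a = f a * RI (mollif a (e n)) by rewrite (proj2 (RI_mollif a (e0 n))) mulr1.
rewrite /ip -/(e n) -RIZ; last exact: (proj1 (RI_mollif a (e0 n))).
rewrite -RIB; last 2 first.
- by apply: intgZ; exact: (proj1 (RI_mollif a (e0 n))).
- by apply: L2_mul => //; exact: L2_mollif.
apply: le_trans (_ : 4 * M * (D n / (4 * e n)) <= eps); last first.
  have -> : eps = 4 * M * (eps / (4 * M)) by field; rewrite gt_eqF.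
  rewrite ler_pM2l ?mulr_gt0//; near: n; apply: Dc; by rewrite divr_gt0// mulr_gt0.
have -> : 4 * M * (D n / (4 * e n)) = RI (fun x => (M / e n) * (`|f x - f a| * b n x)).
  by rewrite RIZ// -/(D n); field; rewrite gt_eqF.
apply: RI_norm_le.
- apply: intgB; first by apply: intgZ; exact: (proj1 (RI_mollif a (e0 n))).
  by apply: L2_mul => //; exact: L2_mollif.
- exact: intgZ.
move=> x; rewrite -mulrBl normrM distrC [leRHS]mulrCA; apply: ler_wpM2l => //.
rewrite /b indicE.
have [xB|xB] := boolP (x \in B n).
  by rewrite mulr1 /mollif normrM gtr0_norm ?invr_gt0// mulrC ler_pM2r ?invr_gt0.
rewrite mulr0 mollif0 ?normr0//; move: xB; rewrite notin_setE /B -ball_normE /=.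
move=> /negP; rewrite -leNgt => h.
have := e0 n; have [xa|xa] := ltP x a => //= en.
by move: h; rewrite ler0_norm ?subr_le0//; lra.
Unshelve. all: by end_near. Qed.

End LebesguePoints.

(** * Sobolev embedding on the line *)

Section SobolevLine.
Context {R : realType}.
Implicit Types f g phi : R -> R.
Local Notation mu := (@lebesgue_measure R).

(** A null set cannot contain [0, 1], which has measure 1. *)
Lemma ae_ex (P : set R) : {ae mu, forall x, P x} -> exists x, P x.
Proof.
move=> [N [mN N0 PN]]; apply: contrapT => h.
have s01 : `[0, 1]%classic `<=` N.
  by move=> x _; apply: PN => /= Px; apply: h; exists x.
have m1 : mu `[0, 1]%classic = 1%:E.
  by rewrite lebesgue_measure_itv/= lte_fin ltr01 sube0.
have : (mu `[0%R, 1%R]%classic <= mu N)%E by apply: le_measure => //; rewrite inE.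
by rewrite m1 [X in (_ <= X)%E]N0 lee_fin ler10.
Qed.

Lemma L2_locally_integrable f : L2 f -> locally_integrable setT f.
Proof.
move=> Lf; split; [exact: L2_measurable|exact: openT|move=> K _ cK].
have [A [_ hA]] := compact_bounded cK.
have mK : measurable K by exact: compact_measurable.
have hK x : K x -> `|x| <= `|A| + 1.
  by move=> Kx; apply: (hA (`|A| + 1)) => //; rewrite (le_lt_trans (ler_norm A))// ltrDl.
pose B : R := `|A| + 1.
have Ih := L2_mul Lf (L2_ind (- B - 1) B).
have : mu.-integrable K (EFin \o (fun x => f x * ind (- B - 1) B x)).
  by apply: (@integrableS _ _ _ mu setT K _ _ mK).
move=> /integrableP[_].
congr (_ < _)%E; apply: eq_integral => x; rewrite inE => /hK.
rewrite ler_norml /ind => /andP[h1 h2] /=; rewrite h2.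
have -> : (x <= - B - 1)%R = false by apply/negbTE; rewrite -ltNge /B; lra.
by rewrite subr0 mulr1.
Qed.

(* Test functions approximating the indicator of an interval turn the weak
   derivative into a fundamental theorem of calculus between Lebesgue points. *)
Lemma weak_deriv_ind f g (a b : R) : L2 f -> L2 g -> weak_deriv f g ->
  lebesgue_pt f a -> lebesgue_pt f b -> f b - f a = ip g (ind a b).
Proof.
move=> Lf Lg fg fa fb.
pose e n : R := n.+1%:R^-1.
have e0 n : 0 < e n by rewrite invr_gt0.
have e1 n : e n <= 1 by rewrite invf_le1// ler1n.
pose st a n x : R := step ((e n)^-1 * x + - ((e n)^-1 * a)).
pose phi n x := 1 * st a n x + (-1) * st b n x.
have st0 c n x : x <= c -> st c n x = 0.
  by move=> xc; rewrite /st -mulrBr step_le0// mulr_ge0_le0 ?invr_ge0 ?subr_le0// ltW.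
have st1 c n x : c + e n <= x -> st c n x = 1.
  move=> xc; rewrite /st -mulrBr step_ge1// mulrC ler_pdivlMr// mul1r; lra.
pose M := `|a| + `|b| + 1.
have phiM n x : M < `|x| -> phi n x = 0.
  rewrite /M => xM; have := e1 n => en.
  have na := ler_norm a; have nb := ler_norm b.
  have na' := ler_norm (- a); have nb' := ler_norm (- b); rewrite !normrN in na' nb'.
  have a0 := normr_ge0 a; have b0 := normr_ge0 b.
  have [x0|x0] := ltP x 0.
    rewrite (ltr0_norm x0) in xM.
    by rewrite /phi !st0 ?mulr0 ?addr0//; lra.
  rewrite (ger0_norm x0) in xM.
  by rewrite /phi !st1 ?mulr1 ?subrr//; lra.
have Tphi n : test_fun (phi n).
  split; last by exists M => x; exact: phiM.
  move=> m; apply: smooth_upto_derivable; apply: smooth_upto_lin;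
    apply: smooth_upto_affine; exact: smooth_upto_step.
have dphi n x : derive1 (phi n) x = 1 * mollif a (e n) x + (-1) * mollif b (e n) x.
  rewrite derive1E; have [_ ->//] : is_derive x 1 (phi n) (1 * mollif a (e n) x + (-1) * mollif b (e n) x).
  exact: (is_derive_add (is_derive_scale _ (is_derive_step_scaled _ _ _)) (is_derive_scale _ (is_derive_step_scaled _ _ _))).
have E n : 1 * ip f (mollif a (e n)) + (-1) * ip f (mollif b (e n)) = - RI (fun x => g x * phi n x).
  rewrite -(fg _ (Tphi n)) -ip_linr//; try exact: L2_mollif.
  by apply: RI_ext => x; rewrite dphi.
have c1 : 1 * ip f (mollif a (e n)) + (-1) * ip f (mollif b (e n)) @[n --> \oo] --> 1 * f a + (-1) * f b.
  by apply: cvgD; apply: cvgM; try exact: cvg_cst; exact: ip_mollif_cvg.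
have mphi n : measurable_fun setT (phi n).
  apply: continuous_measurable; apply: derivable_continuous => x.
  by have [/(_ 0%N)] := Tphi n.
have stN c n x : `|st c n x| <= 1.
  by have /andP[h1 h2] := step_itv ((e n)^-1 * x + - ((e n)^-1 * c)); rewrite ger0_norm.
have c2 : RI (fun x => g x * phi n x) @[n --> \oo] --> RI (fun x => g x * ind a b x).
  apply: (@dominated_RI R _ _ (fun x => 2 * `|g x * ind (- M - 1) M x|)).
  - by apply: intgZ; apply: intg_norm; apply: L2_mul => //; exact: L2_ind.
  - by move=> n; apply: measurable_funM => //; exact: L2_measurable.
  - by apply: measurable_funM; [exact: L2_measurable|exact: measurable_ind].
  - move=> x; apply: cvgM; first exact: cvg_cst.
    (* At [x = c] the step is still 0, so the limit is the indicator of [c < x] at every point; this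
       matches the half-open convention of [ind]. *)
    have cst c : st c n x @[n --> \oo] --> (1 : R) - (x <= c)%R%:R.
      have [xc|xc] := leP x c.
        rewrite subrr; apply: cvg_near_cst; apply: nearW => n; exact: st0.
      rewrite subr0; apply: cvg_near_cst.
      have xc0 : 0 < x - c by rewrite subr_gt0.
      have /cvgrPdist_le/(_ _ xc0) := @cvg_harmonic R; apply: filterS => n.
      rewrite sub0r normrN ger0_norm ?harmonic_ge0// => h.
      by apply: st1; rewrite -lerBrDl; exact: h.
    have := cvgD (cvgM (cvg_cst (1 : R)) (cst a)) (cvgM (cvg_cst (-1 : R)) (cst b)).
    have -> : 1 * (1 - (x <= a)%R%:R) + -1 * (1 - (x <= b)%R%:R) = ind a b x by rewrite /ind; ring.
    by apply.
  - move=> n x; rewrite !normrM mulrCA; apply: ler_wpM2l => //.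
    have [xM|xM] := ltP M `|x|; first by rewrite phiM// normr0 mulr_ge0.
    have -> : ind (- M - 1) M x = 1.
      move: xM; rewrite ler_norml /ind => /andP[h1 h2]; rewrite h2.
      have -> : (x <= - M - 1)%R = false by apply/negbTE; rewrite -ltNge; lra.
      by rewrite subr0.
    rewrite normr1 mulr1; apply: le_trans (ler_normD _ _) _.
    by rewrite mul1r mulN1r normrN; have := stN a n x; have := stN b n x; lra.
have c3 : - RI (fun x => g x * phi n x) @[n --> \oo] --> 1 * f a + (-1) * f b.
  by under eq_fun do rewrite -E.
have h : 1 * f a + (-1) * f b = - ip g (ind a b) by exact: (cvg_unique _ c3 (cvgN c2)).
by rewrite -[RHS]opprK -h; ring.
Qed.

Lemma weak_deriv_hoelder_pt f g (a b : R) : L2 g ->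
  f b - f a = ip g (ind a b) -> (f b - f a) ^+ 2 <= ip g g * `|b - a|.
Proof. by move=> Lg ->; rewrite -ip_ind; apply: ip_CS => //; exact: L2_ind. Qed.

Lemma hoelder_continuous f (C : R) :
  (forall a b, (f b - f a) ^+ 2 <= C * `|b - a|) -> continuous f.
Proof.
move=> fC x; apply/cvgrPdist_le => e e0.
have C0 : 0 <= C by have := fC 0 1; rewrite subr0 normr1 mulr1; apply: le_trans; exact: sqr_ge0.
have d0 : 0 < e ^+ 2 / (C + 1) by rewrite divr_gt0 ?exprn_gt0// ltr_wpDl.
near=> y.
have h : `|x - y| <= e ^+ 2 / (C + 1).
  by near: y; apply: (cvgr_dist_le _ _ _ _ d0); exact: cvg_id.
rewrite -(ler_pXn2r (ltn0Sn 1)) ?nnegrE ?(ltW e0)// real_normK ?num_real//.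
apply: le_trans (fC y x) _; apply: le_trans (_ : (C + 1) * `|x - y| <= _).
  by rewrite ler_wpM2r// lerDl.
by rewrite mulrC -ler_pdivlMr// ltr_wpDl.
Unshelve. all: by end_near. Qed.

(** From one Lebesgue point [a0], the primitive [f a0 + ip g (ind a0 x)] agrees with [f] at every
    other Lebesgue point. *)
Lemma weak_deriv_continuous_rep f g : L2 f -> L2 g -> weak_deriv f g ->
  exists2 h, continuous h & {ae mu, forall x, f x = h x}.
Proof.
move=> Lf Lg fg.
have lp := lebesgue_differentiation (L2_locally_integrable Lf).
have [a0 ha0] := ae_ex lp.
exists (fun x => f a0 + ip g (ind a0 x)).
  apply: (@hoelder_continuous _ (ip g g)) => a b.
  apply: (@weak_deriv_hoelder_pt (fun x => f a0 + ip g (ind a0 x)) g a b) => //.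
  rewrite opprD addrACA subrr add0r.
  transitivity (1 * ip g (ind a0 b) + (-1) * ip g (ind a0 a)); first by ring.
  rewrite -ip_linr//; try exact: L2_ind.
  by apply: RI_ext => x; rewrite mul1r mulN1r ind_add.
apply: ae_imp lp => x hx; rewrite -(weak_deriv_ind Lf Lg fg ha0 hx); ring.
Qed.

Lemma weak_deriv_hoelder f g : continuous f -> L2 f -> L2 g -> weak_deriv f g ->
  forall a b, (f b - f a) ^+ 2 <= ip g g * `|b - a|.
Proof.
move=> cf Lf Lg fg a b; apply: weak_deriv_hoelder_pt => //.
have lp x : lebesgue_pt f x.
  apply: (@continuous_lebesgue_pt _ _ _ setT) => //; last exact: cf.
    by split => //; exact: openT.
  exact: L2_measurable.
exact: weak_deriv_ind.
Qed.

(** Average [f x ^+ 2 <= 2 * f y ^+ 2 + 2 * (f y - f x) ^+ 2] over [y] in the unit interval to the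
    right of [x]; there the squared increment is at most [ip g g]. *)
Lemma weak_deriv_sup f g : continuous f -> L2 f -> L2 g -> weak_deriv f g ->
  forall x, f x ^+ 2 <= 2 * (ip f f + ip g g).
Proof.
move=> cf Lf Lg fg x.
pose i := ind x (x + 1).
have i01 y : i y = 0 \/ (i y = 1 /\ x < y <= x + 1).
  rewrite /i /ind; have [yx|yx] := leP y x.
    have -> : (y <= x + 1)%R = true by lra.
    by left; rewrite subrr.
  by have [yx1|yx1] := leP y (x + 1); [right; rewrite subr0|left; rewrite subr0].
have Ii : intg (fun y => i y * i y) by apply: L2_mul; exact: L2_ind.
have RIi : RI (fun y => i y * i y) = 1.
  by rewrite -/(ip i i) ip_ind addrAC subrr add0r normr1.
have -> : f x ^+ 2 = RI (fun y => f x ^+ 2 * (i y * i y)) by rewrite RIZ// RIi mulr1.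
have I1 : intg (fun y => 2 * (f y ^+ 2)) by apply: intgZ; exact: L2_intg_sqr.
have I2 : intg (fun y => (2 * ip g g) * (i y * i y)) by exact: intgZ.
apply: (@le_trans _ _ (RI (fun y => 2 * (f y ^+ 2) + (2 * ip g g) * (i y * i y)))).
  apply: RI_le => [||y]; [exact: intgZ|exact: intgD|].
  have [->|[-> /andP[xy yx]]] := i01 y; first by rewrite !mulr0 addr0 mulr_ge0// sqr_ge0.
  rewrite !mulr1; have := weak_deriv_hoelder cf Lf Lg fg x y.
  have g0 := ip_ge0 g.
  have : `|y - x| <= 1 by rewrite ger0_norm; lra.
  move=> yx1 h; have {}h : (f y - f x) ^+ 2 <= ip g g.
    by apply: le_trans h _; rewrite ler_piMr.
  have := sqr_ge0 (2 * f y - f x); nra.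
rewrite RID// (RIZ _ Ii) (RIZ 2 (L2_intg_sqr Lf)) RIi mulr1 -ip_sqr -mulrDr.
exact: lexx.
Qed.

End SobolevLine.

(** * Riesz representation *)

Section Riesz.
Context {R : realType} {V : Type}.
(** [G] is membership and [lin s t P Q] stands for sP + tQ. No vector space structure is imposed and
    [B] is only semidefinite, because functions equal almost everywhere are not identified. The
    setting covers both L^2 with [ip] and X with its form. *)
Variables (G : V -> Prop) (lin : R -> R -> V -> V -> V) (B : V -> V -> R).
Hypothesis Glin : forall s t P Q, G P -> G Q -> G (lin s t P Q).
Hypothesis Blin : forall s t P Q W, G P -> G Q -> G W ->
  B (lin s t P Q) W = s * B P W + t * B Q W.
Hypothesis Bsym : forall P Q, G P -> G Q -> B P Q = B Q P.
Hypothesis B_ge0 : forall P, G P -> 0 <= B P P.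

Let Blinr s t P Q W : G P -> G Q -> G W -> B W (lin s t P Q) = s * B W P + t * B W Q.
Proof.
move=> GP GQ GW; rewrite Bsym//; last exact: Glin.
by rewrite Blin// (Bsym GP GW) (Bsym GQ GW).
Qed.

Lemma form_lin_sqr s t P Q : G P -> G Q ->
  B (lin s t P Q) (lin s t P Q) = s ^+ 2 * B P P + 2 * s * t * B P Q + t ^+ 2 * B Q Q.
Proof.
move=> GP GQ; have GL := Glin s t GP GQ.
by rewrite Blin// !Blinr// (Bsym GQ GP); ring.
Qed.

Lemma form_CS P Q : G P -> G Q -> B P Q ^+ 2 <= B P P * B Q Q.
Proof.
move=> GP GQ.
have key t : 0 <= B P P + 2 * t * B P Q + t ^+ 2 * B Q Q.
  have := B_ge0 (Glin 1 t GP GQ); rewrite form_lin_sqr//.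
  by rewrite expr1n mulr1 mul1r.
have [q0|q0] := eqVneq (B Q Q) 0.
  have [->|pq] := eqVneq (B P Q) 0; first by rewrite q0 expr0n mulr0.
  have := key (- (B P P + 1) / (2 * B P Q)); rewrite q0 mulr0 addr0.
  have -> : 2 * (- (B P P + 1) / (2 * B P Q)) * B P Q = - (B P P + 1) by field.
  by rewrite opprD addNKr oppr_ge0 ler10.
have qp : 0 < B Q Q by rewrite lt_neqAle eq_sym q0 B_ge0.
have := key (- B P Q / B Q Q).
have -> : (- B P Q / B Q Q) ^+ 2 * B Q Q = B P Q ^+ 2 / B Q Q by field.
have -> : 2 * (- B P Q / B Q Q) * B P Q = - (2 * (B P Q ^+ 2 / B Q Q)) by field.
by move=> h; rewrite -ler_pdivrMr//; move: h; set z := _ / _; lra.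
Qed.

Lemma form_cvg (U : set_system nat) {FU : Filter U} (u : nat -> V) z W :
  (forall n, G (u n)) -> G z -> G W ->
  B (lin 1 (-1) (u n) z) (lin 1 (-1) (u n) z) @[n --> U] --> 0 ->
  B (u n) W @[n --> U] --> B z W.
Proof.
move=> Gu Gz GW h; apply/cvgrPdist_le => e e0.
have w1 : 0 < B W W + 1 by rewrite ltr_wpDl// B_ge0.
have d0 : 0 < e ^+ 2 / (B W W + 1) by rewrite divr_gt0// exprn_gt0.
have /cvgrPdist_le/(_ _ d0) := h; apply: filterS => n.
have GD := Glin 1 (-1) (Gu n) Gz.
rewrite sub0r normrN ger0_norm ?B_ge0// => hn.
rewrite -(ler_pXn2r (ltn0Sn 1)) ?nnegrE ?(ltW e0)// real_normK ?num_real//.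
have -> : (B z W - B (u n) W) ^+ 2 = B (lin 1 (-1) (u n) z) W ^+ 2.
  by rewrite Blin//; ring.
apply: le_trans (form_CS GD GW) _.
apply: (@le_trans _ _ (e ^+ 2 / (B W W + 1) * (B W W + 1))).
  by apply: ler_pM; rewrite ?B_ge0// lerDl.
by rewrite divfK// gt_eqF.
Qed.

Hypothesis Bcomplete : forall u : nat -> V, (forall n, G (u n)) ->
  (forall e : R, 0 < e -> exists N, forall m n, (N <= m)%N -> (N <= n)%N ->
     B (lin 1 (-1) (u m) (u n)) (lin 1 (-1) (u m) (u n)) <= e) ->
  exists z, G z /\ B (lin 1 (-1) (u n) z) (lin 1 (-1) (u n) z) @[n --> \oo] --> 0.

(* The representing vector minimizes [B P P - 2 * Lam P]. *)
Lemma riesz (Lam : V -> R) (M : R) : (exists P, G P) ->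
  (forall s t P Q, G P -> G Q -> Lam (lin s t P Q) = s * Lam P + t * Lam Q) ->
  (forall P, G P -> Lam P ^+ 2 <= M * B P P) ->
  exists z, G z /\ forall Q, G Q -> B z Q = Lam Q.
Proof.
move=> [P0 GP0] Llin LM.
pose Phi P := B P P - 2 * Lam P.
have Phi_lb P : G P -> - `|M| - 1 <= Phi P.
  move=> GP; have := LM P GP; have := B_ge0 GP; have := ler_norm M; rewrite /Phi.
  set x := B P P; set l := Lam P => h1 h2 h3.
  have h4 : l ^+ 2 <= `|M| * x by apply: le_trans h3 _; rewrite ler_wpM2r.
  have m0 := normr_ge0 M.
  have h5 : (2 * l) ^+ 2 <= (x + `|M| + 1) ^+ 2.
    have := sqr_ge0 (x - `|M|); nra.
  have := ler_norm (2 * l).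
  have : `|2 * l| <= x + `|M| + 1.
    rewrite -(ler_pXn2r (ltn0Sn 1)) ?nnegrE ?real_normK ?num_real//; lra.
  lra.
pose S : set R := [set Phi P | P in [set P | G P]].
have Sinf : has_inf S.
  split; first by exists (Phi P0), P0.
  by exists (- `|M| - 1) => _ [P GP <-]; exact: Phi_lb.
pose d := inf S.
have dlb P : G P -> d <= Phi P by move=> GP; apply: ge_inf; [exact: Sinf.2|exists P].
have /choice[z hz] : forall n : nat, exists z, G z /\ Phi z < d + n.+1%:R^-1.
  move=> n; have n0 : 0 < n.+1%:R^-1 :> R by rewrite invr_gt0.
  by have [_ [P GP <-] hP] := inf_adherent n0 Sinf; exists P.
have Gz n : G (z n) by have [] := hz n.
have zz m n : B (lin 1 (-1) (z m) (z n)) (lin 1 (-1) (z m) (z n)) <=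
    2 * m.+1%:R^-1 + 2 * n.+1%:R^-1.
  have := dlb _ (Glin 2^-1 2^-1 (Gz m) (Gz n)).
  rewrite /Phi !form_lin_sqr// Llin//.
  have [_ h1] := hz m; have [_ h2] := hz n; move: h1 h2; rewrite /Phi.
  set x := B (z m) (z m); set y := B (z n) (z n); set w := B (z m) (z n).
  set l := Lam (z m); set k := Lam (z n).
  set i := m.+1%:R^-1; set j := n.+1%:R^-1; move: x y w l k i j => x y w l k i j.
  rewrite !exprVn; lra.
have [] := Bcomplete Gz.
  move=> e e0; have e4 : 0 < e / 4 by lra.
  have /cvgrPdist_le/(_ _ e4)[N _ hN] := @cvg_harmonic R.
  exists N => m n Nm Nn; apply: le_trans (zz m n) _.
  have := hN m Nm; have := hN n Nn; rewrite /= !sub0r !normrN !ger0_norm//.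
  by rewrite /harmonic/=; set i := m.+1%:R^-1; set j := n.+1%:R^-1; move: i j => i j; lra.
move=> z0 [Gz0 hz0]; exists z0; split => // Q GQ.
have cB : B (z n) Q @[n --> \oo] --> B z0 Q by exact: form_cvg hz0.
(* First variation: [Phi] is at least [d] at [z n] plus [t] times [Q] and less than [d + harmonic n]
   at [z n]; the error vanishes in the limit. *)
have key t : 0 <= 2 * t * (B z0 Q - Lam Q) + t ^+ 2 * B Q Q.
  have c1 : 2 * t * (B (z n) Q - Lam Q) + t ^+ 2 * B Q Q + harmonic n @[n --> \oo] -->
     2 * t * (B z0 Q - Lam Q) + t ^+ 2 * B Q Q + 0.
    apply: cvgD; last exact: cvg_harmonic.
    apply: cvgD; last exact: cvg_cst.
    apply: cvgM; first exact: cvg_cst.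
    exact: (cvgB cB (cvg_cst (Lam Q))).
  rewrite -[leRHS]addr0; apply: (ler_cvg_to (cvg_cst (0 : R)) c1); apply: nearW => n.
  have := dlb _ (Glin 1 t (Gz n) GQ); have [_] := hz n.
  rewrite /Phi form_lin_sqr// Llin// /harmonic/=.
  set x := B (z n) (z n); set y := B (z n) Q; set i := n.+1%:R^-1; move: x y i => x y i.
  rewrite !expr1n; lra.
(* The added 1 keeps [q] positive even if [B Q Q = 0]; taking [t = - D / q] then forces [D = 0]. *)
pose D := B z0 Q - Lam Q; pose q := B Q Q + 1.
have q0 : 0 < q by rewrite ltr_wpDl// B_ge0.
have := key (- D / q); rewrite -/D => h.
suff : D = 0 by rewrite /D => /eqP; rewrite subr_eq0 => /eqP.
have : 0 <= - (2 * D ^+ 2) / q + D ^+ 2 / q.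
  apply: le_trans h _.
  have -> : 2 * (- D / q) * D = - (2 * D ^+ 2) / q by field; rewrite gt_eqF.
  rewrite lerD2l exprMn sqrrN -mulrA ler_wpM2l ?sqr_ge0// exprVn expr2 invfM -mulrA.
  by rewrite ler_piMr ?invr_ge0 ?(ltW q0)// ler_pdivrMl// mulr1 lerDl.
rewrite -mulrDl pmulr_lge0 ?invr_gt0// => h2.
by apply/eqP; rewrite -sqrf_eq0 eq_le sqr_ge0 andbT; move: h2; lra.
Qed.

End Riesz.

(** * Calculus of weak derivatives *)

Section WeakDerivatives.
Context {R : realType}.
Implicit Types f g phi : R -> R.
Local Notation mu := (@lebesgue_measure R).

Lemma L2_continuous_support f (A : R) : continuous f ->
  (forall x, A < `|x| -> f x = 0) -> L2 f.
Proof.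
move=> cf fA; pose B := `|A|.
have : {within `[- B, B], continuous (fun x => `|f x|)}.
  by apply: continuous_subspaceT => x; apply: cvg_norm; exact: cf.
have BB : - B <= B by have := normr_ge0 A; rewrite /B; lra.
move=> /(EVT_max BB)[c _ hc]; apply: (@L2_bounded_support _ _ `|f c| B).
- exact: continuous_measurable.
- move=> x; have [xB|xB] := leP `|x| B; first by apply: hc; rewrite in_itv/= -ler_norml.
  by rewrite fA ?normr0//; apply: le_lt_trans xB; exact: ler_norm.
- by move=> x xB; apply: fA; apply: le_lt_trans xB; exact: ler_norm.
Qed.

Lemma test_smooth_upto phi : test_fun phi -> forall n, smooth_upto n phi.
Proof.
move=> [sphi _] n; elim: n phi sphi => [//|n IH] phi sphi; split; first exact: (sphi 0%N).
by apply: IH => m x; have := sphi m.+1 x; rewrite /derive1n iterSr.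
Qed.

Lemma test_L2 phi : test_fun phi -> L2 phi.
Proof.
move=> Tphi; have [sphi [M hM]] := Tphi.
by apply: (@L2_continuous_support _ M) => //; apply: derivable_continuous; exact: (sphi 0%N).
Qed.

Lemma derive1_test phi : test_fun phi -> test_fun (derive1 phi).
Proof.
move=> [sphi [M hM]]; split; first by move=> n x; have := sphi n.+1 x; rewrite /derive1n iterSr.
exists M => x Mx; rewrite derive1E.
suff [_ ->] : is_derive x 1 phi (0 : R) by [].
apply: (@near_eq_is_derive _ _ _ (cst (0 : R))).
near=> y; rewrite hM//; near: y.
have /cvgrPdist_lt : (fun y : R => `|y|) @ x --> `|x| by apply: cvg_norm; exact: cvg_id.
have d0 : 0 < `|x| - M by rewrite subr_gt0.
move=> /(_ _ d0); apply: filterS => y h.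
by have := le_lt_trans (ler_norm _) h; lra.
Unshelve. all: by end_near. Qed.

(** The factor 1 puts the argument in the form of [smooth_upto_affine]. *)
Lemma test_shift phi (c : R) : test_fun phi ->
  test_fun (fun x => phi (1 * x + c)) /\
  derive1 (fun x => phi (1 * x + c)) = (fun x => derive1 phi (1 * x + c)).
Proof.
move=> Tphi; have [sphi [M hM]] := Tphi; split; first split.
- move=> n; apply: smooth_upto_derivable; apply: smooth_upto_affine.
  exact: test_smooth_upto.
- exists (M + `|c|) => x hx; apply: hM; rewrite mul1r.
  by have := ler_normB (x + c) c; rewrite addrK; lra.
apply/funext => x; rewrite derive1E.
have d := is_derive_add (is_derive_scale 1 (is_derive_id x (1 : R))) (is_derive_cst c x 1).
have [_ ->] := @is_derive_comp _ phi (fun t => 1 * t + c) x _ _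
  (smooth_upto_is_derive (test_smooth_upto Tphi 1) _) d.
by rewrite !mulr1 addr0 mulr1.
Qed.

Lemma weak_deriv_lin (s t : R) f1 g1 f2 g2 : L2 f1 -> L2 g1 -> L2 f2 -> L2 g2 ->
  weak_deriv f1 g1 -> weak_deriv f2 g2 ->
  weak_deriv (fun x => s * f1 x + t * f2 x) (fun x => s * g1 x + t * g2 x).
Proof.
move=> Lf1 Lg1 Lf2 Lg2 w1 w2 phi Tphi.
have L1 := test_L2 Tphi; have L2 := test_L2 (derive1_test Tphi).
rewrite -/(ip _ _) -/(ip _ phi) !ip_linl//.
have := w1 _ Tphi; have := w2 _ Tphi; rewrite -!/(ip _ _) => -> ->; ring.
Qed.

Lemma weak_deriv_shift (y : R) f g : L2 f -> L2 g -> weak_deriv f g ->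
  weak_deriv (fun x => f (x + y)) (fun x => g (x + y)).
Proof.
move=> Lf Lg fg phi Tphi; have [T' dE] := test_shift (- y) Tphi.
have L1 := test_L2 T'; have L2 := test_L2 (derive1_test T').
have := fg _ T'; rewrite dE in L2 *.
rewrite -(@RI_shift R y (fun x => f x * derive1 phi (1 * x - y))); last first.
  by apply: measurable_funM; exact: L2_measurable.
rewrite -(@RI_shift R y (fun x => g x * phi (1 * x - y))); last first.
  by apply: measurable_funM; exact: L2_measurable.
have E x : 1 * (x + y) - y = x by ring.
under [X in RI X = _]eq_fun do rewrite E.
by under [X in _ = - RI X]eq_fun do rewrite E.
Qed.

Lemma weak_deriv_ae f g f' g' : measurable_fun setT f' -> measurable_fun setT g' ->
  {ae mu, forall x, f x = f' x} -> {ae mu, forall x, g x = g' x} ->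
  L2 f -> L2 g -> weak_deriv f g -> weak_deriv f' g'.
Proof.
move=> mf' mg' ff gg Lf Lg fg phi Tphi.
have m1 := L2_measurable (test_L2 Tphi).
have m2 := L2_measurable (test_L2 (derive1_test Tphi)).
have := fg _ Tphi.
rewrite (@RI_ae R _ (fun x => f' x * derive1 phi x)); last 3 first.
- by apply: measurable_funM => //; exact: L2_measurable.
- exact: measurable_funM.
- by apply: ae_imp ff => x ->.
rewrite (@RI_ae R (fun x => g x * phi x) (fun x => g' x * phi x))//.
- by apply: measurable_funM => //; exact: L2_measurable.
- exact: measurable_funM.
- by apply: ae_imp gg => x ->.
Qed.

Lemma ip_cvg (f_ : nat -> R -> R) f g : (forall n, L2 (f_ n)) -> L2 f -> L2 g ->
  RI (fun x => (f_ n x - f x) ^+ 2) @[n --> \oo] --> 0 ->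
  ip (f_ n) g @[n --> \oo] --> ip f g.
Proof.
move=> Lf_ Lf Lg h.
apply: (@form_cvg R (R -> R) (@L2 R) (fun s t f g x => s * f x + t * g x) (@ip R)) => //.
- exact: L2_lin.
- by move=> s t P Q W ? ? ?; exact: ip_linl.
- by move=> P Q _ _; exact: ipC.
- by move=> P _; exact: ip_ge0.
rewrite [X in X @ _ --> _](_ : _ = (fun n => RI (fun x => (f_ n x - f x) ^+ 2)))//.
by apply/funext => n; rewrite ip_sqr; apply: RI_ext => x; congr (_ ^+ 2); ring.
Qed.

(** Each identity pairs the sequence with one fixed test function, and such pairings are continuous
    in L^2. *)
Lemma weak_deriv_lim (f_ g_ : nat -> R -> R) f g :
  (forall n, L2 (f_ n)) -> (forall n, L2 (g_ n)) -> L2 f -> L2 g ->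
  (forall n, weak_deriv (f_ n) (g_ n)) ->
  RI (fun x => (f_ n x - f x) ^+ 2) @[n --> \oo] --> 0 ->
  RI (fun x => (g_ n x - g x) ^+ 2) @[n --> \oo] --> 0 -> weak_deriv f g.
Proof.
move=> Lf_ Lg_ Lf Lg w hf hg phi Tphi.
have L1 := test_L2 Tphi; have L2 := test_L2 (derive1_test Tphi).
have c1 := ip_cvg Lf_ Lf L2 hf.
have c2 := cvgN (ip_cvg Lg_ Lg L1 hg).
have c3 : ip (f_ n) (derive1 phi) @[n --> \oo] --> - ip g phi.
  have E : (fun n => ip (f_ n) (derive1 phi)) = (fun n => - ip (g_ n) phi).
    by apply/funext => n; exact: (w n phi Tphi).
  by rewrite E; exact: c2.
exact: (cvg_unique _ c1 c3).
Qed.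

End WeakDerivatives.

(** * The space X *)

Section Space.
Context {R : realType}.
Implicit Types (u v : H2t R) (P Q : Xt R).
Local Notation mu := (@lebesgue_measure R).

(* Every class in H^2 has a representative whose h0 and h1 are continuous; for it
   pointwise values are meaningful and controlled by the norm. *)
Definition continuousH2 u := inH2 u /\ continuous (h0 u) /\ continuous (h1 u).
Definition continuousX P := continuousH2 P.1 /\ continuousH2 P.2.

Lemma continuousX_inX P : continuousX P -> inX P.
Proof. by case=> -[? _] [? _]. Qed.

Lemma inH2_L2 u : inH2 u -> [/\ L2 (h0 u), L2 (h1 u) & L2 (h2 u)].
Proof. by case=> ? [? [? _]]. Qed.

Lemma inH2_lin (s t : R) u v : inH2 u -> inH2 v -> inH2 (H2lin s t u v).
Proof.
move=> [u0 [u1 [u2 [w0 w1]]]] [v0 [v1 [v2 [z0 z1]]]].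
by do ! split; try exact: (proj1 (L2_lin s t _ _)); try exact: (proj2 (L2_lin s t _ _));
  exact: weak_deriv_lin.
Qed.

Lemma inX_lin (s t : R) P Q : inX P -> inX Q -> inX (Xlin s t P Q).
Proof. by move=> [? ?] [? ?]; split; exact: inH2_lin. Qed.

Lemma continuousH2_lin (s t : R) u v : continuousH2 u -> continuousH2 v -> continuousH2 (H2lin s t u v).
Proof.
move=> [u_ [u0 u1]] [v_ [v0 v1]]; split; first exact: inH2_lin.
by split => x; apply: cvgD; apply: cvgM; try exact: cvg_cst;
  [exact: u0|exact: v0|exact: u1|exact: v1].
Qed.

Lemma continuousX_lin (s t : R) P Q : continuousX P -> continuousX Q -> continuousX (Xlin s t P Q).
Proof. by move=> [? ?] [? ?]; split; exact: continuousH2_lin. Qed.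

Lemma inH2_shift (y : R) u : inH2 u -> inH2 (H2shift y u).
Proof.
move=> [u0 [u1 [u2 [w0 w1]]]].
split; first exact: L2_shift. split; first exact: L2_shift. split; first exact: L2_shift.
by split; exact: weak_deriv_shift.
Qed.

Lemma continuousH2_shift (y : R) u : continuousH2 u -> continuousH2 (H2shift y u).
Proof.
move=> [u_ [u0 u1]]; split; first exact: inH2_shift.
have cy x : (fun t : R => t + y) @ x --> x + y.
  by apply: cvgD; [exact: cvg_id|exact: cvg_cst].
by split => x; [exact: (@continuous_comp _ _ _ (fun t : R => t + y) (h0 u) x (cy x) (u0 _))|
  exact: (@continuous_comp _ _ _ (fun t : R => t + y) (h1 u) x (cy x) (u1 _))].
Qed.

Lemma continuousX_shift (y : R) P : continuousX P -> continuousX (Xshift y P).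
Proof. by move=> [? ?]; split; exact: continuousH2_shift. Qed.

(** A continuous representative changes only [h0] and [h1], so the second derivatives can be
    required to coincide. *)
Definition eqH2 u v := {ae mu, forall x, h0 u x = h0 v x} /\
  {ae mu, forall x, h1 u x = h1 v x} /\ h2 u = h2 v.
Definition eqX P Q := eqH2 P.1 Q.1 /\ eqH2 P.2 Q.2.

Lemma continuousH2_rep u : inH2 u -> exists2 v, continuousH2 v & eqH2 u v.
Proof.
move=> [u0 [u1 [u2 [w0 w1]]]].
have [f cf hf] := weak_deriv_continuous_rep u0 u1 w0.
have [g cg hg] := weak_deriv_continuous_rep u1 u2 w1.
have mf := continuous_measurable cf; have mg := continuous_measurable cg.
exists ((f, g), h2 u) => //; split => //.
split; first exact: L2_ae hf u0.
split; first exact: L2_ae hg u1.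
split; first by [].
split; first exact: (weak_deriv_ae _ _ hf hg u0 u1 w0).
apply: (weak_deriv_ae _ _ hg _ u1 u2 w1) => //; first exact: L2_measurable.
exact: aeW.
Qed.

Lemma continuousX_rep P : inX P -> exists2 Q, continuousX Q & eqX P Q.
Proof.
move=> [/continuousH2_rep[u gu eu] /continuousH2_rep[v gv ev]].
by exists (u, v).
Qed.

Definition nsq u := ip (h0 u) (h0 u) + ip (h1 u) (h1 u) + ip (h2 u) (h2 u).

Lemma H2norm2E u : inH2 u -> H2norm2 u = nsq u.
Proof.
move=> /inH2_L2[L0 L1 L2]; rewrite /H2norm2 /nsq !ip_sqr -!RID//;
  try apply: intgD; exact: L2_intg_sqr.
Qed.

Lemma Xnorm2E P : inX P -> Xnorm2 P = nsq P.1 + nsq P.2.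
Proof. by move=> [? ?]; rewrite /Xnorm2 !H2norm2E. Qed.

Lemma nsq_ge0 u : 0 <= nsq u.
Proof. by rewrite /nsq !addr_ge0// ip_ge0. Qed.

Lemma ip_ae f g f' g' : L2 f -> L2 g -> L2 f' -> L2 g' ->
  {ae mu, forall x, f x = f' x} -> {ae mu, forall x, g x = g' x} -> ip f g = ip f' g'.
Proof.
move=> Lf Lg Lf' Lg' ff gg; apply: RI_ae; try (apply: measurable_funM; exact: L2_measurable).
by apply: ae_imp2 ff gg => x -> ->.
Qed.

Lemma eqH2_refl u : eqH2 u u.
Proof. by split; [exact: aeW|split => //; exact: aeW]. Qed.

Lemma eqX_refl P : eqX P P.
Proof. by split; exact: eqH2_refl. Qed.

Lemma eqH2_lin (s t : R) u v u' v' : eqH2 u u' -> eqH2 v v' ->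
  eqH2 (H2lin s t u v) (H2lin s t u' v').
Proof.
move=> [a0 [a1 a2]] [b0 [b1 b2]]; split; first by apply: ae_imp2 a0 b0 => x e1 e2; rewrite -[LHS]/(s * h0 u x + t * h0 v x) e1 e2.
split; first by apply: ae_imp2 a1 b1 => x e1 e2; rewrite -[LHS]/(s * h1 u x + t * h1 v x) e1 e2.
by rewrite -[LHS]/(fun x => s * h2 u x + t * h2 v x) a2 b2.
Qed.

Lemma eqX_lin (s t : R) P Q P' Q' : eqX P P' -> eqX Q Q' ->
  eqX (Xlin s t P Q) (Xlin s t P' Q').
Proof. by move=> [? ?] [? ?]; split; exact: eqH2_lin. Qed.

Lemma ae_shift (y : R) (A : set R) : {ae mu, forall x, A x} -> {ae mu, forall x, A (x + y)}.
Proof.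
move=> [N [mN N0 AN]]; exists ((fun x : R => x + y) @^-1` N); split.
- by rewrite -[X in measurable X]setTI; exact: (measurable_shift y).
- by rewrite -[RHS]N0; apply/esym; exact: (lebesgue_measure_shift y mN).
- by move=> x /= h; exact: AN.
Qed.

Lemma eqX_shift (y : R) P Q : eqX P Q -> eqX (Xshift y P) (Xshift y Q).
Proof.
have H u v : eqH2 u v -> eqH2 (H2shift y u) (H2shift y v).
  move=> [a0 [a1 a2]]; split; first exact: (ae_shift y a0).
  split; first exact: (ae_shift y a1).
  by rewrite -[LHS]/(fun x => h2 u (x + y)) a2.
by move=> [? ?]; split; exact: H.
Qed.

Definition wv P (i : nat) (x : R) : R := [:: h0 P.1 x; h1 P.1 x; h0 P.2 x; h1 P.2 x]`_i.
Definition wr P (x : R) : 'rV[R]_4 := vec4 (h0 P.1 x) (h1 P.1 x) (h0 P.2 x) (h1 P.2 x).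

Lemma wrE P x (i : 'I_4) : wr P x 0 i = wv P i x.
Proof. by rewrite mxE. Qed.

Lemma wv_ind (T : (R -> R) -> Prop) P : T (h0 P.1) -> T (h1 P.1) -> T (h0 P.2) ->
  T (h1 P.2) -> forall i : 'I_4, T (wv P i).
Proof. by move=> ? ? ? ? [[|[|[|[|//]]]]]. Qed.

Lemma inX_L2_wv P : inX P -> forall i : 'I_4, L2 (wv P i).
Proof. by move=> [/inH2_L2[? ? _] /inH2_L2[? ? _]]; exact: wv_ind. Qed.

Lemma wr_lin (s t : R) P Q x : wr (Xlin s t P Q) x = s *: wr P x + t *: wr Q x.
Proof. by apply/rowP => -[[|[|[|[|//]]]] h]; rewrite !mxE. Qed.

(** [Kf F] and [Nf F] are the cases [H = F] and [H = Gof F], treated by the same estimates. *)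
Definition KH (H : 'rV[R]_4 -> R) P := RI (fun x => H (wr P x)).

Lemma measurable_wr (H : 'rV[R]_4 -> R) P : continuous H -> inX P ->
  measurable_fun setT (fun x => H (wr P x)).
Proof.
move=> cH iP; apply: (@measurable_fun_rv_comp R 4 H (fun i => wv P i)) => // i.
by apply: L2_measurable; exact: (inX_L2_wv iP i).
Qed.

Lemma KH_ae (H : 'rV[R]_4 -> R) P Q : continuous H -> inX P -> inX Q -> eqX P Q ->
  KH H P = KH H Q.
Proof.
move=> cH iP iQ [[a0 [a1 _]] [b0 [b1 _]]]; apply: RI_ae; try exact: measurable_wr.
have := ae_imp2 (fun x h h' => conj h h') (ae_imp2 (fun x h h' => conj h h') a0 a1)
  (ae_imp2 (fun x h h' => conj h h') b0 b1).
by apply: ae_imp => x [[h1 h2] [h3 h4]]; rewrite /wr h1 h2 h3 h4.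
Qed.

Lemma KH_shift (H : 'rV[R]_4 -> R) (y : R) P : continuous H -> inX P ->
  KH H (Xshift y P) = KH H P.
Proof. by move=> cH iP; exact: (RI_shift y (measurable_wr cH iP)). Qed.

Lemma ip_shift (y : R) f g : L2 f -> L2 g ->
  ip (fun x => f (x + y)) (fun x => g (x + y)) = ip f g.
Proof.
move=> Lf Lg; apply: (@RI_shift R y (fun x => f x * g x)).
by apply: measurable_funM; exact: L2_measurable.
Qed.

End Space.

(** * Completeness of X *)

Section SpaceComplete.
Context {R : realType}.
Implicit Types (u v : H2t R) (P Q : Xt R).
Local Notation mu := (@lebesgue_measure R).

Lemma ip_sub f g : ip (fun x => 1 * f x + (-1) * g x) (fun x => 1 * f x + (-1) * g x) =
  RI (fun x => (f x - g x) ^+ 2) :> R.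
Proof. by rewrite ip_sqr; apply: RI_ext => x; congr (_ ^+ 2); ring. Qed.

Definition cauchyR (d : nat -> nat -> R) := forall e : R, 0 < e -> exists N,
  forall m n, (N <= m)%N -> (N <= n)%N -> d m n <= e.

Lemma cauchyR_le d d' : (forall m n, d' m n <= d m n) -> cauchyR d -> cauchyR d'.
Proof.
move=> dd h e /h[N hN]; exists N => m n Nm Nn; exact: le_trans (dd m n) (hN m n Nm Nn).
Qed.

Lemma H2_complete (u : nat -> H2t R) : (forall n, inH2 (u n)) ->
  cauchyR (fun m n => nsq (H2lin 1 (-1) (u m) (u n))) ->
  exists z, continuousH2 z /\ nsq (H2lin 1 (-1) (u n) z) @[n --> \oo] --> 0.
Proof.
move=> iu cu.
have L0 n : L2 (h0 (u n)) by have [] := inH2_L2 (iu n).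
have L1 n : L2 (h1 (u n)) by have [] := inH2_L2 (iu n).
have L2' n : L2 (h2 (u n)) by have [] := inH2_L2 (iu n).
have [|f [Lf hf]] := L2_complete L0.
  apply: cauchyR_le cu => m n; rewrite -ip_sub /nsq -addrA lerDl addr_ge0 ?ip_ge0//.
have [|g [Lg hg]] := L2_complete L1.
  apply: cauchyR_le cu => m n; rewrite -ip_sub /nsq addrAC lerDr addr_ge0 ?ip_ge0//.
have [|h [Lh hh]] := L2_complete L2'.
  apply: cauchyR_le cu => m n; rewrite -ip_sub /nsq lerDr addr_ge0 ?ip_ge0//.
have iz : inH2 ((f, g), h).
  split => //; split => //; split => //; split.
    by apply: (weak_deriv_lim L0 L1 Lf Lg _ hf hg) => n; have [_ [_ [_ []]]] := iu n.
  by apply: (weak_deriv_lim L1 L2' Lg Lh _ hg hh) => n; have [_ [_ [_ []]]] := iu n.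
have [z gz [e0 [e1 e2]]] := continuousH2_rep iz; exists z; split => //.
have [z0 z1 z2] := inH2_L2 (proj1 gz).
have hs : RI (fun x => (h0 (u n) x - f x) ^+ 2) + RI (fun x => (h1 (u n) x - g x) ^+ 2) +
   RI (fun x => (h2 (u n) x - h x) ^+ 2) @[n --> \oo] --> 0.
  have := cvgD (cvgD hf hg) hh; rewrite !addr0; exact.
rewrite [X in X @ _ --> _](_ : _ = (fun n => RI (fun x => (h0 (u n) x - f x) ^+ 2) +
  RI (fun x => (h1 (u n) x - g x) ^+ 2) + RI (fun x => (h2 (u n) x - h x) ^+ 2)))//.
apply/funext => n; rewrite /nsq.
have sub_ae f1 f2 f3 : L2 f1 -> L2 f2 -> L2 f3 -> {ae mu, forall x, f2 x = f3 x} ->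
   ip (fun x => 1 * f1 x + (-1) * f3 x) (fun x => 1 * f1 x + (-1) * f3 x) =
   RI (fun x => (f1 x - f2 x) ^+ 2).
  move=> l1 l2 l3 h23; rewrite -ip_sub; apply: ip_ae; try exact: L2_lin.
    by apply: ae_imp h23 => x ->.
  by apply: ae_imp h23 => x ->.
congr (_ + _ + _); apply: sub_ae => //.
by rewrite -e2; exact: aeW.
Qed.

Lemma X_complete (u : nat -> Xt R) : (forall n, inX (u n)) ->
  cauchyR (fun m n => Xnorm2 (Xlin 1 (-1) (u m) (u n))) ->
  exists z, continuousX z /\ Xnorm2 (Xlin 1 (-1) (u n) z) @[n --> \oo] --> 0.
Proof.
move=> iu cu.
have E m n : Xnorm2 (Xlin 1 (-1) (u m) (u n)) =
   nsq (H2lin 1 (-1) (u m).1 (u n).1) + nsq (H2lin 1 (-1) (u m).2 (u n).2).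
  by rewrite Xnorm2E//; exact: inX_lin.
have [|z1 [g1 c1]] := @H2_complete (fun n => (u n).1) (fun n => proj1 (iu n)).
  by apply: cauchyR_le cu => m n; rewrite E lerDl nsq_ge0.
have [|z2 [g2 c2]] := @H2_complete (fun n => (u n).2) (fun n => proj2 (iu n)).
  by apply: cauchyR_le cu => m n; rewrite E lerDr nsq_ge0.
exists (z1, z2); split => //.
have gz : continuousX (z1, z2) by [].
have := cvgD c1 c2; rewrite addr0.
rewrite [X in _ -> X @ _ --> _](_ : _ = (fun n => nsq (H2lin 1 (-1) (u n).1 z1) + nsq (H2lin 1 (-1) (u n).2 z2))); first exact.
by apply/funext => n; rewrite Xnorm2E//; apply: inX_lin => //; exact: continuousX_inX.
Qed.

End SpaceComplete.

Ltac intg_tac := solve [repeat first [apply: intgB | apply: intgD | apply: intgZ | exact: L2_mul]].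

(** * The quadratic form and its coercivity *)

Section Form.
Context {R : realType}.
Variables a c a2 c2 b b2 om : R.
Implicit Types (u v : H2t R) (P Q W : Xt R).

Definition qB P Q : R :=
  ip (h0 P.1) (h0 Q.1) - c * ip (h1 P.1) (h1 Q.1) + c2 * ip (h2 P.1) (h2 Q.1)
  + (ip (h0 P.2) (h0 Q.2) - a * ip (h1 P.2) (h1 Q.2) + a2 * ip (h2 P.2) (h2 Q.2))
  - om * (ip (h0 P.1) (h0 Q.2) + ip (h0 P.2) (h0 Q.1)
    + b * (ip (h1 P.1) (h1 Q.2) + ip (h1 P.2) (h1 Q.1))
    + b2 * (ip (h2 P.1) (h2 Q.2) + ip (h2 P.2) (h2 Q.1))).

Lemma Iom_qB P : inX P -> Iom a c a2 c2 b b2 om P = qB P P.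
Proof.
move=> [/inH2_L2[A0 A1 A2] /inH2_L2[B0 B1 B2]].
have i1 : I1 a c a2 c2 P = ip (h0 P.1) (h0 P.1) - c * ip (h1 P.1) (h1 P.1) + c2 * ip (h2 P.1) (h2 P.1)
    + ip (h0 P.2) (h0 P.2) - a * ip (h1 P.2) (h1 P.2) + a2 * ip (h2 P.2) (h2 P.2).
  transitivity (RI (fun x => h0 P.1 x * h0 P.1 x - c * (h1 P.1 x * h1 P.1 x) + c2 * (h2 P.1 x * h2 P.1 x)
    + h0 P.2 x * h0 P.2 x - a * (h1 P.2 x * h1 P.2 x) + a2 * (h2 P.2 x * h2 P.2 x))).
    by apply: RI_ext => x; rewrite !expr2.
  rewrite RID; try intg_tac; rewrite RIB; try intg_tac; rewrite RID; try intg_tac.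
  by rewrite RID; try intg_tac; rewrite RIB; try intg_tac; rewrite !RIZ; try intg_tac.
have i2 : I2 b b2 P = ip (h0 P.1) (h0 P.2) + b * ip (h1 P.1) (h1 P.2) + b2 * ip (h2 P.1) (h2 P.2).
  transitivity (RI (fun x => h0 P.1 x * h0 P.2 x + b * (h1 P.1 x * h1 P.2 x) + b2 * (h2 P.1 x * h2 P.2 x))).
    by apply: RI_ext => x; rewrite !mulrA.
  by rewrite RID; try intg_tac; rewrite RID; try intg_tac; rewrite !RIZ; try intg_tac.
rewrite /Iom i1 i2 /qB (ipC (h0 P.2) (h0 P.1)) (ipC (h1 P.2) (h1 P.1)) (ipC (h2 P.2) (h2 P.1)).
ring.
Qed.

Lemma qB_lin (s t : R) P Q W : inX P -> inX Q -> inX W ->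
  qB (Xlin s t P Q) W = s * qB P W + t * qB Q W.
Proof.
move=> [/inH2_L2[? ? ?] /inH2_L2[? ? ?]] [/inH2_L2[? ? ?] /inH2_L2[? ? ?]] [/inH2_L2[? ? ?] /inH2_L2[? ? ?]].
by rewrite /qB !ip_linl//; ring.
Qed.

Lemma qB_sym P Q : qB P Q = qB Q P.
Proof.
rewrite /qB (ipC (h0 P.1)) (ipC (h1 P.1)) (ipC (h2 P.1)) (ipC (h0 P.2)) (ipC (h1 P.2)) (ipC (h2 P.2)).
rewrite (ipC (h0 P.1)) (ipC (h1 P.1)) (ipC (h2 P.1)) (ipC (h0 P.2)) (ipC (h1 P.2)) (ipC (h2 P.2)).
ring.
Qed.

Lemma qB_ae P Q P' Q' : inX P -> inX Q -> inX P' -> inX Q' -> eqX P P' -> eqX Q Q' ->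
  qB P Q = qB P' Q'.
Proof.
move=> [/inH2_L2[? ? ?] /inH2_L2[? ? ?]] [/inH2_L2[? ? ?] /inH2_L2[? ? ?]].
move=> [/inH2_L2[? ? ?] /inH2_L2[? ? ?]] [/inH2_L2[? ? ?] /inH2_L2[? ? ?]].
move=> [[e0 [e1 e2]] [f0 [f1 f2]]] [[e0' [e1' e2']] [f0' [f1' f2']]].
rewrite /qB e2 e2' f2 f2'.
rewrite (ip_ae _ _ _ _ e0 e0')// (ip_ae _ _ _ _ e1 e1')// (ip_ae _ _ _ _ f0 f0')// (ip_ae _ _ _ _ f1 f1')//.
by rewrite (ip_ae _ _ _ _ e0 f0')// (ip_ae _ _ _ _ e1 f1')// (ip_ae _ _ _ _ f0 e0')// (ip_ae _ _ _ _ f1 e1').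
Qed.

Hypothesis a0 : a < 0.
Hypothesis c0 : c < 0.
Hypothesis a20 : 0 < a2.
Hypothesis c20 : 0 < c2.
Hypothesis b0 : 0 < b.
Hypothesis b20 : 0 < b2.
Hypothesis om1 : `|om| < 1.
Hypothesis oma : `|om| < - a / b.
Hypothesis omc : `|om| < - c / b.
Hypothesis oma2 : `|om| < a2 / b2.
Hypothesis omc2 : `|om| < c2 / b2.

Let cross f g : L2 f -> L2 g -> `|2 * om * ip f g| <= `|om| * (ip f f + ip g g).
Proof.
move=> Lf Lg; rewrite mulrAC mulrC normrM ler_wpM2l//.
have h1 := ip_AMGM 1 Lf Lg; have h2 := ip_AMGM (-1) Lf Lg.
by rewrite ler_norml; apply/andP; split; move: h1 h2; rewrite sqrrN expr1n; lra.
Qed.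

Let dlt := Num.min (1 - `|om|) (Num.min (Num.min (- a - `|om| * b) (- c - `|om| * b))
  (Num.min (a2 - `|om| * b2) (c2 - `|om| * b2))).

(** Each mixed product is absorbed by the two squares at the cost of a factor [|om|]. What remains
    of the coefficients are the margins listed in [dlt], positive by the bounds on the speed. *)
Lemma qB_coercive : exists2 d : R, 0 < d & forall P, inX P -> d * Xnorm2 P <= qB P P.
Proof.
exists dlt.
  by rewrite /dlt !lt_min !subr_gt0 om1 -!ltr_pdivlMr// oma omc oma2 omc2.
move=> P iP; rewrite Xnorm2E//.
have [/inH2_L2[A0 A1 A2] /inH2_L2[B0 B1 B2]] := iP.
have d1 : dlt <= 1 - `|om| by rewrite ge_min lexx.
have d2 : dlt <= - a - `|om| * b by rewrite !ge_min lexx !orbT.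
have d3 : dlt <= - c - `|om| * b by rewrite !ge_min lexx !orbT.
have d4 : dlt <= a2 - `|om| * b2 by rewrite !ge_min lexx !orbT.
have d5 : dlt <= c2 - `|om| * b2 by rewrite !ge_min lexx !orbT.
have := cross A0 B0; have := cross A1 B1; have := cross A2 B2.
have := ip_ge0 (h0 P.1); have := ip_ge0 (h1 P.1); have := ip_ge0 (h2 P.1).
have := ip_ge0 (h0 P.2); have := ip_ge0 (h1 P.2); have := ip_ge0 (h2 P.2).
rewrite /qB /nsq (ipC (h0 P.2) (h0 P.1)) (ipC (h1 P.2) (h1 P.1)) (ipC (h2 P.2) (h2 P.1)).
move: (ip (h0 P.1) (h0 P.1)) (ip (h1 P.1) (h1 P.1)) (ip (h2 P.1) (h2 P.1))
 (ip (h0 P.2) (h0 P.2)) (ip (h1 P.2) (h1 P.2)) (ip (h2 P.2) (h2 P.2))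
 (ip (h0 P.1) (h0 P.2)) (ip (h1 P.1) (h1 P.2)) (ip (h2 P.1) (h2 P.2)).
move=> x0 x1 x2 y0 y1 y2 z0 z1 z2 py2 py1 py0 px2 px1 px0.
rewrite !ler_norml => /andP[_ k2] /andP[_ k1] /andP[_ k0].
have q1 : b * (2 * om * z1) <= b * (`|om| * (x1 + y1)) by rewrite ler_wpM2l// ltW.
have q2 : b2 * (2 * om * z2) <= b2 * (`|om| * (x2 + y2)) by rewrite ler_wpM2l// ltW.
have := ler_wpM2r px0 d1; have := ler_wpM2r py0 d1.
have := ler_wpM2r px1 d3; have := ler_wpM2r py1 d2.
have := ler_wpM2r px2 d5; have := ler_wpM2r py2 d4.
lra.
Qed.

Lemma qB_upper : exists2 C : R, 0 < C & forall P, inX P -> qB P P <= C * Xnorm2 P.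
Proof.
(* A crude sum of all coefficients, which dominates each of the five bounds needed below. *)
pose C := 1 + `|om| - c - a + `|om| * b + c2 + a2 + `|om| * b2.
have o0 := normr_ge0 om; have ob : 0 <= `|om| * b by rewrite mulr_ge0// ltW.
have ob2 : 0 <= `|om| * b2 by rewrite mulr_ge0// ltW.
have hs : [/\ a < 0, c < 0, 0 < a2 & 0 < c2] by [].
case: hs => ha hc ha2 hc2.
exists C; first by rewrite /C; lra.
move=> P iP; rewrite Xnorm2E//.
have [/inH2_L2[A0 A1 A2] /inH2_L2[B0 B1 B2]] := iP.
have d1 : 1 + `|om| <= C by rewrite /C; lra.
have d2 : - a + `|om| * b <= C by rewrite /C; lra.
have d3 : - c + `|om| * b <= C by rewrite /C; lra.
have d4 : a2 + `|om| * b2 <= C by rewrite /C; lra.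
have d5 : c2 + `|om| * b2 <= C by rewrite /C; lra.
have := cross A0 B0; have := cross A1 B1; have := cross A2 B2.
have := ip_ge0 (h0 P.1); have := ip_ge0 (h1 P.1); have := ip_ge0 (h2 P.1).
have := ip_ge0 (h0 P.2); have := ip_ge0 (h1 P.2); have := ip_ge0 (h2 P.2).
rewrite /qB /nsq (ipC (h0 P.2) (h0 P.1)) (ipC (h1 P.2) (h1 P.1)) (ipC (h2 P.2) (h2 P.1)).
move: (ip (h0 P.1) (h0 P.1)) (ip (h1 P.1) (h1 P.1)) (ip (h2 P.1) (h2 P.1))
 (ip (h0 P.2) (h0 P.2)) (ip (h1 P.2) (h1 P.2)) (ip (h2 P.2) (h2 P.2))
 (ip (h0 P.1) (h0 P.2)) (ip (h1 P.1) (h1 P.2)) (ip (h2 P.1) (h2 P.2)).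
move=> x0 x1 x2 y0 y1 y2 z0 z1 z2 py2 py1 py0 px2 px1 px0.
rewrite !ler_norml => /andP[k2 _] /andP[k1 _] /andP[k0 _].
have q1 : b * (- (`|om| * (x1 + y1))) <= b * (2 * om * z1) by rewrite ler_wpM2l// ltW.
have q2 : b2 * (- (`|om| * (x2 + y2))) <= b2 * (2 * om * z2) by rewrite ler_wpM2l// ltW.
have := ler_wpM2r px0 d1; have := ler_wpM2r py0 d1.
have := ler_wpM2r px1 d3; have := ler_wpM2r py1 d2.
have := ler_wpM2r px2 d5; have := ler_wpM2r py2 d4.
move: C {d1 d2 d3 d4 d5} => C.
lra.
Qed.

End Form.

(** * Pointwise bounds by the norm of X *)

Section Pointwise.
Context {R : realType}.
Implicit Types (P Q D : Xt R).
Local Notation mu := (@lebesgue_measure R).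

Definition nw P (x : R) : R := `|wr P x|.

Lemma nw_ge0 P x : 0 <= nw P x. Proof. exact: normr_ge0. Qed.

Lemma continuous_norm_rv : continuous (fun w : 'rV[R]_4 => `|w|).
Proof. by move=> w; exact: norm_continuous. Qed.

Lemma nw_sqr_le P x : nw P x ^+ 2 <= h0 P.1 x ^+ 2 + h1 P.1 x ^+ 2 + h0 P.2 x ^+ 2 + h1 P.2 x ^+ 2.
Proof.
apply: le_trans (norm_rv_sqr_le _) _; rewrite le_eqVlt; apply/orP; left; apply/eqP.
by rewrite !big_ord_recl big_ord0 !mxE /= addr0 !addrA.
Qed.

Lemma L2_nw P : inX P -> L2 (nw P).
Proof.
move=> iP; split; first exact: (measurable_wr continuous_norm_rv iP).
have [/inH2_L2[A0 A1 _] /inH2_L2[B0 B1 _]] := iP.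
apply: (intg_le (g := fun x => h0 P.1 x ^+ 2 + h1 P.1 x ^+ 2 + h0 P.2 x ^+ 2 + h1 P.2 x ^+ 2)).
- by apply: measurable_funX; exact: (measurable_wr continuous_norm_rv iP).
- by do ?[apply: intgD]; exact: L2_intg_sqr.
- by move=> x; rewrite ger0_norm ?sqr_ge0// nw_sqr_le.
Qed.

Lemma ip_nw P : inX P -> ip (nw P) (nw P) <= Xnorm2 P.
Proof.
move=> iP; have [/inH2_L2[A0 A1 A2] /inH2_L2[B0 B1 B2]] := iP.
rewrite ip_sqr.
apply: (@le_trans _ _ (RI (fun x => h0 P.1 x ^+ 2 + h1 P.1 x ^+ 2 + h0 P.2 x ^+ 2 + h1 P.2 x ^+ 2))).
  apply: RI_le => [||x]; [exact: L2_intg_sqr (L2_nw iP)| |exact: nw_sqr_le].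
  by do ?[apply: intgD]; exact: L2_intg_sqr.
rewrite Xnorm2E// /nsq !RID; try (do ?[apply: intgD]; exact: L2_intg_sqr).
have := ip_ge0 (h2 P.1); have := ip_ge0 (h2 P.2); rewrite !ip_sqr; lra.
Qed.

(** Function and first derivative both lie in H^1, so [weak_deriv_sup] applies to all four
    coordinates. *)
Lemma nw_sup P x : continuousX P -> nw P x <= Num.sqrt (2 * Xnorm2 P).
Proof.
move=> gP; have iP := continuousX_inX gP; have [/inH2_L2[A0 A1 A2] /inH2_L2[B0 B1 B2]] := iP.
have [[[_ [_ [_ [w0 w1]]]] [c0 c1]] [[_ [_ [_ [w2 w3]]]] [c2 c3]]] := gP.
apply: norm_rv_le; first exact: sqrtr_ge0.
have n1 := nsq_ge0 P.1; have n2 := nsq_ge0 P.2.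
have key f : f x ^+ 2 <= 2 * Xnorm2 P -> `|f x| <= Num.sqrt (2 * Xnorm2 P).
  by move=> h; rewrite -sqrtr_sqr ler_wsqrtr.
move=> i; rewrite wrE; apply: key; move: i.
have i0 := ip_ge0 (h0 P.1); have i1 := ip_ge0 (h1 P.1); have i2 := ip_ge0 (h2 P.1).
have j0 := ip_ge0 (h0 P.2); have j1 := ip_ge0 (h1 P.2); have j2 := ip_ge0 (h2 P.2).
apply: (@wv_ind R (fun f => f x ^+ 2 <= 2 * Xnorm2 P)); rewrite Xnorm2E// /nsq.
- by have := weak_deriv_sup c0 A0 A1 w0 x; lra.
- by have := weak_deriv_sup c1 A1 A2 w1 x; lra.
- by have := weak_deriv_sup c2 B0 B1 w2 x; lra.
- by have := weak_deriv_sup c3 B1 B2 w3 x; lra.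
Qed.

Lemma wv_hoelder P (i : 'I_4) x y : continuousX P -> (wv P i y - wv P i x) ^+ 2 <= Xnorm2 P * `|y - x|.
Proof.
move=> gP; have iP := continuousX_inX gP; have [/inH2_L2[A0 A1 A2] /inH2_L2[B0 B1 B2]] := iP.
have [[[_ [_ [_ [w0 w1]]]] [c0 c1]] [[_ [_ [_ [w2 w3]]]] [c2 c3]]] := gP.
have n1 := nsq_ge0 P.1; have n2 := nsq_ge0 P.2.
have i0 := ip_ge0 (h0 P.1); have i1 := ip_ge0 (h1 P.1); have i2 := ip_ge0 (h2 P.1).
have j0 := ip_ge0 (h0 P.2); have j1 := ip_ge0 (h1 P.2); have j2 := ip_ge0 (h2 P.2).
move: i; apply: (@wv_ind R (fun f => (f y - f x) ^+ 2 <= Xnorm2 P * `|y - x|)); rewrite Xnorm2E// /nsq.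
- apply: le_trans (weak_deriv_hoelder c0 A0 A1 w0 x y) _; rewrite ler_wpM2r//; lra.
- apply: le_trans (weak_deriv_hoelder c1 A1 A2 w1 x y) _; rewrite ler_wpM2r//; lra.
- apply: le_trans (weak_deriv_hoelder c2 B0 B1 w2 x y) _; rewrite ler_wpM2r//; lra.
- apply: le_trans (weak_deriv_hoelder c3 B1 B2 w3 x y) _; rewrite ler_wpM2r//; lra.
Qed.

Lemma Xnorm2_ge0 P : inX P -> 0 <= Xnorm2 P.
Proof. by move=> iP; rewrite Xnorm2E// addr_ge0// nsq_ge0. Qed.

Lemma nw_lin_le (s t : R) P Q x : nw (Xlin s t P Q) x <= `|s| * nw P x + `|t| * nw Q x.
Proof. by rewrite /nw wr_lin; apply: le_trans (ler_normD _ _) _; rewrite !normrZ. Qed.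

End Pointwise.

(** * Lipschitz and Brezis-Lieb estimates for integral functionals *)

Section C1Estimates.
Context {R : realType}.
Implicit Types (P Q D : Xt R).
Variables (H : 'rV[R]_4 -> R) (kap : R -> R).
Hypothesis H1 : C1 H.
Hypothesis H0 : H 0 = 0.
Hypothesis kap0 : forall r, 0 <= kap r.
Hypothesis kap_le : forall r s, 0 <= r -> r <= s -> kap r <= kap s.
Hypothesis Hpd : forall w i, `|pd i H w| <= kap `|w| * `|w|.

(** The intermediate points satisfy [|xi i| <= |x| + 2 * |y|], which is at most [3 * r] and at most
    twice [|x| + |y|]; 8 is this 2 times the four coordinates. *)
Lemma H_lip r x y : `|x| <= r -> `|y| <= r ->
  `|H x - H y| <= 8 * kap (3 * r) * (`|x| + `|y|) * `|x - y|.
Proof.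
move=> xr yr; have [xi [h1 h2]] := MVT4 y x (proj1 H1).
rewrite h2; apply: le_trans (ler_norm_sum _ _ _) _.
have x0 := normr_ge0 x; have y0 := normr_ge0 y.
apply: (@le_trans _ _ (\sum_(i < 4) kap (3 * r) * (2 * (`|x| + `|y|)) * `|x - y|)).
  apply: ler_sum => i _; rewrite normrM; apply: ler_pM => //; last exact: coord_le_norm.
  have hx : `|xi i| <= `|x| + 2 * `|y|.
    have := h1 i; have := ler_normD (xi i - y) y; rewrite subrK.
    by have := ler_normB x y; lra.
  apply: le_trans (Hpd _ _) _; apply: ler_pM => //.
    by apply: kap_le => //; lra.
  by lra.
by rewrite sum4_const le_eqVlt; apply/orP; left; apply/eqP; ring.
Qed.

Lemma H_quad r x : `|x| <= r -> `|H x| <= 8 * kap (3 * r) * `|x| ^+ 2.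
Proof.
move=> xr; have := @H_lip r x 0 xr; rewrite normr0 H0 !subr0 addr0 => h.
rewrite expr2 mulrA; apply: h; exact: le_trans xr.
Qed.

(** By symmetry let [|x| <= |d|]. Then [H (x + d) - H d] and [H x] are separately controlled by
    [|x| * |d|]: 32 = 8 * 3 + 8, and [6 * r] is 3 times the bound [2 * r] on [|x + d|]. *)
Lemma H_brezis_lieb r x d : `|x| <= r -> `|d| <= r ->
  `|H (x + d) - H x - H d| <= 32 * kap (6 * r) * (`|x| * `|d|).
Proof.
move=> xr dr.
have r0 : 0 <= r := le_trans (normr_ge0 x) xr.
have x0 := normr_ge0 x; have d0 := normr_ge0 d.
have xd := ler_normD x d; have xd0 := normr_ge0 (x + d).
have E : 3 * (2 * r) = 6 * r by ring.
have hxd : `|x + d| <= 2 * r by lra.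
have hx : `|x| <= 2 * r by lra.
have hd : `|d| <= 2 * r by lra.
have K0 := kap0 (6 * r).
wlog : x d xr dr x0 d0 xd xd0 hxd hx hd / `|x| <= `|d|.
  move=> h; have [le|/ltW le] := leP `|x| `|d|; first exact: h.
  have := h d x; rewrite (addrC d x) (addrC `|d|) (mulrC `|d|) addrAC; apply => //.
move=> le; have k1 := H_lip hxd hd; have k2 := H_quad hx.
rewrite addrK E in k1; rewrite E in k2.
have -> : H (x + d) - H x - H d = (H (x + d) - H d) - H x by ring.
apply: le_trans (ler_normB _ _) _.
set K := kap (6 * r) in k1 k2 K0 *.
apply: le_trans (lerD k1 k2) _.
apply: (@le_trans _ _ (8 * K * (3 * `|d|) * `|x| + 8 * K * (`|d| * `|x|))).
  apply: lerD; first by rewrite ler_wpM2r// ler_wpM2l ?mulr_ge0//; lra.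
  by rewrite ler_wpM2l ?mulr_ge0// expr2 ler_wpM2r.
by rewrite le_eqVlt; apply/orP; left; apply/eqP; ring.
Qed.

Let cH : continuous H := C1_continuous H1.

Lemma intg_KH r P : inX P -> (forall x, nw P x <= r) -> intg (fun x => H (wr P x)).
Proof.
move=> iP Pr; apply: (intg_le (g := fun x => 8 * kap (3 * r) * nw P x ^+ 2)).
- exact: measurable_wr.
- by apply: intgZ; exact: L2_intg_sqr (L2_nw iP).
- by move=> x; exact: H_quad (Pr x).
Qed.

Lemma continuousX_intg_KH P : continuousX P -> intg (fun x => H (wr P x)).
Proof. by move=> gP; apply: intg_KH (continuousX_inX gP) _ => x; exact: nw_sup. Qed.

(** [H_lip] under the integral, followed by Cauchy-Schwarz; the squared form avoids square roots. *)
Lemma KH_lip r P Q : continuousX P -> continuousX Q ->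
  (forall x, nw P x <= r) -> (forall x, nw Q x <= r) ->
  (KH H P - KH H Q) ^+ 2 <=
    (8 * kap (3 * r)) ^+ 2 * (2 * (Xnorm2 P + Xnorm2 Q)) * Xnorm2 (Xlin 1 (-1) P Q).
Proof.
move=> gP gQ Pr Qr; have iP := continuousX_inX gP; have iQ := continuousX_inX gQ.
have iD := inX_lin 1 (-1) iP iQ.
set C := 8 * kap (3 * r); pose f x := 1 * nw P x + 1 * nw Q x.
have Lf : L2 f by apply: L2_lin; exact: L2_nw.
have LD := L2_nw iD.
have h : `|KH H P - KH H Q| <= C * ip f (nw (Xlin 1 (-1) P Q)).
  rewrite /KH -RIB; try exact: continuousX_intg_KH.
  rewrite /ip -RIZ; last exact: L2_mul.
  apply: RI_norm_le.
  - by apply: intgB; exact: continuousX_intg_KH.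
  - by apply: intgZ; exact: L2_mul.
  move=> x; apply: le_trans (H_lip (Pr x) (Qr x)) _; rewrite /f !mul1r /nw wr_lin.
  by rewrite scale1r scaleN1r mulrA.
have C0 : 0 <= C by rewrite mulr_ge0.
have ip0 : 0 <= ip f (nw (Xlin 1 (-1) P Q)).
  by apply: RI_ge0 => x; rewrite mulr_ge0 ?nw_ge0// /f !mul1r addr_ge0 ?nw_ge0.
rewrite -real_normK ?num_real//.
apply: (@le_trans _ _ ((C * ip f (nw (Xlin 1 (-1) P Q))) ^+ 2)).
  by rewrite lerXn2r// nnegrE ?mulr_ge0.
rewrite exprMn -mulrA ler_wpM2l ?sqr_ge0//.
apply: le_trans (ip_CS Lf LD) _; apply: ler_pM; rewrite ?ip_ge0//; last exact: ip_nw.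
have := ip_AMGM 1 (L2_nw iP) (L2_nw iQ).
rewrite /f !ip_linl ?ip_linr//; try exact: L2_nw; try exact: L2_lin.
rewrite (ipC (nw Q) (nw P)); have := ip_nw iP; have := ip_nw iQ.
rewrite expr1n; lra.
Qed.

Lemma KH_brezis_lieb r P D : continuousX P -> continuousX D ->
  (forall x, nw P x <= r) -> (forall x, nw D x <= r) ->
  `|KH H (Xlin 1 1 P D) - KH H P - KH H D| <= 32 * kap (6 * r) * ip (nw P) (nw D).
Proof.
move=> gP gD Pr Dr; have iP := continuousX_inX gP; have iD := continuousX_inX gD.
have gS := continuousX_lin 1 1 gP gD.
rewrite /KH -RIB; try exact: continuousX_intg_KH.
rewrite -RIB; try exact: continuousX_intg_KH; last by apply: intgB; exact: continuousX_intg_KH.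
have LL := L2_mul (L2_nw iP) (L2_nw iD).
rewrite /ip -RIZ//; apply: RI_norm_le.
- by apply: intgB; [apply: intgB|]; exact: continuousX_intg_KH.
- exact: intgZ.
move=> x; rewrite wr_lin !scale1r; exact: H_brezis_lieb (Pr x) (Dr x).
Qed.

End C1Estimates.

(** * Algebra of linear combinations and scalar inequalities *)

Lemma Gof0 {R : realType} (F : 'rV[R]_4 -> R) : Gof F 0 = 0.
Proof. by rewrite /Gof big1// => i _; rewrite mxE mul0r. Qed.

Local Opaque RI wr Gof pd.

Lemma Xlin10 {R : realType} (P Q : Xt R) : Xlin 1 0 P Q = P.
Proof.
case: P => -[[p0 p1] p2] [[q0 q1] q2].
by rewrite /Xlin /H2lin /=; repeat f_equal; apply/funext => x; rewrite mul1r mul0r addr0.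
Qed.

Lemma arith_scale {R : realType} (q t x y z : R) : x <= y ->
  q * (t ^+ 2 * z) + x <= q * z + y - q * (1 - t ^+ 2) * z.
Proof. by move=> h; lra. Qed.

Lemma IVT_sign {R : realType} (f : R -> R) (x y : R) : x <= y -> continuous f ->
  0 <= f x -> f y <= 0 -> exists2 t, x <= t <= y & f t = 0.
Proof.
move=> xy cf fx fy.
have hv : Num.min (f x) (f y) <= 0 <= Num.max (f x) (f y).
  by rewrite ge_min le_max fx fy orbT.
have [t] := IVT xy (continuous_subspaceT cf) hv.
by rewrite in_itv/=; exists t.
Qed.

Lemma arith_taylor {R : realType} (t q C x bqq bqd bdd K0 K1 dk : R) :
  0 <= bdd <= C * x -> `|K1 - K0 - t * dk| <= q * t ^+ 2 * x ->
  `|(1 ^+ 2 * bqq + 2 * 1 * t * bqd + t ^+ 2 * bdd) / 2 - K1 - (bqq / 2 - K0) - t * (bqd - dk)|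
  <= (C / 2 + q) * x * t ^+ 2.
Proof.
move=> /andP[b0 bC] h.
have -> : (1 ^+ 2 * bqq + 2 * 1 * t * bqd + t ^+ 2 * bdd) / 2 - K1 - (bqq / 2 - K0) -
   t * (bqd - dk) = t ^+ 2 * bdd / 2 - (K1 - K0 - t * dk) by field.
apply: le_trans (ler_normB _ _) _.
have t0 := sqr_ge0 t; rewrite ger0_norm; last by rewrite divr_ge0// mulr_ge0.
have := ler_wpM2l t0 bC; lra.
Qed.

Lemma arith_dJ {R : realType} (s x M k0 k1 : R) : `|k1 - k0| <= `|s - 1| * M ->
  s * x - k1 <= x - k0 + `|s - 1| * (`|x| + M + 1).
Proof.
move=> h; have s0 := normr_ge0 (s - 1).
have := ler_norm ((s - 1) * x); rewrite normrM => h1.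
have := ler_norm (- (k1 - k0)); rewrite normrN => h2.
lra.
Qed.

Lemma Xlin_0r {R : realType} (s : R) (P Q W : Xt R) : Xlin s 0 P Q = Xlin s 0 P W.
Proof.
by rewrite /Xlin /H2lin /=; repeat f_equal; apply/funext => x; rewrite !mul0r.
Qed.

Lemma Xlin_1l {R : realType} (s t : R) (P Q W : Xt R) :
  Xlin s t P Q = Xlin 1 t (Xlin s 0 P W) Q.
Proof.
rewrite /Xlin /H2lin /h0 /h1 /h2 /=.
by repeat f_equal; apply/funext => x; rewrite mul0r addr0 mul1r.
Qed.

Lemma arith_small {R : realType} (C t x y z : R) : 0 <= C -> 0 <= t -> t <= 1 -> 0 <= x ->
  y <= 2 * t ^+ 2 * x -> z <= 2 * y -> C * z <= t * (4 * C * x + 1).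
Proof.
move=> C0 t0 t1 x0 hy hz.
have h1 : C * z <= C * (4 * t ^+ 2 * x) by rewrite ler_wpM2l//; lra.
have Cx : 0 <= C * x by rewrite mulr_ge0.
have h2 : (C * x) * t ^+ 2 <= (C * x) * t by rewrite ler_wpM2l// expr2 ler_piMl.
lra.
Qed.

Lemma arith_near1 {R : realType} (y : R) : `|y - 1| <= 2^-1 ->
  y <= 2 /\ (4^-1 <= y ^+ 2 /\ `|y - 1| <= 1).
Proof.
move=> h; have := h; rewrite ler_norml => /andP[h1 h2].
split; first by lra.
split; last by apply: le_trans h _; lra.
have : 2^-1 <= y by lra.
by nra.
Qed.

Lemma arith_bound {R : realType} (e y1 y2 y3 : R) : e <= 2 -> y1 <= y3 -> 0 <= y1 -> 0 <= y2 ->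
  e * y1 <= 2 * y3 + y2.
Proof. by move=> ? ? ? ?; nra. Qed.

Lemma arith_descent {R : realType} (j jp j0 t dj M th : R) :
  `|j - j0 - t * dj| <= M * t ^+ 2 -> j0 <= jp -> dj <= - th + th / 4 -> 0 < t ->
  t * (M + 1) <= th / 4 -> j <= jp - t * (th / 2).
Proof.
move=> h1 h2 h3 t0 h4; have := le_trans (ler_norm _) h1 => h5.
have h6 := ler_wpM2l (ltW t0) h3; have h7 := ler_wpM2l (ltW t0) h4.
have h8 : 0 <= t ^+ 2 by exact: sqr_ge0.
lra.
Qed.

Lemma ind_itv {R : realType} (n : nat) (x : R) : 0 <= ind (- n%:R) n%:R x <= 1.
Proof.
rewrite /ind; have n0 : 0 <= n%:R :> R by [].
have [h|h] := leP x (- n%:R); last by rewrite subr0; case: (x <= _)%R; rewrite ?lexx ?ler01.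
have -> : (x <= n%:R)%R = true by apply: le_trans h _; rewrite (le_trans _ n0)// oppr_le0.
by rewrite subrr lexx ler01.
Qed.

Lemma ind1 {R : realType} (n : nat) (x : R) : `|x| < n%:R -> ind (- n%:R) n%:R x = 1.
Proof.
rewrite ltr_norml /ind => /andP[h1 h2]; rewrite (ltW h2) leNgt h1 subr0//.
Qed.

Lemma arith_abs {R : realType} (x y : R) : x ^+ 2 <= y -> `|x| <= y + 1.
Proof.
move=> h; have x0 := normr_ge0 x; rewrite -real_normK ?num_real// in h.
by move: (`|x|) x0 h => z z0 h; nra.
Qed.

Lemma ind_out {R : realType} (n : nat) (x : R) : n%:R + 1 < `|x| -> ind (- n%:R) n%:R x = 0.
Proof.
move=> h; rewrite /ind; have n0 : 0 <= n%:R :> R by [].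
have [x0|x0] := ltP x 0.
  rewrite (ltr0_norm x0) in h.
  have -> : (x <= - n%:R)%R = true by rewrite lerNr (le_trans _ (ltW h))// lerDl.
  by rewrite (le_trans (ltW x0) n0) subrr.
rewrite (ger0_norm x0) in h; have h2 : n%:R < x by apply: le_lt_trans h; rewrite lerDl.
rewrite !leNgt h2 (le_lt_trans _ h2) ?subrr// (le_trans _ n0)// oppr_le0//.
Qed.

Lemma Xlin_addK {R : realType} (P Q : Xt R) : P = Xlin 1 1 Q (Xlin 1 (-1) P Q).
Proof.
case: P Q => -[[p0 p1] p2] [[p3 p4] p5] [[[q0 q1] q2] [[q3 q4] q5]].
by rewrite /Xlin /H2lin /h0 /h1 /h2 /=; repeat f_equal; apply/funext => x; ring.
Qed.

Lemma arith_split {R : realType} (bp bz bd np nz nd : R) : bp - np = 0 ->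
  bd - nd = (np - nz - nd - (bp - bz - bd)) - (bz - nz).
Proof. by move=> /eqP; rewrite subr_eq0 => /eqP ->; ring. Qed.

Lemma arith_splitJ {R : realType} (bp bz bd np nz nd : R) :
  bd / 2 - nd = (bp / 2 - np) - (2^-1 * (bp - bz - bd) - (np - nz - nd)) - (bz / 2 - nz).
Proof. by field. Qed.

Lemma arith_divl {R : realType} (k d x y z : R) : 0 < k -> 0 < d -> d * x <= y -> k * y <= z ->
  x <= (k * d)^-1 * z.
Proof.
move=> k0 d0 h1 h2; rewrite ler_pdivlMl ?mulr_gt0// -mulrA.
by apply: le_trans h2; rewrite ler_wpM2l// ltW.
Qed.

Lemma qB_shift {R : realType} (a c a2 c2 b b2 om y : R) (P Q : Xt R) : inX P -> inX Q ->
  qB a c a2 c2 b b2 om (Xshift y P) (Xshift y Q) = qB a c a2 c2 b b2 om P Q.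
Proof.
move=> [/inH2_L2[? ? ?] /inH2_L2[? ? ?]] [/inH2_L2[? ? ?] /inH2_L2[? ? ?]].
by rewrite /qB !ip_shift.
Qed.

(** * The variational problem *)

Section Variational.
Context {R : realType}.
Variables (a c a2 c2 b b2 om d C : R).
Variables (F : 'rV[R]_4 -> R) (k : R) (kap : R -> R).
Implicit Types (P Q D : Xt R).

Local Notation B := (qB a c a2 c2 b b2 om).
Local Notation J := (Jom a c a2 c2 b b2 om F).
Local Notation Pf := (Pom a c a2 c2 b b2 om F).
Local Notation N := (KH (Gof F)).
Local Notation X := (@Xnorm2 R).
Local Notation "P \- Q" := (Xlin 1 (-1) P Q).

Hypothesis d0 : 0 < d.
Hypothesis Bcoer : forall P, inX P -> d * X P <= B P P.
Hypothesis C0 : 0 < C.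
Hypothesis Bupper : forall P, inX P -> B P P <= C * X P.
Hypothesis NL : nonlinearity F k kap.

(** It coincides with J on the manifold. The factor [1/k] leaves the nonlinear density
    [Gof F w / k - F w], nonnegative and nondecreasing along rays, and the quadratic weight [kc]. *)
Definition action P := J P - Pf P / k.
Local Notation E := action.

Let k2 : 2 < k := nl_k NL.
Let k0 : 0 < k. Proof. by apply: lt_trans (nl_k NL). Qed.
Let kc : R := 2^-1 - k^-1.
Let kc0 : 0 < kc.
Proof. by rewrite subr_gt0 ltf_pV2// posrE. Qed.

Let G0 : Gof F 0 = 0 := Gof0 F.

Lemma B_ge0 P : inX P -> 0 <= B P P.
Proof. by move=> iP; apply: le_trans (Bcoer iP); rewrite mulr_ge0 ?Xnorm2_ge0// ltW. Qed.

Lemma J_E P : inX P -> J P = B P P / 2 - KH F P.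
Proof. by move=> iP; rewrite /Jom Iom_qB. Qed.

Lemma Pf_E P : inX P -> Pf P = B P P - N P.
Proof. by move=> iP; rewrite /Pom Iom_qB. Qed.

Lemma action_E P : inX P -> E P = kc * B P P + (N P / k - KH F P).
Proof. by move=> iP; rewrite /action J_E// Pf_E// /kc; ring. Qed.

Let intF P : continuousX P -> intg (fun x => F (wr P x)).
Proof.
exact: (continuousX_intg_KH (nl_C1 NL) (nl_F0 NL) (nl_kap_ge0 NL) (nl_kap_le NL) (nl_pd NL)).
Qed.

Let intG P : continuousX P -> intg (fun x => Gof F (wr P x)).
Proof.
exact: (continuousX_intg_KH (nl_C1G NL) G0 (nl_kap_ge0 NL) (nl_kap_le NL) (nl_pdG NL)).
Qed.

Let LE P : continuousX P -> N P / k - KH F P = RI (fun x => k^-1 * Gof F (wr P x) - F (wr P x)).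
Proof.
by move=> gP; rewrite RIB ?RIZ; try apply: intgZ; try exact: intF; try exact: intG; rewrite mulrC.
Qed.

Lemma action_ge P : continuousX P -> kc * B P P <= E P.
Proof.
move=> gP; rewrite action_E; last exact: continuousX_inX.
rewrite lerDl LE//; apply: RI_ge0 => x; rewrite mulrC; exact: (nl_L_ge0 NL).
Qed.

Lemma B_lin_sqr s t P Q : inX P -> inX Q ->
  B (Xlin s t P Q) (Xlin s t P Q) = s ^+ 2 * B P P + 2 * s * t * B P Q + t ^+ 2 * B Q Q.
Proof.
apply: (form_lin_sqr (G := @inX R)); first by move=> *; exact: inX_lin.
  by move=> *; exact: qB_lin.
by move=> *; exact: qB_sym.
Qed.

Lemma B_CS P Q : inX P -> inX Q -> B P Q ^+ 2 <= B P P * B Q Q.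
Proof.
apply: (form_CS (G := @inX R) (lin := @Xlin R)).
- by move=> *; exact: inX_lin.
- by move=> *; exact: qB_lin.
- by move=> *; exact: qB_sym.
- exact: B_ge0.
Qed.

Lemma X_lin_le s t P Q : inX P -> inX Q ->
  X (Xlin s t P Q) <= 2 * s ^+ 2 * X P + 2 * t ^+ 2 * X Q.
Proof.
move=> iP iQ; rewrite !Xnorm2E//; last exact: inX_lin.
have key f g : L2 f -> L2 g ->
    ip (fun x => s * f x + t * g x) (fun x => s * f x + t * g x) <=
    2 * s ^+ 2 * ip f f + 2 * t ^+ 2 * ip g g.
  move=> Lf Lg; have := ip_ge0 (fun x => s * f x + (- t) * g x).
  by rewrite !ip_linl ?ip_linr//; try exact: L2_lin; rewrite (ipC g f); lra.
have [/inH2_L2[A0 A1 A2] /inH2_L2[B0 B1 B2]] := iP.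
have [/inH2_L2[A0' A1' A2'] /inH2_L2[B0' B1' B2']] := iQ.
have := key _ _ A0 A0'; have := key _ _ A1 A1'; have := key _ _ A2 A2'.
have := key _ _ B0 B0'; have := key _ _ B1 B1'; have := key _ _ B2 B2'.
rewrite /nsq /=; lra.
Qed.

(** Multiplication by [s] is encoded as [Xlin s 0 P Q], in which [Q] is a dummy. *)
Lemma X_scale_le s P Q : inX P -> inX Q -> X (Xlin s 0 P Q) <= 2 * s ^+ 2 * X P.
Proof. by move=> iP iQ; have := X_lin_le s 0 iP iQ; rewrite expr0n mulr0 mul0r addr0. Qed.

Lemma B_scale s P Q : inX P -> inX Q -> B (Xlin s 0 P Q) (Xlin s 0 P Q) = s ^+ 2 * B P P.
Proof. by move=> iP iQ; rewrite B_lin_sqr// expr0n mulr0 !mul0r !addr0. Qed.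

Lemma action_scale t P : continuousX P -> 0 <= t -> t <= 1 ->
  E (Xlin t 0 P P) <= E P - kc * (1 - t ^+ 2) * B P P.
Proof.
move=> gP t0 t1; have iP := continuousX_inX gP; have gt := continuousX_lin t 0 gP gP.
rewrite !action_E ?B_scale//; try exact: continuousX_inX.
apply: arith_scale; rewrite [leLHS](LE gt) [leRHS](LE gP); apply: RI_le.
- by apply: intgB; [apply: intgZ; exact: intG|exact: intF].
- by apply: intgB; [apply: intgZ; exact: intG|exact: intF].
- move=> x; rewrite wr_lin scale0r addr0 ![k^-1 * _]mulrC; exact: (nl_L_le NL).
Qed.

Lemma N_le r P : continuousX P -> (forall x, nw P x <= r) -> `|N P| <= kap r * X P.
Proof.
move=> gP Pr; have iP := continuousX_inX gP; have L := L2_intg_sqr (L2_nw iP).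
apply: (@le_trans _ _ (kap r * RI (fun x => nw P x ^+ 2))); last first.
  by rewrite ler_wpM2l ?(nl_kap_ge0 NL)// -ip_sqr ip_nw.
rewrite -RIZ//; apply: RI_norm_le; [exact: intG|exact: intgZ|].
move=> x; apply: le_trans (nl_G_le NL _) _; rewrite ler_wpM2r ?sqr_ge0//.
by apply: (nl_kap_le NL); [exact: normr_ge0|exact: Pr].
Qed.

Lemma sub_sqrt_bound (T : R) P : continuousX P -> X P <= T -> forall x, nw P x <= Num.sqrt (2 * T).
Proof.
move=> gP PT x; apply: le_trans (nw_sup x gP) _.
by rewrite ler_wsqrtr// ler_wpM2l.
Qed.

Lemma X_sub_bound (P Q : Xt R) : inX P -> inX Q -> X P <= 2 * X (P \- Q) + 2 * X Q.
Proof.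
move=> iP iQ.
have -> : P = Xlin 1 1 (P \- Q) Q.
  case: P Q {iP iQ} => -[[p0 p1] p2] [[p3 p4] p5] [[[q0 q1] q2] [[q3 q4] q5]].
  by rewrite /Xlin /H2lin /h0 /h1 /h2 /=; repeat f_equal; apply/funext => x; ring.
apply: le_trans (X_lin_le _ _ _ _) _ => //; first exact: inX_lin.
rewrite !expr1n !mulr1.
have -> // : Xlin 1 (-1) (Xlin 1 1 (P \- Q) Q) Q = P \- Q.
case: P Q {iP iQ} => -[[p0 p1] p2] [[p3 p4] p5] [[[q0 q1] q2] [[q3 q4] q5]].
by rewrite /Xlin /H2lin /h0 /h1 /h2 /=; repeat f_equal; apply/funext => x; ring.
Qed.

(** * Continuity of the functionals along filters *)

Section Continuity.
Context {T : Type} (U : set_system T) {FU : Filter U}.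
Variables (u : T -> Xt R) (P : Xt R).
Hypothesis gu : forall t, continuousX (u t).
Hypothesis gP : continuousX P.
Hypothesis uP : X (u t \- P) @[t --> U] --> 0.

Let Xb : \forall t \near U, X (u t) <= 2 + 2 * X P.
Proof.
have /cvgrPdist_le/(_ _ ltr01) := uP; apply: filterS => t.
rewrite sub0r normrN => h; have := X_sub_bound (continuousX_inX (gu t)) (continuousX_inX gP).
by have := ler_norm (X (u t \- P)); lra.
Qed.

Lemma KH_cvg (H : 'rV[R]_4 -> R) : C1 H -> H 0 = 0 ->
  (forall w i, `|pd i H w| <= kap `|w| * `|w|) -> KH H (u t) @[t --> U] --> KH H P.
Proof.
move=> cH H0 Hpd.
pose T0 := 2 + 2 * X P; pose r := Num.sqrt (2 * T0).
have XP0 := Xnorm2_ge0 (continuousX_inX gP).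
pose A := (8 * kap (3 * r)) ^+ 2 * (2 * (T0 + T0)).
have A0 : 0 <= A by rewrite mulr_ge0 ?sqr_ge0//; rewrite /T0; lra.
apply/cvgrPdist_le => e e0.
have e1 : 0 < e ^+ 2 / (A + 1) by rewrite divr_gt0 ?exprn_gt0// ltr_wpDl.
have /cvgrPdist_le/(_ _ e1) uPe := uP.
apply: (filterS2 _ _ Xb uPe) => t Xt.
rewrite sub0r normrN ger0_norm; last by apply: Xnorm2_ge0; apply: inX_lin; exact: continuousX_inX.
move=> Xe; rewrite distrC -(ler_pXn2r (ltn0Sn 1)) ?nnegrE ?(ltW e0)// real_normK ?num_real//.
apply: le_trans (KH_lip (r := r) cH H0 (nl_kap_ge0 NL) (nl_kap_le NL) Hpd (gu t) gP _ _) _.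
- exact: sub_sqrt_bound.
- by apply: sub_sqrt_bound => //; rewrite /T0; lra.
apply: (@le_trans _ _ (A * X (u t \- P))).
  apply: ler_wpM2r; first by apply: Xnorm2_ge0; apply: inX_lin; exact: continuousX_inX.
  rewrite ler_wpM2l ?sqr_ge0// ler_wpM2l// lerD// /T0; lra.
apply: (@le_trans _ _ ((A + 1) * (e ^+ 2 / (A + 1)))).
  by apply: ler_pM => //; [apply: Xnorm2_ge0; apply: inX_lin; exact: continuousX_inX|rewrite lerDl].
by rewrite mulrC divfK// gt_eqF// ltr_wpDl.
Qed.

Lemma B_cvg : B (u t) (u t) @[t --> U] --> B P P.
Proof.
have iu t := continuousX_inX (gu t); have iP := continuousX_inX gP.
have iD t : inX (u t \- P) by exact: inX_lin.
have E t : B (u t) (u t) = B (u t \- P) (u t \- P) + 2 * B (u t \- P) P + B P P.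
  by rewrite B_lin_sqr// qB_lin//; ring.
have cv1 : B (u t \- P) (u t \- P) @[t --> U] --> 0.
  apply/cvgrPdist_le => e e0; have e1 : 0 < e / C by rewrite divr_gt0.
  have /cvgrPdist_le/(_ _ e1) := uP; apply: filterS => t.
  rewrite !sub0r !normrN !ger0_norm ?Xnorm2_ge0 ?B_ge0// => h.
  by apply: le_trans (Bupper (iD t)) _; rewrite mulrC -ler_pdivlMr.
have cv2 : B (u t \- P) P @[t --> U] --> 0.
  apply/cvgrPdist_le => e e0.
  have p1 : 0 < B P P + 1 by rewrite ltr_wpDl// B_ge0.
  have e1 : 0 < e ^+ 2 / (B P P + 1) by rewrite divr_gt0// exprn_gt0.
  have /cvgrPdist_le/(_ _ e1) := cv1; apply: filterS => t.
  rewrite !sub0r !normrN ger0_norm ?B_ge0// => h.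
  rewrite -(ler_pXn2r (ltn0Sn 1)) ?nnegrE ?(ltW e0)// real_normK ?num_real//.
  apply: le_trans (B_CS (iD t) iP) _.
  apply: (@le_trans _ _ (e ^+ 2 / (B P P + 1) * (B P P + 1))).
    by apply: ler_pM; rewrite ?B_ge0// lerDl.
  by rewrite divfK// gt_eqF.
have c3 : B (u t \- P) (u t \- P) + 2 * B (u t \- P) P + B P P @[t --> U] --> 0 + 2 * 0 + B P P.
  apply: cvgD; last exact: cvg_cst.
  by apply: cvgD => //; apply: cvgM => //; exact: cvg_cst.
have -> : (fun t => B (u t) (u t)) =
  (fun t => B (u t \- P) (u t \- P) + 2 * B (u t \- P) P + B P P) by exact/funext.
by move: c3; rewrite mulr0 !add0r.
Qed.

Lemma Pf_cvg : Pf (u t) @[t --> U] --> Pf P.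
Proof.
rewrite Pf_E; last exact: continuousX_inX.
have E t : Pf (u t) = B (u t) (u t) - N (u t) by rewrite Pf_E//; exact: continuousX_inX.
have -> : (fun t => Pf (u t)) = (fun t => B (u t) (u t) - N (u t)) by exact/funext.
apply: cvgB; first exact: B_cvg.
exact: KH_cvg (nl_C1G NL) G0 (nl_pdG NL).
Qed.

End Continuity.

Lemma Xlin_sub (s t s' t' : R) P Q :
  Xlin s' t' P Q \- Xlin s t P Q = Xlin (s' - s) (t' - t) P Q.
Proof.
case: P Q => -[[p0 p1] p2] [[p3 p4] p5] [[[q0 q1] q2] [[q3 q4] q5]].
by rewrite /Xlin /H2lin /h0 /h1 /h2 /=; repeat f_equal; apply/funext => x; ring.
Qed.

Lemma Xlin_cvg {T : Type} (U : set_system T) {FU : Filter U} (s t : T -> R) (s0 t0 : R) P Q :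
  continuousX P -> continuousX Q -> s @ U --> s0 -> t @ U --> t0 ->
  X (Xlin (s i) (t i) P Q \- Xlin s0 t0 P Q) @[i --> U] --> 0.
Proof.
move=> gP gQ ss tt; have iP := continuousX_inX gP; have iQ := continuousX_inX gQ.
have cv : 2 * (s i - s0) ^+ 2 * X P + 2 * (t i - t0) ^+ 2 * X Q @[i --> U] -->
   2 * (s0 - s0) ^+ 2 * X P + 2 * (t0 - t0) ^+ 2 * X Q.
  have sq (f : T -> R) (l : R) : f @ U --> l -> (f i - l) ^+ 2 @[i --> U] --> (l - l) ^+ 2.
    move=> fl; have h : f i - l @[i --> U] --> l - l by apply: cvgB => //; exact: cvg_cst.
    exact: (cvgM h h).
  by apply: cvgD; apply: cvgM; try exact: cvg_cst; apply: cvgM; try exact: cvg_cst; exact: sq.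
rewrite !subrr expr0n !mulr0 !mul0r addr0 in cv.
apply: (squeeze_cvgr _ (cvg_cst 0) cv); apply: nearW => i.
by rewrite Xlin_sub X_lin_le// andbT Xnorm2_ge0//; exact: inX_lin.
Qed.

(** * Comparison with the infimum by scaling *)

Variable Sr : R.
Hypothesis SrE : Som a c a2 c2 b b2 om F = Sr%:E.

Lemma Sr_le Q : inX Q -> Pf Q = 0 -> X Q != 0 -> Sr <= J Q.
Proof.
move=> iQ PQ XQ; rewrite -lee_fin -SrE; apply: ereal_inf_lbound.
by exists Q.
Qed.

(** Along [t P] the functional is negative at [t = 1], and positive for small [t] because the
    quadratic part wins; it vanishes in between. *)
Lemma Pf_neg_project P : continuousX P -> Pf P < 0 ->
  exists t, [/\ 0 < t, t < 1, Pf (Xlin t 0 P P) = 0, X (Xlin t 0 P P) != 0 & 0 < B P P].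
Proof.
move=> gP PP; have iP := continuousX_inX gP.
have XP0 : 0 < X P.
  rewrite lt_neqAle Xnorm2_ge0// andbT eq_sym; apply/eqP => X0.
  have := Bupper iP; have := B_ge0 iP; have := N_le gP (fun x => nw_sup x gP).
  rewrite X0 !mulr0 normr_le0 => /eqP N0 B0 B1.
  by move: PP; rewrite Pf_E// N0 subr0; lra.
have BP0 : 0 < B P P by apply: lt_le_trans (Bcoer iP); exact: mulr_gt0.
pose r := Num.sqrt (2 * X P).
have r0 : 0 <= r by exact: sqrtr_ge0.
have d4 : 0 < d / 4 by rewrite divr_gt0.
have [rho rho0 hrho] := nl_kap_small NL d4.
(* This brings the values of [t1 P] below [rho], where [kap <= d / 4]; so N is at most
   [d / 4 * (2 * t1 ^+ 2 * X P)], half of the lower bound for the form. The other term keeps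
   [t1 < 1]. *)
pose t1 := Num.min 2^-1 (rho / (r + 1)).
have r1 : 0 < r + 1 by rewrite ltr_wpDl.
have t10 : 0 < t1 by rewrite lt_min invr_gt0 ltr0n divr_gt0.
have t11 : t1 < 1 by apply: (@le_lt_trans _ _ 2^-1); [rewrite ge_min lexx|lra].
pose f t := Pf (Xlin t 0 P P).
have f1 : f 1 < 0 by rewrite /f Xlin10.
have ft1 : 0 < f t1.
  have gt := continuousX_lin t1 0 gP gP.
  rewrite /f Pf_E; last exact: continuousX_inX.
  rewrite B_scale// subr_gt0; apply: le_lt_trans (ler_norm _) _.
  apply: le_lt_trans (N_le (r := rho) gt _) _.
    move=> x; apply: le_trans (nw_lin_le _ _ _ _ _) _; rewrite normr0 mul0r addr0 gtr0_norm//.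
    apply: (@le_trans _ _ (t1 * (r + 1))).
      by rewrite ler_wpM2l ?(ltW t10)//; have := nw_sup x gP; rewrite -/r; lra.
    by rewrite -ler_pdivlMr// ge_min lexx orbT.
  apply: (@le_lt_trans _ _ (d / 4 * (2 * t1 ^+ 2 * X P))).
    by apply: ler_pM => //; [exact: (nl_kap_ge0 NL)|apply: Xnorm2_ge0; exact: continuousX_inX|exact: X_scale_le].
  apply: (@lt_le_trans _ _ (t1 ^+ 2 * (d * X P))).
    have -> : d / 4 * (2 * t1 ^+ 2 * X P) = (t1 ^+ 2 * (d * X P)) / 2 by field.
    have : 0 < t1 ^+ 2 * (d * X P) by rewrite mulr_gt0 ?exprn_gt0// mulr_gt0.
    by move: (t1 ^+ 2 * _) => z; lra.
  by rewrite ler_wpM2l ?sqr_ge0// Bcoer.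
have cf : continuous f.
  move=> t; apply: (Pf_cvg (P := Xlin t 0 P P)) => [i||]; [exact: continuousX_lin|exact: continuousX_lin|].
  by apply: (Xlin_cvg gP gP); [exact: cvg_id|exact: cvg_cst].
have [t /andP[tt1 t1'] ft0] := IVT_sign (ltW t11) cf (ltW ft1) (ltW f1); exists t.
have t0 : 0 < t by apply: lt_le_trans tt1.
split => //.
  by rewrite lt_neqAle t1' andbT; apply/eqP => t1E; rewrite t1E in ft0; rewrite ft0 ltxx in f1.
apply/eqP => X0.
have := Bupper (inX_lin t 0 iP iP); rewrite X0 mulr0 B_scale//.
by rewrite leNgt mulr_gt0 ?exprn_gt0.
Qed.

(** Scaling down to the manifold lowers E by at least [kc * (1 - t ^+ 2) * B P P], which is
    positive; hence the strict inequality. *)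
Lemma Pf_neg_action P : continuousX P -> Pf P < 0 -> Sr < E P.
Proof.
move=> gP PP; have [t [t0 t1 Pt Xt BP]] := Pf_neg_project gP PP.
have iP := continuousX_inX gP.
have h1 : Sr <= E (Xlin t 0 P P).
  by rewrite /action Pt mul0r subr0; apply: Sr_le => //; exact: inX_lin.
have h2 := action_scale gP (ltW t0) (ltW t1).
apply: le_lt_trans h1 (le_lt_trans h2 _).
rewrite gtrDl oppr_lt0 mulr_gt0// mulr_gt0// subr_gt0.
by rewrite expr_lt1// ltW.
Qed.

(** * Taylor expansion of the action *)

Lemma pd_lip rho i (x y : 'rV[R]_4) : `|y| + `|x - y| <= rho ->
  `|pd i F x - pd i F y| <= 4 * kap rho * `|x - y|.
Proof.
move=> hr; have [xi [h1 h2]] := MVT4 y x (proj1 (nl_C1pd NL i)).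
rewrite h2; apply: le_trans (ler_norm_sum _ _ _) _.
apply: (@le_trans _ _ (\sum_(j < 4) kap rho * `|x - y|)); last by rewrite sum4_const mulrA.
apply: ler_sum => j _; rewrite normrM; apply: ler_pM => //; last exact: coord_le_norm.
apply: le_trans (nl_pdpd NL _ _ _) _; apply: (nl_kap_le NL) => //.
apply: le_trans hr; have := ler_normD (xi j - y) y; rewrite subrK addrC => h.
by apply: le_trans h _; rewrite lerD2l.
Qed.

Definition dF (w v : 'rV[R]_4) : R := \sum_i v 0 i * pd i F w.

Lemma dF_taylor r (w v : 'rV[R]_4) (t : R) : `|w| <= r -> `|v| <= r -> `|t| <= 1 ->
  `|F (w + t *: v) - F w - t * dF w v| <= 16 * kap (2 * r) * t ^+ 2 * `|v| ^+ 2.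
Proof.
move=> wr vr t1; have [xi [h1 h2]] := MVT4 w (w + t *: v) (proj1 (nl_C1 NL)).
rewrite h2 /dF mulr_sumr -sumrB; apply: le_trans (ler_norm_sum _ _ _) _.
have tv : `|t *: v| <= r by rewrite normrZ; apply: le_trans vr; rewrite ler_piMl.
apply: (@le_trans _ _ (\sum_(i < 4) (4 * kap (2 * r) * `|t *: v|) * `|t *: v|)); last first.
  rewrite sum4_const normrZ -[t ^+ 2]real_normK ?num_real// le_eqVlt; apply/orP; left; apply/eqP; ring.
apply: ler_sum => i _.
have hx : `|xi i - w| <= `|t *: v| by have := h1 i; rewrite addrAC subrr add0r.
have -> : pd i F (xi i) * (w + t *: v - w) 0 i - t * (v 0 i * pd i F w) =
  (pd i F (xi i) - pd i F w) * (t *: v) 0 i by rewrite addrAC subrr add0r !mxE; ring.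
rewrite normrM; apply: ler_pM => //; last exact: coord_le_norm.
apply: (@le_trans _ _ (4 * kap (2 * r) * `|xi i - w|)).
  by apply: pd_lip; rewrite mulr2n mulrDl !mul1r lerD// (le_trans hx).
by rewrite ler_wpM2l// mulr_ge0// (nl_kap_ge0 NL).
Qed.

Lemma dF_scale r (w v : 'rV[R]_4) (s : R) : `|w| <= r -> `|s - 1| <= 1 ->
  `|dF (s *: w) v - dF w v| <= 16 * kap (2 * r) * `|s - 1| * (`|w| * `|v|).
Proof.
move=> wr s1; rewrite /dF -sumrB; apply: le_trans (ler_norm_sum _ _ _) _.
have E0 : s *: w - w = (s - 1) *: w by rewrite scalerBl scale1r.
apply: (@le_trans _ _ (\sum_(i < 4) `|v| * (4 * kap (2 * r) * (`|s - 1| * `|w|)))); last first.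
  by rewrite sum4_const le_eqVlt; apply/orP; left; apply/eqP; ring.
apply: ler_sum => i _; rewrite -mulrBr normrM; apply: ler_pM => //; first exact: coord_le_norm.
apply: le_trans (pd_lip i (rho := 2 * r) _) _.
  rewrite E0 normrZ mulr2n mulrDl !mul1r lerD//; apply: le_trans wr.
  by rewrite ler_piMl.
by rewrite E0 normrZ.
Qed.

Lemma dF_le (w v : 'rV[R]_4) : `|dF w v| <= 4 * kap `|w| * (`|w| * `|v|).
Proof.
apply: le_trans (ler_norm_sum _ _ _) _.
apply: (@le_trans _ _ (\sum_(i < 4) `|v| * (kap `|w| * `|w|))); last first.
  by rewrite sum4_const le_eqVlt; apply/orP; left; apply/eqP; ring.
apply: ler_sum => i _; rewrite normrM; apply: ler_pM => //; first exact: coord_le_norm.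
exact: (nl_pd NL).
Qed.

Definition DK Q D : R := RI (fun x => dF (wr Q x) (wr D x)).

Lemma measurable_dF Q D : inX Q -> inX D -> measurable_fun setT (fun x : R => dF (wr Q x) (wr D x)).
Proof.
move=> iQ iD; rewrite /dF; apply: measurable_sum => i; apply: measurable_funM.
  have -> : (fun x => wr D x 0 i) = wv D i by apply/funext => x; rewrite wrE.
  by apply: L2_measurable; exact: (inX_L2_wv iD i).
by apply: measurable_wr => //; exact: C1_continuous (nl_C1pd NL i).
Qed.

Lemma intg_dF Q D : continuousX Q -> continuousX D -> intg (fun x => dF (wr Q x) (wr D x)).
Proof.
move=> gQ gD; have iQ := continuousX_inX gQ; have iD := continuousX_inX gD.
pose r := Num.sqrt (2 * X Q).
apply: (intg_le (g := fun x => 4 * kap r * (nw Q x * nw D x))).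
- exact: measurable_dF.
- by apply: intgZ; apply: L2_mul; exact: L2_nw.
- move=> x; apply: le_trans (dF_le _ _) _; apply: ler_wpM2r; first by rewrite mulr_ge0.
  rewrite ler_wpM2l//; apply: (nl_kap_le NL) => //; exact: (nw_sup x gQ).
Qed.

(** The candidate for the derivative of J at [Q] in direction [D], justified by [J_taylor]. *)
Definition dJ Q D : R := B Q D - DK Q D.

(** The remainder depends on [Q] only through the pointwise bound [r], so it is uniform when the
    base point moves along a ray. *)
Lemma J_taylor r Q D (t : R) : continuousX Q -> continuousX D ->
  (forall x, nw Q x <= r) -> (forall x, nw D x <= r) -> `|t| <= 1 ->
  `|J (Xlin 1 t Q D) - J Q - t * dJ Q D| <= (C / 2 + 16 * kap (2 * r)) * X D * t ^+ 2.
Proof.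
move=> gQ gD Qr Dr t1; have iQ := continuousX_inX gQ; have iD := continuousX_inX gD.
have gS := continuousX_lin 1 t gQ gD; have iS := continuousX_inX gS.
have L := L2_intg_sqr (L2_nw iD).
have h : `|KH F (Xlin 1 t Q D) - KH F Q - t * DK Q D| <= 16 * kap (2 * r) * t ^+ 2 * X D.
  have I1 := intF gS; have I2 := intF gQ; have I3 := intgZ t (intg_dF gQ gD).
  have -> : KH F (Xlin 1 t Q D) - KH F Q - t * DK Q D =
     RI (fun x => F (wr (Xlin 1 t Q D) x) - F (wr Q x) - t * dF (wr Q x) (wr D x)).
    rewrite RIB//; last exact: intgB.
    by rewrite RIB// RIZ//; exact: intg_dF.
  apply: (@le_trans _ _ (16 * kap (2 * r) * t ^+ 2 * RI (fun x => nw D x ^+ 2))); last first.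
    rewrite ler_wpM2l//; last by rewrite -ip_sqr ip_nw.
    by rewrite mulr_ge0 ?sqr_ge0// mulr_ge0// (nl_kap_ge0 NL).
  rewrite -RIZ//; apply: RI_norm_le; [by apply: intgB => //; exact: intgB|exact: intgZ|].
  by move=> x; rewrite wr_lin scale1r; exact: dF_taylor (Qr x) (Dr x) t1.
have hB : 0 <= B D D <= C * X D by rewrite B_ge0// Bupper.
rewrite !J_E// B_lin_sqr// /dJ.
exact: arith_taylor hB h.
Qed.

(** * Minimizers are critical points *)

Section Critical.
Variable P : Xt R.
Hypothesis gP : continuousX P.
Hypothesis PP : Pf P = 0.
Hypothesis XP : X P != 0.
Hypothesis JP : J P = Sr.

Let iP := continuousX_inX gP.

Let BP0 : 0 < B P P.
Proof.
apply: lt_le_trans (Bcoer iP); rewrite mulr_gt0// lt_neqAle eq_sym XP.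
exact: Xnorm2_ge0.
Qed.

Let NP : N P = B P P.
Proof. by move: PP; rewrite Pf_E// => /eqP; rewrite subr_eq0 => /eqP. Qed.

(** The form scales exactly by [expR (2 * s)], N at least by [expR (k * s)], and the two agree at
    [s = 0]. *)
Lemma Pf_ray_neg s : 0 < s -> Pf (Xlin (expR s) 0 P P) < 0.
Proof.
move=> s0; have gs := continuousX_lin (expR s) 0 gP gP.
rewrite Pf_E; last exact: continuousX_inX.
have : expR (k * s) * N P <= N (Xlin (expR s) 0 P P).
  rewrite /KH -RIZ; last exact: intG.
  apply: RI_le => [||x]; [by apply: intgZ; exact: intG|exact: intG|].
  by rewrite wr_lin scale0r addr0; exact: (nl_G_exp_ge NL _ (ltW s0)).
rewrite NP B_scale// subr_lt0; apply: lt_le_trans.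
rewrite ltr_pM2r// -expRM_natl ltr_expR ltr_pM2r//.
Qed.

Lemma Pf_ray_pos s : s < 0 -> 0 < Pf (Xlin (expR s) 0 P P).
Proof.
move=> s0; have gs := continuousX_lin (expR s) 0 gP gP.
rewrite Pf_E; last exact: continuousX_inX.
have : N (Xlin (expR s) 0 P P) <= expR (k * s) * N P.
  rewrite /KH -RIZ; last exact: intG.
  apply: RI_le => [||x]; [exact: intG|by apply: intgZ; exact: intG|].
  by rewrite wr_lin scale0r addr0; exact: (nl_G_exp_le NL _ (ltW s0)).
rewrite NP B_scale// subr_gt0 => h; apply: le_lt_trans h _.
by rewrite ltr_pM2r// -expRM_natl ltr_expR ltr_nM2r.
Qed.

(** Using [N P = B P P] and [nl_F_exp], the increment of J is at most [B P P] times [(expR (2 * s) -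
    1) / 2 - (expR (k * s) - 1) / k], which [exp_bernoulli] makes nonpositive. *)
Lemma J_ray_max s : J (Xlin (expR s) 0 P P) <= J P.
Proof.
have gs := continuousX_lin (expR s) 0 gP gP.
rewrite !J_E//; last exact: continuousX_inX.
have : N P * ((expR (k * s) - 1) / k) <= KH F (Xlin (expR s) 0 P P) - KH F P.
  rewrite mulrC /KH -RIZ; last exact: intG.
  rewrite -RIB; try exact: intF.
  apply: RI_le => [||x]; [by apply: intgZ; exact: intG|by apply: intgB; exact: intF|].
  by rewrite wr_lin scale0r addr0 mulrC; exact: (nl_F_exp NL).
rewrite NP B_scale// -expRM_natl => h.
have := exp_bernoulli s k2; rewrite -(ler_pM2l BP0) => h2.
move: h h2; set e2 := expR (2 * s); set ek := expR (k * s).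
set x := B P P; set K1 := KH F _; set K2 := KH F P.
move: x K1 K2 => x K1 K2; move: e2 ek => e2 ek h h2.
have := le_trans h2 h; lra.
Qed.

Lemma dJ_ray_lip D : continuousX D -> exists2 L, 0 < L & forall s, `|s - 1| <= 1 ->
  dJ (Xlin s 0 P P) D <= dJ P D + `|s - 1| * L.
Proof.
move=> gD; have iD := continuousX_inX gD.
pose r := Num.sqrt (2 * X P).
pose M := 16 * kap (2 * r) * ip (nw P) (nw D).
have ip0 : 0 <= ip (nw P) (nw D) by apply: RI_ge0 => x; rewrite mulr_ge0 ?nw_ge0.
have M0 : 0 <= M by rewrite mulr_ge0// mulr_ge0// (nl_kap_ge0 NL).
exists (`|B P D| + M + 1); first by rewrite ltr_wpDl// addr_ge0.
move=> s s1; have gs := continuousX_lin s 0 gP gP.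
have LL := L2_mul (L2_nw iP) (L2_nw iD).
have h : `|DK (Xlin s 0 P P) D - DK P D| <= `|s - 1| * M.
  have I1 := intg_dF gs gD; have I2 := intg_dF gP gD.
  rewrite /DK -RIB//.
  have -> : `|s - 1| * M = RI (fun x => (16 * kap (2 * r) * `|s - 1|) * (nw P x * nw D x)).
    by rewrite RIZ// /M /ip mulrCA mulrA.
  apply: RI_norm_le; [exact: intgB|exact: intgZ|].
  by move=> x; rewrite wr_lin scale0r addr0; apply: dF_scale s1; exact: (nw_sup x gP).
rewrite /dJ qB_lin// mul0r addr0.
exact: arith_dJ h.
Qed.

(* If J' P D < 0, then for small t the values of Pom at e^s P + t D have opposite
   signs at s = -del and s = del, so some point of this segment lies on the manifold;
   there J is below max_s J(e^s P) = S. *)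
Lemma dJ_ge0 D : continuousX D -> 0 <= dJ P D.
Proof.
move=> gD; have iD := continuousX_inX gD; rewrite leNgt; apply/negP => th0.
pose th := - dJ P D; have {}th0 : 0 < th by rewrite oppr_gt0.
have [L L0 hL] := dJ_ray_lip gD.
(* The first bound keeps [expR s] between 1/2 and 3/2; the second lets the slope [- th] change by at
   most [th / 4] when the base point moves. *)
pose eta := Num.min 2^-1 (th / (4 * L)).
have eta0 : 0 < eta by rewrite lt_min invr_gt0 ltr0n divr_gt0// mulr_gt0.
have eta1 : eta <= 2^-1 by rewrite ge_min lexx.
have eta2 : eta * L <= th / 4.
  have : eta <= th / (4 * L) by rewrite ge_min lexx orbT.
  rewrite -(ler_pM2r L0) => h; apply: le_trans h _; rewrite le_eqVlt; apply/orP; left; apply/eqP.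
  by field; rewrite gt_eqF.
have [del del0 hdel] : exists2 del : R, 0 < del & forall s, `|s| <= del -> `|expR s - 1| <= eta.
  have := @continuous_expR R 0 => /cvgrPdist_le/(_ _ eta0)/nbhs_ballP[e /= e0 he].
  exists (e / 2) => [|s hs]; first by rewrite divr_gt0.
  have := he s; rewrite -ball_normE /= sub0r normrN expR0 distrC; apply.
  by apply: le_lt_trans hs _; rewrite ltr_pdivrMr// ltr_pMr// ltr1n.
pose r := 2 * Num.sqrt (2 * X P) + Num.sqrt (2 * X D).
pose M := (C / 2 + 16 * kap (2 * r)) * X D.
have XD0 := Xnorm2_ge0 iD.
have M0 : 0 <= M.
  rewrite mulr_ge0// addr_ge0 ?divr_ge0 ?(ltW C0)// mulr_ge0//; exact: (nl_kap_ge0 NL).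
pose gam s t := Xlin (expR s) t P D.
have gg s t : continuousX (gam s t) by exact: continuousX_lin.
have gam0 s : gam s 0 = Xlin (expR s) 0 P P by exact: Xlin_0r.
have gamE s t : gam s t = Xlin 1 t (Xlin (expR s) 0 P P) D by exact: Xlin_1l.
have cvt s : Pf (gam s t) @[t --> (0 : R)^'+] --> Pf (gam s 0).
  apply: (Pf_cvg (P := gam s 0)) => [t||]; [exact: gg|exact: gg|].
  apply: (Xlin_cvg gP gD); first exact: cvg_cst.
  by apply: cvg_at_right_filter; exact: cvg_id.
have neg : Pf (gam del 0) < 0 by rewrite gam0; exact: Pf_ray_neg.
have pos : 0 < Pf (gam (- del) 0) by rewrite gam0; apply: Pf_ray_pos; rewrite oppr_lt0.
(* [t * (M + 1) <= th / 4] absorbs the Taylor remainder, the next bound keeps the crossing point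
   away from 0, and the signs are inherited from [t = 0] by continuity. *)
have [t [[t0 t1] [tM tX] [tn tp]]] : exists t, [/\ 0 < t /\ t <= 1,
    t * (M + 1) <= th / 4 /\ t * (4 * C * X D + 1) < B P P / 4 &
    Pf (gam del t) < 0 /\ 0 < Pf (gam (- del) t)].
  have h1 : 0 < M + 1 by rewrite ltr_wpDl.
  have h2 : 0 < 4 * C * X D + 1 by rewrite ltr_wpDl// !mulr_ge0// ltW.
  have h3 : 0 < th / 4 / (M + 1) by do 2 apply: divr_gt0 => //.
  have h4 : 0 < B P P / 4 / (4 * C * X D + 1) by do 2 apply: divr_gt0 => //.
  near (0 : R)^'+ => t; exists t.
  split; split.
  - by near: t; exact: nbhs_right_gt.
  - by near: t; apply: nbhs_right_le.
  - by rewrite -ler_pdivlMr//; near: t; exact: nbhs_right_le.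
  - by rewrite -ltr_pdivlMr//; near: t; exact: nbhs_right_lt.
  - near: t; exact: (cvgr_lt _ (cvt del) _ neg).
  - near: t; exact: (cvgr_gt _ (cvt (- del)) _ pos).
have cf : continuous (fun s => Pf (gam s t)).
  move=> s; apply: (Pf_cvg (P := gam s t)) => [i||]; [exact: gg|exact: gg|].
  apply: (Xlin_cvg gP gD); last exact: cvg_cst.
  exact: continuous_expR.
have dd : - del <= del by apply: (le_trans _ (ltW del0)); rewrite oppr_le0 ltW.
have [s /andP[s1 s2] Ps] := IVT_sign dd cf (ltW tp) (ltW tn).
have {s1 s2} hs : `|expR s - 1| <= eta by apply: hdel; rewrite ler_norml s1.
have [es [e14 s11]] := arith_near1 (le_trans hs eta1).
have es0 := expR_gt0 s.
have gs := continuousX_lin (expR s) 0 gP gP.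
(* If it vanished, the scaled [P] would have the norm of [t D], so its form would lie below
   [B P P / 4]; yet [expR s >= 1/2]. *)
have Xg : X (gam s t) != 0.
  apply/eqP => X0.
  have := X_sub_bound (continuousX_inX (gg s 0)) (continuousX_inX (gg s t)).
  rewrite X0 mulr0 addr0 Xlin_sub subrr sub0r gam0.
  have := X_lin_le 0 (- t) iP iD; rewrite expr0n mulr0 mul0r add0r sqrrN => h1 h2.
  have := Bupper (continuousX_inX gs); rewrite B_scale//.
  have e1 : B P P / 4 <= expR s ^+ 2 * B P P by rewrite mulrC ler_wpM2r// ltW.
  move=> h3; have := le_trans e1 h3; rewrite leNgt => /negP; apply.
  apply: le_lt_trans tX; exact: arith_small (ltW C0) (ltW t0) t1 XD0 h1 h2.
have Jg : J (gam s t) <= J P - t * (th / 2).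
  have rP x : nw (Xlin (expR s) 0 P P) x <= r.
    apply: le_trans (nw_lin_le _ _ _ _ _) _; rewrite normr0 mul0r addr0 gtr0_norm//.
    rewrite /r; have h1 := nw_sup x gP; have h2 := nw_ge0 P x; have h3 := sqrtr_ge0 (2 * X D).
    exact: arith_bound.
  have rD x : nw D x <= r.
    by apply: le_trans (nw_sup x gD) _; rewrite /r lerDr mulr_ge0// sqrtr_ge0.
  have t1' : `|t| <= 1 by rewrite gtr0_norm.
  have := J_taylor gs gD rP rD t1'; rewrite -gamE -/M => hT.
  have hdJ : dJ (Xlin (expR s) 0 P P) D <= - th + th / 4.
    apply: le_trans (hL _ s11) _; rewrite /th opprK lerD2l.
    by apply: le_trans (ler_wpM2r (ltW L0) hs) _.
  exact: arith_descent hT (J_ray_max s) hdJ t0 tM.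
have := le_trans (Sr_le (continuousX_inX (gg s t)) Ps Xg) Jg; rewrite JP.
by rewrite leNgt gtrDl oppr_lt0 mulr_gt0// divr_gt0.
Unshelve. all: by end_near. Qed.

Lemma dJ_eq0 D : continuousX D -> dJ P D = 0.
Proof.
move=> gD; apply/eqP; rewrite eq_le dJ_ge0// andbT.
have gN := continuousX_lin (-1) 0 gD gD; have iD := continuousX_inX gD.
have := dJ_ge0 gN; rewrite /dJ qB_sym qB_lin// mul0r addr0 (qB_sym _ _ _ _ _ _ _ D P).
have -> : DK P (Xlin (-1) 0 D D) = (-1) * DK P D.
  rewrite /DK -RIZ; last exact: intg_dF.
  apply: RI_ext => x; rewrite wr_lin scale0r addr0 scaleN1r /dF mulr_sumr.
  by apply: eq_bigr => i _; rewrite !mxE; ring.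
by rewrite !mulN1r -opprD oppr_ge0.
Qed.

Lemma J_critical D : continuousX D -> is_derive (0 : R) (1 : R) (fun t : R => J (Xlin 1 t P D)) (0 : R).
Proof.
move=> gD; have iD := continuousX_inX gD.
pose r := Num.sqrt (2 * X P) + Num.sqrt (2 * X D).
pose M := (C / 2 + 16 * kap (2 * r)) * X D.
have XD0 := Xnorm2_ge0 iD.
have M0 : 0 <= M.
  rewrite mulr_ge0// addr_ge0 ?divr_ge0 ?(ltW C0)// mulr_ge0//; exact: (nl_kap_ge0 NL).
have rP x : nw P x <= r.
  by apply: le_trans (nw_sup x gP) _; rewrite /r lerDl sqrtr_ge0.
have rD x : nw D x <= r.
  by apply: le_trans (nw_sup x gD) _; rewrite /r lerDr sqrtr_ge0.
apply/is_deriveP; apply/cvgrPdist_le => e e0.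
have e1 : 0 < e / (M + 1) by rewrite divr_gt0// ltr_wpDl.
near=> h.
have h0 : h != 0 by near: h; exact: nbhs_dnbhs_neq.
have h1 : `|h| <= 1 by near: h; exact: dnbhs0_le.
have he : `|h| <= e / (M + 1) by near: h; exact: dnbhs0_le.
have := J_taylor gP gD rP rD h1; rewrite dJ_eq0// mulr0 subr0 -/M addr0 Xlin10 => hT.
rewrite sub0r normrN normrM normfV mulrC ler_pdivrMr ?normr_gt0//.
apply: le_trans hT _; rewrite -[h ^+ 2]real_normK ?num_real// expr2 mulrA.
rewrite ler_wpM2r//; apply: (@le_trans _ _ ((M + 1) * `|h|)); first by rewrite ler_wpM2r// lerDl.
by rewrite mulrC -ler_pdivlMr// ltr_wpDl.
Unshelve. all: by end_near. Qed.

End Critical.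

(** * Weak limits and splitting along an ultrafilter *)

Lemma ip_nw_tail P (e : R) : continuousX P -> 0 < e -> exists A : nat,
  ip (fun x => nw P x * (1 - ind (- A%:R) A%:R x)) (fun x => nw P x * (1 - ind (- A%:R) A%:R x)) <= e.
Proof.
move=> gP e0; have iP := continuousX_inX gP.
have mi A : measurable_fun setT (fun x : R => 1 - ind (- A%:R) A%:R x).
  by apply: measurable_funB => //; exact: measurable_ind.
have mn := L2_measurable (L2_nw iP).
pose g n x := nw P x * (1 - ind (- n%:R) n%:R x) * (nw P x * (1 - ind (- n%:R) n%:R x)).
have i01 (n : nat) (x : R) : 0 <= ind (- n%:R) n%:R x <= 1.
  exact: ind_itv.
have cv : RI (g n) @[n --> \oo] --> RI (fun=> 0 : R).
  apply: (@dominated_RI R g (fun=> 0) (fun x => nw P x ^+ 2)).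
  - exact: L2_intg_sqr (L2_nw iP).
  - by move=> n; apply: measurable_funM; apply: measurable_funM.
  - by [].
  - move=> x; apply: cvg_near_cst.
    have := nbhs_infty_gtr `|x|; apply: filterS => n hn.
    by rewrite /g ind1 ?subrr ?mulr0.
  - move=> n x; have /andP[h1 h2] := i01 n x; have h3 := nw_ge0 P x.
    rewrite ger0_norm; last by rewrite !mulr_ge0 ?subr_ge0.
    rewrite expr2; apply: ler_pM; rewrite ?mulr_ge0 ?subr_ge0//; rewrite ler_piMr// gerBl//.
have z0 : RI (fun=> 0 : R) = 0.
  transitivity (RI (fun x => 0 * nw P x ^+ 2)); first by apply: RI_ext => x; rewrite mul0r.
  by rewrite RIZ ?mul0r//; exact: L2_intg_sqr (L2_nw iP).
rewrite z0 in cv; have /cvgrPdist_le/(_ _ e0)[A _ hA] := cv.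
exists A; have := hA A (leqnn A); rewrite /= sub0r normrN; apply: le_trans; exact: ler_norm.
Qed.

Section Compactness.
Context (U : set_system nat) {UU : UltraFilter U}.
Let PU : ProperFilter U := @ultra_proper _ U UU.
Local Existing Instance PU.
Variables (Phi : nat -> Xt R) (T eps : R).
Hypothesis gPhi : forall n, continuousX (Phi n).
Hypothesis XPhi : \forall n \near U, X (Phi n) <= T.

Let iPhi n : inX (Phi n) := continuousX_inX (gPhi n).

(** Compactness of the segment yields a cluster point, and an ultrafilter converges to each of its
    cluster points. *)
Lemma ultra_bounded_cvg (f : nat -> R) (M : R) :
  (\forall n \near U, `|f n| <= M) -> exists l : R, f @ U --> l.
Proof.
move=> fM; have fU : (f @ U) `[- M, M]%classic.
  by apply: filterS fM => n /=; rewrite in_itv/= ler_norml.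
have [l [_ cl]] := @segment_compact R (- M) M (f @ U) _ fU.
exists l => V Vl; have [//|h] := in_ultra_setVsetC (f @^-1` V) UU.
by have [x [/= nVx Vx]] := cl (~` V) V h Vl.
Qed.

Let T0 : 0 <= T.
Proof.
have [n hn] := filter_ex XPhi; exact: le_trans (Xnorm2_ge0 (iPhi n)) hn.
Qed.

Lemma form_riesz (Lam : Xt R -> R) (M : R) :
  (forall s t P Q, continuousX P -> continuousX Q -> Lam (Xlin s t P Q) = s * Lam P + t * Lam Q) ->
  (forall P, continuousX P -> Lam P ^+ 2 <= M * B P P) ->
  exists z, continuousX z /\ forall Q, continuousX Q -> B z Q = Lam Q.
Proof.
move=> Ll LM; apply: (riesz (G := @continuousX R) (lin := @Xlin R) _ _ _ _ _ _ Ll LM).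
- exact: continuousX_lin.
- by move=> s t P Q W gP gQ gW; apply: qB_lin; exact: continuousX_inX.
- by move=> P Q _ _; exact: qB_sym.
- by move=> P gP; apply: B_ge0; exact: continuousX_inX.
- move=> u gu cu.
  have iu n := continuousX_inX (gu n).
  have [|z [gz hz]] := @X_complete R u iu.
    move=> e e0; have [N0 hN] := cu (d * e) (mulr_gt0 d0 e0); exists N0 => m n Nm Nn.
    rewrite -(ler_pM2l d0); apply: le_trans (hN m n Nm Nn).
    by apply: Bcoer; exact: inX_lin.
  exists z; split => //.
  have hC : C * X (u n \- z) @[n --> \oo] --> C * 0 by apply: cvgM => //; exact: cvg_cst.
  rewrite mulr0 in hC; apply: (squeeze_cvgr _ (cvg_cst 0) hC); apply: nearW => n.
  have iD : inX (u n \- z) by apply: inX_lin => //; exact: continuousX_inX.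
  by rewrite B_ge0// Bupper.
- by exists (Phi 0%N).
Qed.

(** The limits of [B (Phi n) Q] define a functional of [Q]: linear because limits are unique,
    bounded by Cauchy-Schwarz and the norm bound [T]. Its representing element is the weak limit. *)
Lemma weak_limit : exists2 z, continuousX z & forall Q, continuousX Q -> B (Phi n) Q @[n --> U] --> B z Q.
Proof.
have ex Q : exists l : R, continuousX Q -> B (Phi n) Q @[n --> U] --> l.
  have [gQ|nQ] := pselect (continuousX Q); last by exists 0.
  have [|l hl] := @ultra_bounded_cvg (fun n => B (Phi n) Q) (C * T * B Q Q + 1); last by exists l.
  apply: filterS XPhi => n hn; have iQ := continuousX_inX gQ.
  apply: arith_abs; apply: le_trans (B_CS (iPhi n) iQ) _.
  apply: ler_wpM2r; first exact: B_ge0.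
  apply: le_trans (Bupper (iPhi n)) _; exact: ler_wpM2l (ltW C0) _ _ hn.
have [Lam hLam] := choice ex.
have [|P gP|z [gz hz]] := @form_riesz Lam (C * T).
- move=> s t P Q gP gQ.
  have h1 : B (Phi n) (Xlin s t P Q) @[n --> U] --> s * Lam P + t * Lam Q.
    have -> : (fun n => B (Phi n) (Xlin s t P Q)) = (fun n => s * B (Phi n) P + t * B (Phi n) Q).
      apply/funext => n; rewrite qB_sym qB_lin//; try exact: continuousX_inX.
      by rewrite (qB_sym _ _ _ _ _ _ _ P) (qB_sym _ _ _ _ _ _ _ Q).
    by apply: cvgD; apply: cvgM; try exact: cvg_cst; exact: hLam.
  exact: (cvg_unique _ (hLam _ (continuousX_lin s t gP gQ)) h1).
- have iP := continuousX_inX gP; have h := hLam P gP.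
  apply: (cvgr_to_le (cvgM h h)); apply: filterS XPhi => n hn.
  have := B_CS (iPhi n) iP; rewrite expr2 => hB; apply: le_trans hB _.
  apply: ler_wpM2r; first exact: B_ge0.
  apply: le_trans (Bupper (iPhi n)) _; exact: ler_wpM2l (ltW C0) _ _ hn.
by exists z => // Q gQ; rewrite hz//; exact: hLam.
Qed.

Lemma wv_lin (s t : R) P Q (i : 'I_4) x :
  wv (Xlin s t P Q) i x = s * wv P i x + t * wv Q i x.
Proof. by rewrite -!wrE wr_lin !mxE. Qed.

Lemma wv_sqr_le P (i : 'I_4) x : continuousX P -> wv P i x ^+ 2 <= 2 / d * B P P.
Proof.
move=> gP; have iP := continuousX_inX gP; have X0 := Xnorm2_ge0 iP.
have h : `|wv P i x| <= Num.sqrt (2 * X P).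
  by apply: le_trans (nw_sup x gP); rewrite -wrE; exact: coord_le_norm.
apply: (@le_trans _ _ (2 * X P)).
  by rewrite -[leRHS]sqr_sqrtr ?mulr_ge0// -[leLHS]real_normK ?num_real// lerXn2r// nnegrE sqrtr_ge0.
by rewrite -mulrA ler_wpM2l// ler_pdivlMl// Bcoer.
Qed.

Section WeakLimit.
Variable z : Xt R.
Hypothesis gz : continuousX z.
Hypothesis Bz : forall Q, continuousX Q -> B (Phi n) Q @[n --> U] --> B z Q.

Let iz := continuousX_inX gz.
Let D n := Phi n \- z.
Let gD n : continuousX (D n). Proof. exact: continuousX_lin. Qed.
Let iD n := continuousX_inX (gD n).
Let TD := 2 * T + 2 * X z.

Let XD : \forall n \near U, X (D n) <= TD.
Proof.
apply: filterS XPhi => n hn; apply: le_trans (X_lin_le _ _ (iPhi n) iz) _.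
by rewrite sqrrN expr1n !mulr1 lerD2r ler_wpM2l.
Qed.

(* Point evaluations are bounded on X, hence represented by the form, so weak
   convergence yields pointwise convergence. *)
Lemma wv_cvg (i : 'I_4) x : wv (Phi n) i x @[n --> U] --> wv z i x.
Proof.
have [kx [gkx hk]] := @form_riesz (fun P => wv P i x) (2 / d)
  (fun s t P Q _ _ => wv_lin s t P Q i x) (fun P gP => wv_sqr_le i x gP).
have h := Bz gkx.
have -> : (fun n => wv (Phi n) i x) = (fun n => B (Phi n) kx).
  by apply/funext => n; rewrite qB_sym hk.
by rewrite -hk// qB_sym.
Qed.

Lemma nwD_cvg0 x : nw (D n) x @[n --> U] --> 0.
Proof.
have h : wr (D n) x @[n --> U] --> (0 : 'rV[R]_4).
  apply: cvg_rv => i; rewrite mxE.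
  have -> : (fun n => wr (D n) x 0 i) = (fun n => 1 * wv (Phi n) i x + (-1) * wv z i x).
    by apply/funext => n; rewrite wrE wv_lin.
  have hc : 1 * wv (Phi n) i x + (-1) * wv z i x @[n --> U] --> 1 * wv z i x + (-1) * wv z i x.
    by apply: cvgD; apply: cvgM; try exact: cvg_cst; exact: wv_cvg.
  by move: hc; rewrite mul1r mulN1r subrr.
by have := cvg_norm h; rewrite normr0; exact.
Qed.

(** The [D n] share one Hoelder constant, so pointwise smallness at [x] extends to a neighbourhood
    independent of [n]; compactness, in the form of [near_covering], makes it uniform along the
    ultrafilter. *)
Lemma nwD_unif (A e : R) : 0 < e ->
  \forall n \near U, forall x, `|x| <= A -> nw (D n) x <= e.
Proof.
move=> e0; have e2 : 0 < e / 2 by rewrite divr_gt0.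
have TD0 : 0 <= TD by rewrite addr_ge0// mulr_ge0// Xnorm2_ge0.
have dl0 : 0 < (e / 2) ^+ 2 / (TD + 1) by rewrite divr_gt0 ?exprn_gt0// ltr_wpDl.
have cpt : near_covering `[- A, A]%classic by apply/compact_near_coveringP; exact: segment_compact.
have key : \forall n \near U, `[- A, A]%classic `<=` (fun x => nw (D n) x <= e).
  apply: (cpt nat U (fun n x => nw (D n) x <= e)) => x _.
  near=> y n.
  have h1 : nw (D n) x <= e / 2.
    have -> : nw (D n) x = `|0 - nw (D n) x| by rewrite sub0r normrN ger0_norm ?nw_ge0.
    by near: n; exact: (cvgr_dist_le _ _ (nwD_cvg0 x) _ e2).
  have h2 : X (D n) <= TD by near: n; exact: XD.
  have h3 : `|x - y| <= (e / 2) ^+ 2 / (TD + 1).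
    by near: y; apply: (cvgr_dist_le _ _ _ _ dl0); exact: cvg_id.
  have h4 : `|wr (D n) y - wr (D n) x| <= e / 2.
    apply: norm_rv_le; first exact: ltW.
    move=> i; rewrite mxE [(- wr _ _) _ _]mxE !wrE.
    rewrite -(ler_pXn2r (ltn0Sn 1)) ?nnegrE ?(ltW e2)// real_normK ?num_real//.
    apply: le_trans (wv_hoelder i x y (gD n)) _; rewrite distrC.
    apply: le_trans (ler_pM (Xnorm2_ge0 (iD n)) (normr_ge0 _) h2 h3) _.
    apply: (@le_trans _ _ ((TD + 1) * ((e / 2) ^+ 2 / (TD + 1)))).
      by rewrite ler_wpM2r ?(ltW dl0)// lerDl.
    by rewrite mulrC divfK// gt_eqF// ltr_wpDl.
  rewrite /nw -[wr (D n) y](subrK (wr (D n) x)); apply: le_trans (ler_normD _ _) _.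
  by rewrite [e]splitr; exact: lerD h4 h1.
apply: filterS key => n h x xA; apply: h => /=.
by rewrite in_itv/= -ler_norml.
Unshelve. all: by end_near. Qed.

(** On a large interval [nw (D n)] is uniformly small; outside it [nw z] has small L^2 norm while
    [nw (D n)] stays bounded in L^2. Each region contributes [e / 2]. *)
Lemma ip_nwD_cvg0 : ip (nw z) (nw (D n)) @[n --> U] --> 0.
Proof.
apply/cvgrPdist_le => e e0; have e2 : 0 < e / 2 by rewrite divr_gt0.
have TD0 : 0 <= TD by rewrite addr_ge0// mulr_ge0// Xnorm2_ge0.
have e3 : 0 < (e / 2) ^+ 2 / (TD + 1) by rewrite divr_gt0 ?exprn_gt0// ltr_wpDl.
have [A hA] := ip_nw_tail gz e3.
pose ii : R -> R := ind (- A%:R) A%:R.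
have Lz := L2_nw iz.
have Li : L2 ii by exact: L2_ind.
pose q := ip (nw z) ii.
have q0 : 0 <= q.
  by apply: RI_ge0 => x; rewrite mulr_ge0 ?nw_ge0//; have /andP[] := ind_itv A x.
have e4 : 0 < e / 2 / (q + 1) by rewrite divr_gt0// ltr_wpDl.
have Lt : L2 (fun x => nw z x * (1 - ii x)).
  split; first by apply: measurable_funM; [exact: L2_measurable|apply: measurable_funB => //; exact: L2_measurable].
  apply: (intg_le (g := fun x => nw z x ^+ 2)).
  - apply: measurable_funX; apply: measurable_funM; first exact: L2_measurable.
    by apply: measurable_funB => //; exact: L2_measurable.
  - exact: L2_intg_sqr.
  - move=> x; have /andP[h1 h2] := ind_itv A x; have h3 := nw_ge0 z x.
    rewrite ger0_norm ?sqr_ge0// lerXn2r ?nnegrE ?mulr_ge0 ?subr_ge0//.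
    by rewrite ler_piMr// gerBl.
near=> n.
have hX : X (D n) <= TD by near: n; exact: XD.
have hU : forall x, `|x| <= A%:R + 1 -> nw (D n) x <= e / 2 / (q + 1).
  by near: n; exact: nwD_unif.
have LD := L2_nw (iD n).
have ip0 : 0 <= ip (nw z) (nw (D n)) by apply: RI_ge0 => x; rewrite mulr_ge0 ?nw_ge0.
rewrite sub0r normrN ger0_norm//.
pose f1 x := (e / 2 / (q + 1)) * (nw z x * ii x).
have I1 : intg f1 by apply: intgZ; exact: L2_mul.
have I2 : intg (fun x => nw z x * (1 - ii x) * nw (D n) x) by exact: L2_mul.
apply: (@le_trans _ _ (RI (fun x => f1 x + nw z x * (1 - ii x) * nw (D n) x))).
  apply: RI_le => [||x]; [exact: L2_mul|exact: intgD|].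
  have /andP[h1 h2] := ind_itv A x; rewrite -/(ii x) in h1 h2.
  have h3 := nw_ge0 z x; have h4 := nw_ge0 (D n) x.
  have h5 : nw z x * ii x * nw (D n) x <= f1 x.
    rewrite /f1 mulrC; have [xA|xA] := leP `|x| (A%:R + 1).
      by apply: ler_wpM2r; [rewrite mulr_ge0|exact: hU].
    by rewrite /ii ind_out ?mulr0.
  have -> : nw z x * nw (D n) x = nw z x * ii x * nw (D n) x + nw z x * (1 - ii x) * nw (D n) x by ring.
  by rewrite lerD2r.
rewrite RID// [e]splitr; apply: lerD.
  rewrite /f1 RIZ; last exact: L2_mul.
  rewrite -/(ip (nw z) ii) -/q; apply: (@le_trans _ _ (e / 2 / (q + 1) * (q + 1))).
    by rewrite ler_wpM2l ?(ltW e4)// lerDl.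
  by rewrite divfK// gt_eqF// ltr_wpDl.
apply: le_trans (ler_norm _) _.
rewrite -(ler_pXn2r (ltn0Sn 1)) ?nnegrE ?(ltW e2)// real_normK ?num_real//.
apply: le_trans (ip_CS Lt LD) _.
apply: (@le_trans _ _ ((e / 2) ^+ 2 / (TD + 1) * (TD + 1))); last first.
  by rewrite divfK// gt_eqF// ltr_wpDl.
apply: ler_pM; rewrite ?ip_ge0//.
by apply: le_trans (ip_nw (iD n)) (le_trans hX _); rewrite lerDl.
Unshelve. all: by end_near. Qed.

(** The Brezis-Lieb error is a constant times [ip (nw z) (nw (D n))], which tends to 0. *)
Lemma KH_split (H : 'rV[R]_4 -> R) : C1 H -> H 0 = 0 ->
  (forall w i, `|pd i H w| <= kap `|w| * `|w|) ->
  KH H (Phi n) - KH H z - KH H (D n) @[n --> U] --> 0.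
Proof.
move=> cH H0 Hpd; pose r := Num.sqrt (2 * (TD + X z)).
have TD0 : 0 <= TD by rewrite addr_ge0// mulr_ge0// Xnorm2_ge0.
pose M := 32 * kap (6 * r).
have hM : M * ip (nw z) (nw (D n)) @[n --> U] --> M * 0.
  by apply: cvgM; [exact: cvg_cst|exact: ip_nwD_cvg0].
rewrite mulr0 in hM; apply/cvgrPdist_le => e e0.
have /cvgrPdist_le/(_ _ e0) hMe := hM.
apply: (filterS2 _ _ XD hMe) => n hn; rewrite !sub0r !normrN => hMn.
have -> : Phi n = Xlin 1 1 z (D n) by exact: Xlin_addK.
apply: le_trans (KH_brezis_lieb (r := r) cH H0 (nl_kap_ge0 NL) (nl_kap_le NL) Hpd gz (gD n) _ _) _.
- by apply: sub_sqrt_bound => //; rewrite lerDr.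
- by apply: sub_sqrt_bound => //; apply: le_trans hn _; rewrite lerDl Xnorm2_ge0.
exact: le_trans (ler_norm _) hMn.
Qed.

Lemma B_split : B (Phi n) (Phi n) - B z z - B (D n) (D n) @[n --> U] --> 0.
Proof.
have -> : (fun n => B (Phi n) (Phi n) - B z z - B (D n) (D n)) =
  (fun n => 2 * (B (Phi n) z - B z z)).
  apply/funext => n; rewrite B_lin_sqr//; ring.
have h : 2 * (B (Phi n) z - B z z) @[n --> U] --> 2 * (B z z - B z z).
  apply: cvgM; first exact: cvg_cst.
  by apply: cvgB; [exact: Bz|exact: cvg_cst].
by move: h; rewrite subrr mulr0.
Qed.

Hypothesis PPhi : forall n, Pf (Phi n) = 0.
Hypothesis JPhi : J (Phi n) @[n --> U] --> Sr.
Hypothesis eps0 : 0 < eps.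
Hypothesis nwPhi : forall n, eps <= nw (Phi n) 0.

Lemma X_weak_limit_neq0 : X z != 0.
Proof.
have h : wr (Phi n) 0 @[n --> U] --> wr z 0.
  apply: cvg_rv => i; rewrite wrE.
  have -> : (fun n => wr (Phi n) 0 0 i) = (fun n => wv (Phi n) i 0).
    by apply/funext => n; rewrite wrE.
  exact: wv_cvg.
have ge : eps <= nw z 0 by apply: (cvgr_to_ge (cvg_norm h)); exact: nearW.
apply/eqP => X0; have := le_trans ge (nw_sup 0 gz).
by rewrite X0 mulr0 sqrtr0 leNgt eps0.
Qed.

Lemma Pf_split : Pf (D n) @[n --> U] --> - Pf z.
Proof.
have h : KH (Gof F) (Phi n) - KH (Gof F) z - KH (Gof F) (D n) -
   (B (Phi n) (Phi n) - B z z - B (D n) (D n)) @[n --> U] --> 0 - 0.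
  by apply: cvgB; [exact: (KH_split (nl_C1G NL) G0 (nl_pdG NL))|exact: B_split].
have E1 : (fun n => Pf (D n)) = (fun n => (KH (Gof F) (Phi n) - KH (Gof F) z - KH (Gof F) (D n) -
   (B (Phi n) (Phi n) - B z z - B (D n) (D n))) - Pf z).
  apply/funext => n; have := PPhi n; rewrite !Pf_E// => h0.
  exact: arith_split h0.
have -> : - Pf z = 0 - 0 - Pf z by rewrite subr0 sub0r.
rewrite E1; exact: (@cvgB _ _ _ U _ _ _ _ _ h (cvg_cst (Pf z))).
Qed.

Lemma J_split : J (D n) @[n --> U] --> Sr - J z.
Proof.
have hK := KH_split (nl_C1 NL) (nl_F0 NL) (nl_pd NL).
have hB : 2^-1 * (B (Phi n) (Phi n) - B z z - B (D n) (D n)) @[n --> U] --> (2^-1 * 0 : R).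
  by apply: cvgM; [exact: cvg_cst|exact: B_split].
have h : J (Phi n) - (2^-1 * (B (Phi n) (Phi n) - B z z - B (D n) (D n)) -
   (KH F (Phi n) - KH F z - KH F (D n))) @[n --> U] --> (Sr - (2^-1 * 0 - 0) : R).
  by apply: cvgB; [exact: JPhi|apply: cvgB; [exact: hB|exact: hK]].
rewrite mulr0 !subr0 in h.
have E1 : (fun n => J (D n)) = (fun n => J (Phi n) - (2^-1 * (B (Phi n) (Phi n) - B z z - B (D n) (D n)) -
   (KH F (Phi n) - KH F z - KH F (D n))) - J z).
  by apply/funext => n; rewrite !J_E//; exact: arith_splitJ.
rewrite E1; exact: (@cvgB _ _ _ U _ _ _ _ _ h (cvg_cst (J z))).
Qed.

Lemma weak_limit_minimizer : [/\ Pf z = 0, J z = Sr & X (D n) @[n --> U] --> 0].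
Proof.
have Xz := X_weak_limit_neq0.
have Bz0 : 0 < B z z.
  by apply: lt_le_trans (Bcoer iz); rewrite mulr_gt0// lt_neqAle eq_sym Xz Xnorm2_ge0.
have Ez0 : 0 < E z by apply: lt_le_trans (action_ge gz); rewrite mulr_gt0.
have cE : E (D n) @[n --> U] --> Sr - E z.
  have h : J (D n) - Pf (D n) * k^-1 @[n --> U] --> Sr - J z - (- Pf z) * k^-1.
    by apply: cvgB; [exact: J_split|apply: cvgM; [exact: Pf_split|exact: cvg_cst]].
  have -> : Sr - E z = Sr - J z - (- Pf z) * k^-1 by rewrite /action; ring.
  exact: h.
have ED0 n : 0 <= E (D n).
  by apply: le_trans (action_ge (gD n)); rewrite mulr_ge0 ?B_ge0// ltW.
have Ezle : E z <= Sr by rewrite -subr_ge0; apply: (cvgr_to_ge cE); exact: nearW.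
have Pz : Pf z = 0.
  (* If [Pf z > 0], eventually [Pf (D n) < 0], so [E (D n)] exceeds [Sr] although its limit is
     [Sr - E z]. If [Pf z < 0], then [E z > Sr], against [Ezle]. *)
  apply/eqP; rewrite eq_le; apply/andP; split; rewrite leNgt; apply/negP => hP.
    have hn : \forall n \near U, Pf (D n) < 0.
      by apply: (cvgr_lt _ Pf_split); rewrite oppr_lt0.
    have : Sr <= Sr - E z.
      apply: (cvgr_to_ge cE); apply: filterS hn => n hn.
      exact: ltW (Pf_neg_action (gD n) hn).
    by rewrite lerBrDr gerDl leNgt Ez0.
  by have := lt_le_trans (Pf_neg_action gz hP) Ezle; rewrite ltxx.
have EJ : E z = J z by rewrite /action Pz mul0r subr0.
have Jz : J z = Sr.
  apply/eqP; rewrite eq_le; apply/andP; split; first by rewrite -EJ.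
  exact: Sr_le.
split => //.
have cE0 : E (D n) @[n --> U] --> 0 by move: cE; rewrite EJ Jz subrr.
have kd : 0 < kc * d by rewrite mulr_gt0.
have h : (kc * d)^-1 * E (D n) @[n --> U] --> ((kc * d)^-1 * 0 : R).
  by apply: cvgM => //; exact: cvg_cst.
rewrite mulr0 in h; apply: (squeeze_cvgr _ (cvg_cst 0) h); apply: nearW => n.
apply/andP; split; first exact: Xnorm2_ge0.
by apply: arith_divl kc0 d0 (Bcoer (iD n)) (action_ge (gD n)).
Qed.

End WeakLimit.

End Compactness.

(** * Invariance under translation and change of representative *)

Lemma J_shift y P : inX P -> J (Xshift y P) = J P.
Proof.
move=> iP; have iS : inX (Xshift y P) by case: iP => ? ?; split; exact: inH2_shift.
apply: etrans (J_E iS) _; apply: etrans _ (esym (J_E iP)).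
apply: (congr2 (fun x y => x / 2 - y)); first exact: qB_shift.
exact: (KH_shift y (C1_continuous (nl_C1 NL)) iP).
Qed.

Lemma Pf_shift y P : inX P -> Pf (Xshift y P) = Pf P.
Proof.
move=> iP; have iS : inX (Xshift y P) by case: iP => ? ?; split; exact: inH2_shift.
apply: etrans (Pf_E iS) _; apply: etrans _ (esym (Pf_E iP)).
apply: (congr2 (fun x y => x - y)); first exact: qB_shift.
exact: (KH_shift y (C1_continuous (nl_C1G NL)) iP).
Qed.

Lemma J_ae P Q : inX P -> inX Q -> eqX P Q -> J P = J Q.
Proof.
move=> iP iQ PQ; apply: etrans (J_E iP) _; apply: etrans _ (esym (J_E iQ)).
apply: (congr2 (fun x y => x / 2 - y)); first exact: qB_ae.
exact: (KH_ae (C1_continuous (nl_C1 NL)) iP iQ PQ).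
Qed.

Lemma Pf_ae P Q : inX P -> inX Q -> eqX P Q -> Pf P = Pf Q.
Proof.
move=> iP iQ PQ; apply: etrans (Pf_E iP) _; apply: etrans _ (esym (Pf_E iQ)).
apply: (congr2 (fun x y => x - y)); first exact: qB_ae.
exact: (KH_ae (C1_continuous (nl_C1G NL)) iP iQ PQ).
Qed.

(** If all values were below an [eps] with [kap eps <= d / 2], N would be at most half of [d * X P],
    whereas on the manifold it equals the form, which is at least [d * X P]. *)
Lemma nonvanishing : exists2 eps, 0 < eps & forall P, continuousX P -> Pf P = 0 -> X P != 0 ->
  exists y, eps <= nw P y.
Proof.
have d2 : 0 < d / 2 by rewrite divr_gt0.
have [eps e0 he] := nl_kap_small NL d2.
exists eps => // P gP PP XP; have iP := continuousX_inX gP.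
apply: contrapT => hn.
have h x : nw P x <= eps by rewrite leNgt; apply/negP => hx; apply: hn; exists x; exact: ltW.
have X0 : 0 < X P by rewrite lt_neqAle eq_sym XP Xnorm2_ge0.
have := N_le gP h; have := Bcoer iP; move: PP; rewrite Pf_E// => /eqP; rewrite subr_eq0 => /eqP <-.
move=> h1 h2; have := le_trans h1 (le_trans (ler_norm _) (le_trans h2 (ler_wpM2r (ltW X0) he))).
by rewrite ler_pM2r// leNgt ltr_pdivrMr// ltr_pMr// ltr1n.
Qed.

Lemma minimizing_bounded (u : nat -> Xt R) : (forall n, continuousX (u n)) -> (forall n, Pf (u n) = 0) ->
  J (u n) @[n --> \oo] --> Sr -> exists T, \forall n \near \oo, X (u n) <= T.
Proof.
move=> gu Pu Ju; exists ((Sr + 1) / (kc * d)).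
have kd : 0 < kc * d by rewrite mulr_gt0.
have /cvgrPdist_le/(_ _ ltr01) := Ju; apply: filterS => n hn.
rewrite ler_pdivlMr// mulrC -mulrA.
apply: (@le_trans _ _ (J (u n))); last first.
  by rewrite -lerBlDl; apply: le_trans (ler_norm _) _; rewrite distrC.
have := action_ge (gu n); rewrite /action Pu mul0r subr0; apply: le_trans.
by rewrite ler_wpM2l ?(ltW kc0)// Bcoer//; exact: continuousX_inX.
Qed.

End Variational.

Lemma Xnorm2_ae {R : realType} (P Q : Xt R) : inX P -> inX Q -> eqX P Q -> Xnorm2 P = Xnorm2 Q.
Proof.
have H (u v : H2t R) : inH2 u -> inH2 v -> eqH2 u v -> nsq u = nsq v.
  move=> /inH2_L2[? ? ?] /inH2_L2[? ? ?] [e0 [e1 e2]].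
  by rewrite /nsq e2 (ip_ae _ _ _ _ e0 e0)// (ip_ae _ _ _ _ e1 e1).
move=> iP iQ [e1 e2]; rewrite (Xnorm2E iP) (Xnorm2E iQ).
case: iP iQ => [p1 p2] [q1 q2].
by rewrite (H _ _ p1 q1 e1) (H _ _ p2 q2 e2).
Qed.

Lemma inX_shift {R : realType} (y : R) (P : Xt R) : inX P -> inX (Xshift y P).
Proof. by move=> [? ?]; split; exact: inH2_shift. Qed.

Lemma Xnorm2_shift {R : realType} (y : R) (P : Xt R) : inX P -> Xnorm2 (Xshift y P) = Xnorm2 P.
Proof.
have H (u : H2t R) : inH2 u -> nsq (H2shift y u) = nsq u.
  move=> /inH2_L2[L0 L1 L2].
  have e0 := ip_shift y L0 L0; have e1 := ip_shift y L1 L1; have e2 := ip_shift y L2 L2.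
  exact: (congr2 +%R (congr2 +%R e0 e1) e2).
move=> iP; rewrite (Xnorm2E iP) (Xnorm2E (inX_shift y iP)).
by case: iP => p1 p2; exact: (congr2 +%R (H _ p1) (H _ p2)).
Qed.

(** Every set of [U] meets every tail, since [U] contains the tails; so an index beyond the previous
    one with value below [1/(k+1)] can always be chosen. *)
Lemma subsequence_of_filter {R : realType} (U : set_system nat) {FU : ProperFilter U} (f : nat -> R) :
  \oo `<=` U -> f @ U --> 0 -> exists2 nk : nat -> nat,
    {homo nk : m n / (m < n)%N >-> (m < n)%N} & f (nk k) @[k --> \oo] --> 0.
Proof.
move=> ooU f0.
have ex (m k : nat) : exists n, (m < n)%N && (`|f n| < k.+1%:R^-1).
  have h1 : \forall n \near U, (m < n)%N by apply: ooU; exists m.+1.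
  have h2 : \forall n \near U, `|f n| < k.+1%:R^-1.
    have e0 : 0 < k.+1%:R^-1 :> R by rewrite invr_gt0.
    have /cvgrPdist_lt/(_ _ e0) := f0; apply: filterS => n.
    by rewrite sub0r normrN.
  by have [n [n1 n2]] := filter_ex (filterI h1 h2); exists n; apply/andP.
pose next m k := xchoose (ex m k).
pose nk := fix nk k := if k is j.+1 then next (nk j) j.+1 else next 0%N 0%N.
have nk_lt k : (nk k < nk k.+1)%N by have /andP[] := xchooseP (ex (nk k) k.+1).
have nk_f k : `|f (nk k)| < k.+1%:R^-1 
  by case: k => [|k]; [have /andP[] := xchooseP (ex 0%N 0%N)
    |have /andP[] := xchooseP (ex (nk k) k.+1)].
exists nk; first by apply: homo_ltn => //; exact: ltn_trans.
apply/cvgrPdist_lt => e e0; near=> k.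
rewrite sub0r normrN; apply: lt_trans (nk_f k) _.
near: k; exact: (near_infty_natSinv_lt (PosNum e0)).
Unshelve. all: by end_near. Qed.

Local Transparent wr.

(** * From representatives to the given minimizing sequence *)

Section Main.
Context {R : realType}.
Variables (a c a2 c2 b b2 om d C k Sr : R) (F : 'rV[R]_4 -> R) (kap : R -> R).

Local Notation B := (qB a c a2 c2 b b2 om).
Local Notation J := (Jom a c a2 c2 b b2 om F).
Local Notation Pf := (Pom a c a2 c2 b b2 om F).
Local Notation M := (Mom_nz a c a2 c2 b b2 om F).
Local Notation "P \- Q" := (Xlin 1 (-1) P Q).

Hypothesis d0 : 0 < d.
Hypothesis Bcoer : forall P, inX P -> d * Xnorm2 P <= B P P.
Hypothesis C0 : 0 < C.
Hypothesis Bupper : forall P, inX P -> B P P <= C * Xnorm2 P.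
Hypothesis NL : nonlinearity F k kap.

Lemma Mom_nz_rep P : M P -> exists Q, [/\ continuousX Q, eqX P Q, Pf Q = 0, Xnorm2 Q != 0 & J P = J Q].
Proof.
move=> [iP [PP XP]]; have [Q gQ PQ] := continuousX_rep iP; have iQ := continuousX_inX gQ.
exists Q; split; [exact: gQ|exact: PQ| | |].
- by rewrite -(Pf_ae a c a2 c2 b b2 om NL iP iQ PQ).
- by rewrite -(Xnorm2_ae iP iQ PQ).
- exact: (J_ae a c a2 c2 b b2 om NL iP iQ PQ).
Qed.

Lemma J_ge0 P : M P -> 0 <= J P.
Proof.
move=> /Mom_nz_rep[Q [gQ _ PQ _ ->]].
have := action_ge a c a2 c2 b b2 om NL gQ; rewrite /action PQ mul0r subr0; apply: le_trans.
have k0 : 0 < k by apply: lt_trans (nl_k NL).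
rewrite mulr_ge0 ?(B_ge0 d0 Bcoer (continuousX_inX gQ))//.
by rewrite subr_ge0 lef_pV2 ?posrE// ltW// (nl_k NL).
Qed.

(** Bounded below by 0 because J = E on the manifold, and above by the value at one of its
    elements. *)
Lemma Som_fin P : M P -> exists s, Som a c a2 c2 b b2 om F = s%:E.
Proof.
move=> MP; have le : (Som a c a2 c2 b b2 om F <= (J P)%:E)%E.
  by apply: ereal_inf_lbound; exists P.
have ge : (0 <= Som a c a2 c2 b b2 om F)%E.
  by apply: le_ereal_inf_tmp => _ [Q MQ <-]; rewrite lee_fin; exact: J_ge0.
by case: (Som _ _ _ _ _ _ _ _) le ge => // s _ _; exists s.
Qed.

Hypothesis SrE : Som a c a2 c2 b b2 om F = Sr%:E.

Lemma minimizing_continuousX (u : nat -> Xt R) : (forall n, continuousX (u n)) ->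
  (forall n, Pf (u n) = 0) -> (forall n, Xnorm2 (u n) != 0) -> J (u n) @[n --> \oo] --> Sr ->
  exists (nk : nat -> nat) (y : nat -> R) (z : Xt R),
    [/\ {homo nk : m n / (m < n)%N >-> (m < n)%N}, continuousX z, Xnorm2 z != 0, Pf z = 0 & J z = Sr /\
    Xnorm2 (Xshift (y k) (u (nk k)) \- z) @[k --> \oo] --> 0].
Proof.
move=> gu Pu Xu Ju.
have iu n := continuousX_inX (gu n).
have [eps e0 nonv] := nonvanishing d0 Bcoer NL.
have /choice[y hy] n := nonv _ (gu n) (Pu n) (Xu n).
have [T XT] := minimizing_bounded d0 Bcoer NL gu Pu Ju.
(* An ultrafilter finer than [\oo]: every limit and every eventual bound known for the sequence
   passes to it. *)
have [U [UU ooU]] := ultraFilterLemma (_ : ProperFilter (\oo : set_system nat)).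
have PU : ProperFilter U := @ultra_proper _ U UU.
pose Phi n := Xshift (y n) (u n).
have gPhi n : continuousX (Phi n) by exact: continuousX_shift.
have PPhi n : Pf (Phi n) = 0 by rewrite (Pf_shift a c a2 c2 b b2 om NL (y n) (iu n)).
have JPhi : J (Phi n) @[n --> U] --> Sr.
  have -> : (fun n => J (Phi n)) = (fun n => J (u n)).
    by apply/funext => n; rewrite (J_shift a c a2 c2 b b2 om NL (y n) (iu n)).
  by move=> V /Ju h; exact: ooU.
have XPhi : \forall n \near U, Xnorm2 (Phi n) <= T.
  by apply: ooU; apply: filterS XT => n; rewrite (Xnorm2_shift (y n) (iu n)).
have nwPhi n : eps <= `|wr (Phi n) 0|.
  have -> : wr (Phi n) 0 = wr (u n) (y n) by rewrite /wr /= /h0 /h1 /= add0r.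
  exact: hy.
have [z gz Bz] := weak_limit d0 Bcoer C0 Bupper gPhi XPhi.
have Xz := X_weak_limit_neq0 d0 Bcoer Bupper gPhi gz Bz e0 nwPhi.
have [Pz Jz Dz] := weak_limit_minimizer d0 Bcoer C0 Bupper NL SrE gPhi XPhi gz Bz PPhi JPhi e0 nwPhi.
have [nk nki hnk] := subsequence_of_filter ooU Dz.
exists nk, (y \o nk), z; split; [exact: nki|exact: gz|exact: Xz|exact: Pz|].
by split; [exact: Jz|exact: hnk].
Qed.

Lemma minimizer_critical z Phi : continuousX z -> Pf z = 0 -> Xnorm2 z != 0 -> J z = Sr -> inX Phi ->
  is_derive (0 : R) (1 : R) (fun t : R => J (Xlin 1 t z Phi)) (0 : R).
Proof.
move=> gz Pz Xz Jz iPhi; have [D gD PD] := continuousX_rep iPhi.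
have -> : (fun t : R => J (Xlin 1 t z Phi)) = (fun t => J (Xlin 1 t z D)).
  apply/funext => t; apply: (J_ae a c a2 c2 b b2 om NL); last by apply: eqX_lin => //; exact: eqX_refl.
  - exact: inX_lin (continuousX_inX gz) iPhi.
  - exact: inX_lin (continuousX_inX gz) (continuousX_inX gD).
exact: (J_critical d0 Bcoer C0 Bupper NL SrE gz Pz Xz Jz gD).
Qed.

End Main.

Theorem theorem1p1 (R : realType) (a c a2 c2 b b2 om : R)
  (F : 'rV[R]_4 -> R) (Psi : nat -> Xt R) :
  a < 0 -> c < 0 -> 0 < a2 -> 0 < c2 -> 0 < b -> 0 < b2 ->
  0 < `|om| -> `|om| < 1 -> `|om| < - a / b -> `|om| < - c / b ->
  `|om| < a2 / b2 -> `|om| < c2 / b2 ->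
  C2 F -> F 0 = 0 -> condA F -> condB F -> condC F ->
  (forall n, Mom_nz a c a2 c2 b b2 om F (Psi n)) ->
  (fun n => (Jom a c a2 c2 b b2 om F (Psi n))%:E) @ \oo
     --> Som a c a2 c2 b b2 om F ->
  exists (nk : nat -> nat) (y : nat -> R) (Psi0 : Xt R),
    {homo nk : m n / (m < n)%N >-> (m < n)%N} /\
    Mom_nz a c a2 c2 b b2 om F Psi0 /\
    (fun k => Xnorm2 (Xlin 1 (-1) (Xshift (y k) (Psi (nk k))) Psi0)) @ \oo --> 0 /\
    (Jom a c a2 c2 b b2 om F Psi0)%:E = Som a c a2 c2 b b2 om F /\
    (forall Phi : Xt R, inX Phi ->
       is_derive (0 : R) (1 : R) (fun t : R => Jom a c a2 c2 b b2 om F (Xlin 1 t Psi0 Phi)) (0 : R)).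
Proof.
move=> a0 c0 a20 c20 b0 b20 _ om1 oma omc oma2 omc2 F2 F0 [p [p0 hA]] [q1 [q2 [C [q10 [q12 [C0 hB]]]]]] _ MPsi JPsi.
have NL := nonlinearityP F2 F0 p0 hA q10 q12 C0 hB.
have [d d0 Bcoer] := qB_coercive b0 b20 om1 oma omc oma2 omc2.
have [Cu Cu0 Bupper] := qB_upper om a0 c0 a20 c20 b0 b20.
have [Sr SrE] := Som_fin d0 Bcoer NL (MPsi 0%N).
have JPsiR : Jom a c a2 c2 b b2 om F (Psi n) @[n --> \oo] --> Sr.
  by rewrite SrE in JPsi; exact: (fine_cvg JPsi).
have /choice[u hu] n := Mom_nz_rep NL (MPsi n).
have gu n : continuousX (u n) by have [] := hu n.
have uE n : eqX (Psi n) (u n) by have [] := hu n.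
have Pu n : Pom a c a2 c2 b b2 om F (u n) = 0 by have [] := hu n.
have Xu n : Xnorm2 (u n) != 0 by have [] := hu n.
have Ju : Jom a c a2 c2 b b2 om F (u n) @[n --> \oo] --> Sr.
  have <- : (fun n => Jom a c a2 c2 b b2 om F (Psi n)) = (fun n => Jom a c a2 c2 b b2 om F (u n)).
    by apply/funext => n; have [] := hu n.
  exact: JPsiR.
have [nk [y [z [nki gz Xz Pz [Jz uz]]]]] :=
  minimizing_continuousX d0 Bcoer Cu0 Bupper NL SrE gu Pu Xu Ju.
have iz := continuousX_inX gz.
exists nk, y, z; split; first exact: nki.
split; first by split; [exact: iz|split; [exact: Pz|exact: Xz]].
split; last first.
  split; first by rewrite SrE Jz.
  by move=> Phi; exact: (minimizer_critical d0 Bcoer Cu0 Bupper NL SrE).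
(* The indices and translations found for the representatives serve the original sequence, since
   shifts and linear combinations respect equality almost everywhere. *)
have -> : (fun k => Xnorm2 (Xlin 1 (-1) (Xshift (y k) (Psi (nk k))) z)) =
   (fun k => Xnorm2 (Xlin 1 (-1) (Xshift (y k) (u (nk k))) z)); last exact: uz.
apply/funext => k; apply: Xnorm2_ae.
- by apply: inX_lin iz; apply: inX_shift; have [] := MPsi (nk k).
- by apply: inX_lin iz; apply: inX_shift; exact: continuousX_inX.
- by apply: eqX_lin (eqX_refl _); exact: eqX_shift.
Qed.
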